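(* Let $R$ be a Dedekind domain with torsion class group $\operatorname{Cl}(R)$ and let $\mathcal O\subseteq R$ be an order with conductor $\mathfrak f$ such that $R/\mathfrak f$ is finite. (1) Suppose that $|\operatorname{Cl}(R)|\neq 2$ and that every class of $\operatorname{Cl}(R)$ contains a prime ideal of $R$ coprime to $\mathfrak f$. Then $\mathcal O$ is transfer Krull if and only if the following two conditions hold: (a) $\mathcal O\cdot R^\times=R$; (b) $\mathsf v_{\mathfrak p}(u)=1$ for all $\mathfrak p\in\operatorname{Spec}(\mathcal O)$ and all atoms $u\in\mathcal O_{\mathfrak p}$. Moreover, if $\mathcal O$ is transfer Krull, then the inclusion $\mathcal O^\bullet\hookrightarrow R^\bullet$ is a transfer homomorphism, and there is a transfer homomorphism $\theta\colon\mathcal O^\bullet\to\mathcal B(\operatorname{Cl}(R))$, where $\mathcal B(\operatorname{Cl}(R))$ is the monoid of zero-sum sequences over $\operatorname{Cl}(R)$. (2) Suppose that $|\operatorname{Cl}(R)|=2$ and that every class of $\operatorname{Pic}(\mathcal O)$ contains a prime ideal coprime to $\mathfrak f$. Then $\mathcal O$ is transfer Krull if and only if the following two conditions hold: (a) $\mathcal O\cdot R^\times=R$; (b) $\mathsf v_{\mathfrak p}(u)\in\{1,2\}$ for all $\mathfrak p\in\operatorname{Spec}(\mathcal O)$ and all atoms $u\in\mathcal O_{\mathfrak p}$, and if the prime ideal of $R$ lying over $\mathfrak p$ is principal, then $\mathsf v_{\mathfrak p}(u)=1$ for all atoms $u\in\mathcal O_{\mathfrak p}$.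
   Context: A monoid is a commutative cancellative semigroup with identity. For a monoid $H$, $H^\times$ is its group of units, $\mathsf q(H)$ its quotient group, and $a\sim_H b$ means $a=\varepsilon b$ for some $\varepsilon\in H^\times$. An atom is a non-unit that is not a product of two non-units. For a domain $D$, $D^\bullet=D\setminus\{0\}$ is its multiplicative monoid, and monoid-theoretic notions are applied to $D$ via $D^\bullet$ (e.g. the atoms of $D$ are the atoms of $D^\bullet$; $D$ is transfer Krull if $D^\bullet$ is). A monoid homomorphism $\theta\colon H\to B$ is a transfer homomorphism if (T1) $B=\theta(H)\cdot B^\times$ and $\theta^{-1}(B^\times)=H^\times$; and (T2) whenever $u\in H$, $b,c\in B$ and $\theta(u)=bc$, there exist $v,w\in H$ with $u=vw$, $\theta(v)\sim_B b$ and $\theta(w)\sim_B c$. A monoid $H$ is Krull if it is completely integrally closed (every $x\in\mathsf q(H)$ for which there is $c\in H$ with $cx^n\in H$ for all $n\in\mathbb N$ lies in $H$) and satisfies the ascending chain condition on $v$-ideals (divisorial ideals). A monoid $H$ is transfer Krull if there exist a Krull monoid $B$ and a transfer homomorphism $H\to B$. For an additive abelian group $G$, $\mathcal B(G)$ is the submonoid of the (multiplicative) free abelian monoid $\mathcal F(G)$ with basis $G$ consisting of all formal products $g_1\cdots g_n$ with $g_1+\dots+g_n=0$ in $G$. An order in a Dedekind domain $R$ is a subring $\mathcal O\subseteq R$ with the same quotient field such that $R$ is a finitely generated $\mathcal O$-module; its conductor is $\mathfrak f=\{x\in R: xR\subseteq\mathcal O\}$, the greatest ideal of $R$ contained in $\mathcal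 O$. $\operatorname{Pic}(\mathcal O)$ is the Picard group of $\mathcal O$ (invertible ideals modulo principal ideals). $\mathcal O\cdot R^\times=\{a\varepsilon: a\in\mathcal O,\varepsilon\in R^\times\}$. If $\mathfrak p$ is a nonzero prime ideal of $\mathcal O$ such that exactly one prime ideal $P$ of $R$ lies over $\mathfrak p$, then the integral closure $\overline{\mathcal O_{\mathfrak p}}$ of the localization $\mathcal O_{\mathfrak p}$ is a DVR and $\mathsf v_{\mathfrak p}$ denotes its normalized valuation, i.e. the $P$-adic valuation. (Condition (a) implies that exactly one prime ideal of $R$ lies over each $\mathfrak p$, so that condition (b) is meaningful in the presence of (a). For $\mathfrak p=0$ there are no atoms and the condition is void.) *)

(* Defs.v *)
(* Throughout, K is a field and a domain with quotient field K
   is given as a subring D : subringClosed K; its ideals, fractional ideals and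
   overrings are subsets of K. *)
From HB Require Import structures.
From mathcomp Require Import all_boot all_order all_algebra.
From mathcomp Require Import ring finmap multiset.
From mathcomp Require Import boolp classical_sets cardinality.
Set Implicit Arguments.
Unset Strict Implicit.
Unset Printing Implicit Defensive.
Import GRing.Theory.
Local Open Scope quotient_scope.
Local Open Scope classical_set_scope.
Local Open Scope card_scope.

HB.mixin Record Monoid_isCancelCom H of Monoid H := {
  cmulgC : commutative (@monoid.mul H);
  cmulgI : right_injective (@monoid.mul H)
}.

#[short(type="cmonoidType")]
HB.structure Definition CMonoid := {H of Monoid H & Monoid_isCancelCom H}.

Section MonoidTheory.
Local Open Scope group_scope.
Variable H : cmonoidType.
Implicit Types x y u v w : H.

Definition munit x := exists y, x * y = 1.

Definition massoc x y := exists2 e, munit e & x = e * y.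

Definition atom u :=
  ~ munit u /\ forall v w, u = v * w -> munit v \/ munit w.

Lemma cmulgACA : interchange (@monoid.mul H) (@monoid.mul H).
Proof.
by move=> x y z t; rewrite -!mulgA; congr (_ * _); rewrite !mulgA (cmulgC y).
Qed.

Let qequiv (p q : H * H) := p.1 * q.2 == q.1 * p.2.

Let qequiv_equiv : equiv_class_of qequiv.
Proof.
split=> [p|p q|p q r]; rewrite /qequiv; [by []|by rewrite eq_sym|].
move=> /eqP qp /eqP pr; apply/eqP/(@cmulgI H p.2).
by rewrite mulgA (cmulgC p.2 q.1) qp (cmulgC p.1) -mulgA pr mulgA cmulgC
           (cmulgC q.2).
Qed.

Canonical qgroup_equiv := EquivRelPack qequiv_equiv.
Canonical qgroup_encModRel := defaultEncModRel qequiv.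

(* The quotient group q(H): pairs (a, b), read as a / b, with
   (a, b) ~ (c, d) iff ad = cb. *)
Definition qgroup := {eq_quot qequiv}.
HB.instance Definition _ := EqQuotient.on qgroup.
HB.instance Definition _ := Choice.on qgroup.

Definition qfrac x y : qgroup := \pi_qgroup (x, y).

Lemma qfracP x y z t : (qfrac x y = qfrac z t) <-> x * t = z * y.
Proof.
split=> [/eqP|e]; first by rewrite /qfrac piE => /eqP.
by apply/eqP; rewrite /qfrac piE; apply/eqP.
Qed.

Lemma qfrac_repr (q : qgroup) : qfrac (repr q).1 (repr q).2 = q.
Proof. by rewrite /qfrac -surjective_pairing reprK. Qed.

Lemma qgroupP (q : qgroup) : exists x y, q = qfrac x y.
Proof. by exists (repr q).1, (repr q).2; rewrite qfrac_repr. Qed.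

Definition qmul (p q : qgroup) : qgroup :=
  qfrac ((repr p).1 * (repr q).1) ((repr p).2 * (repr q).2).
Definition qinv (q : qgroup) : qgroup := qfrac (repr q).2 (repr q).1.

Lemma qmulE x y z t : qmul (qfrac x y) (qfrac z t) = qfrac (x * z) (y * t).
Proof.
have /qfracP e1 := qfrac_repr (qfrac x y).
have /qfracP e2 := qfrac_repr (qfrac z t).
by apply/qfracP; rewrite cmulgACA e1 e2 cmulgACA.
Qed.

Lemma qinvE x y : qinv (qfrac x y) = qfrac y x.
Proof.
have /qfracP e := qfrac_repr (qfrac x y).
by apply/qfracP; rewrite cmulgC -e cmulgC.
Qed.

Fact qmulA : associative qmul.
Proof.
move=> p q r; have [x [y ->]] := qgroupP p; have [z [t ->]] := qgroupP q.
by have [a [b ->]] := qgroupP r; rewrite !qmulE !mulgA.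
Qed.
Fact qmulC : commutative qmul.
Proof.
move=> p q; have [x [y ->]] := qgroupP p; have [z [t ->]] := qgroupP q.
by rewrite !qmulE (cmulgC x) (cmulgC y).
Qed.
Fact qmul1 : left_id (qfrac 1 1) qmul.
Proof. by move=> p; have [x [y ->]] := qgroupP p; rewrite qmulE !mul1g. Qed.
Fact qmulr1 : right_id (qfrac 1 1) qmul.
Proof. by move=> p; rewrite qmulC qmul1. Qed.
Fact qmulV : left_inverse (qfrac 1 1) qinv qmul.
Proof.
move=> p; have [x [y ->]] := qgroupP p; rewrite qinvE qmulE.
by apply/qfracP; rewrite mulg1 mul1g cmulgC.
Qed.
Fact qmulrV : right_inverse (qfrac 1 1) qinv qmul.
Proof. by move=> p; rewrite qmulC qmulV. Qed.

HB.instance Definition _ :=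
  isGroup.Build qgroup qmulA qmul1 qmulr1 qmulV qmulrV.

Definition qinj x : qgroup := qfrac x 1.

Definition completely_integrally_closed :=
  forall q : qgroup,
    (exists c : H, forall n : nat, range qinj (qinj c * q ^+ n)) ->
    range qinj q.

(* X^{-1} = (H : X), and X_v = (X^{-1})^{-1} *)
Definition qdual (X : set qgroup) : set qgroup :=
  [set q | forall p, X p -> range qinj (q * p)].

Definition v_ideal (X : set qgroup) :=
  X `<=` range qinj /\ qdual (qdual X) = X.

Definition acc_v_ideals :=
  forall I : nat -> set qgroup,
    (forall n, v_ideal (I n)) -> (forall n, I n `<=` I n.+1) ->
    exists N, forall n, N <= n -> I n = I N.

Definition krull := completely_integrally_closed /\ acc_v_ideals.

End MonoidTheory.

Section Transfer.
Local Open Scope group_scope.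
Variables H B : cmonoidType.

Definition transfer_hom (theta : H -> B) :=
  [/\ monoid.monoid_morphism theta,
      (forall b, exists u e, munit e /\ b = theta u * e)
        /\ (forall u, munit (theta u) <-> munit u) &
      forall u b c, theta u = b * c ->
        exists v w, [/\ u = v * w, massoc (theta v) b & massoc (theta w) c] ].

End Transfer.

Definition transfer_krull (H : cmonoidType) :=
  exists (B : cmonoidType) (theta : H -> B), krull B /\ transfer_hom theta.

Section ZeroSum.
Local Open Scope ring_scope.
Variable G : zmodType.

(* The free abelian monoid F(G), in multiplicative notation, is {mset G} with
   multiset sum as its product. *)
Definition msum (S : {mset G}%mset) : G := \sum_(g <- S) g.

Record zerosum :=
  ZeroSum { zseq : {mset G}%mset; zseqP : msum zseq == 0 }.
HB.instance Definition _ := [isSub for zseq].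
HB.instance Definition _ := [Choice of zerosum by <:].

Lemma msumD S T : msum (msetD S T) = msum S + msum T.
Proof.
rewrite /msum -big_cat; apply: perm_big; apply/allP => g _ /=.
by rewrite count_cat !count_mem_mset msetE2.
Qed.

Fact zs_one : msum mset0 == 0.
Proof. by rewrite /msum big_mset0. Qed.
Fact zs_mul (S T : zerosum) : msum (msetD (zseq S) (zseq T)) == 0.
Proof. by rewrite msumD (eqP (zseqP S)) (eqP (zseqP T)) addr0. Qed.

Definition zsmul S T := ZeroSum (zs_mul S T).
Definition zsone := ZeroSum zs_one.

Fact zsmulA : associative zsmul.
Proof. by move=> S T U; apply/val_inj/msetDA. Qed.
Fact zsmulC : commutative zsmul.
Proof. by move=> S T; apply/val_inj/msetDC. Qed.
Fact zsmul1 : left_id zsone zsmul.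
Proof. by move=> S; apply/val_inj/mset0D. Qed.
Fact zsmulr1 : right_id zsone zsmul.
Proof. by move=> S; apply/val_inj/msetD0. Qed.
Fact zsmulI : right_injective zsmul.
Proof. by move=> S T U /(congr1 zseq)/(can_inj (msetDKB (zseq S)))/val_inj. Qed.

HB.instance Definition _ := isMonoid.Build zerosum zsmulA zsmul1 zsmulr1.
HB.instance Definition _ := Monoid_isCancelCom.Build zerosum zsmulC zsmulI.

End ZeroSum.

Section Domains.
Local Open Scope ring_scope.
Variable K : fieldType.
Implicit Types (D E : subringClosed K) (I J P : set K).

Section Dot.
Variable D : subringClosed K.

(* D \ {0} *)
Record dot := Dot { dotval :> K; dotP : (dotval \in D) && (dotval != 0) }.
HB.instance Definition _ := [isSub for dotval].
HB.instance Definition _ := [Choice of dot by <:].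

Fact dot_one : (1 \in D) && (1 != 0 :> K).
Proof. by rewrite rpred1 oner_neq0. Qed.
Fact dot_mul (x y : dot) : (val x * val y \in D) && (val x * val y != 0).
Proof.
case/andP: (dotP x) => xD x0; case/andP: (dotP y) => yD y0.
by rewrite rpredM // mulf_neq0.
Qed.

Definition dotmul x y := Dot (dot_mul x y).
Definition dotone := Dot dot_one.

Fact dotmulA : associative dotmul.
Proof. by move=> x y z; apply/val_inj/mulrA. Qed.
Fact dotmulC : commutative dotmul.
Proof. by move=> x y; apply/val_inj/mulrC. Qed.
Fact dotmul1 : left_id dotone dotmul.
Proof. by move=> x; apply/val_inj/mul1r. Qed.
Fact dotmulr1 : right_id dotone dotmul.
Proof. by move=> x; apply/val_inj/mulr1. Qed.
Fact dotmulI : right_injective dotmul.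
Proof.
move=> x y z /(congr1 dotval)/= /mulfI e; apply/val_inj/e.
by case/andP: (dotP x).
Qed.

HB.instance Definition _ := isMonoid.Build dot dotmulA dotmul1 dotmulr1.
HB.instance Definition _ := Monoid_isCancelCom.Build dot dotmulC dotmulI.

End Dot.

Fact dot_incl_subproof D E (sDE : {subset D <= E}) (x : dot D) :
  (val x \in E) && (val x != 0).
Proof. by case/andP: (dotP x) => /sDE-> ->. Qed.

Definition dot_incl D E (sDE : {subset D <= E}) (x : dot D) : dot E :=
  Dot (dot_incl_subproof sDE x).

Definition is_quotient_field D :=
  forall x : K, exists a b, [/\ a \in D, b \in D, b != 0 & x = a / b].

Definition is_submodule D I :=
  [/\ I 0, forall x y, I x -> I y -> I (x + y) &
      forall a x, a \in D -> I x -> I (a * x)].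

Definition is_ideal D I := is_submodule D I /\ I `<=` [set` D].

Definition is_prime D P :=
  [/\ is_ideal D P, ~ P 1 &
      forall x y, x \in D -> y \in D -> P (x * y) -> P x \/ P y].

Definition is_maximal D I :=
  [/\ is_ideal D I, ~ I 1 &
      forall J, is_ideal D J -> ~ J 1 -> I `<=` J -> J = I].

Definition Dspan D (s : seq K) : set K :=
  [set x | exists c : 'I_(size s) -> K,
     (forall i, c i \in D) /\ x = \sum_i c i * s`_i].

Definition noetherian D :=
  forall I, is_ideal D I -> exists s, I = Dspan D s.

(* Integral closure is taken in K, the quotient field in every use below. *)
Definition intclosure (D : {pred K}) : set K :=
  [set x | exists p : {poly K}, [/\ p \is monic, p \is a polyOver D & root p x] ].

Definition dedekind D :=
  [/\ noetherian D, intclosure D = [set` D] &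
      forall P, is_prime D P -> P != [set 0] -> is_maximal D P].

Definition is_order (R O : subringClosed K) :=
  [/\ {subset O <= R}, is_quotient_field O & exists s, [set` R] = Dspan O s].

Lemma order_sub (R O : subringClosed K) :
  is_order R O -> {subset O <= R}.
Proof. by case. Qed.

Definition conductor (R O : subringClosed K) : set K :=
  [set x | x \in R /\ forall r, r \in R -> x * r \in O].

(* the set of cosets D / I *)
Definition residue D I : set (set K) :=
  [set [set x + y | y in I] | x in [set` D] ].

Definition coprime_ideals D I J := [set x + y | x in I & y in J] = [set` D].

Definition ring_unit (A : set K) (x : K) := [/\ x != 0, A x & A x^-1].

Definition is_principal D I := exists x, I = [set x * a | a in [set` D] ].

Definition is_fractional D I :=
  [/\ is_submodule D I, exists2 x, I x & x != 0 &
      exists c, [/\ c \in D, c != 0 & forall x, I x -> c * x \in D] ].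

Definition idealM I J : set K :=
  [set x | exists s : seq (K * K),
     (forall p, p \in s -> I p.1 /\ J p.2) /\ x = \sum_(p <- s) p.1 * p.2].

(* (D : I) *)
Definition idealV D I : set K := [set x | forall y, I y -> x * y \in D].

Definition is_invertible D I :=
  is_fractional D I /\ idealM I (idealV D I) = [set` D].

Lemma mem_idealM I J x y : I x -> J y -> idealM I J (x * y).
Proof.
move=> Ix Jy; exists [:: (x, y)]; split; last by rewrite big_seq1.
by move=> p; rewrite inE => /eqP->.
Qed.

Lemma idealM_ind I J (Q : set K) :
    Q 0 -> (forall x y, Q x -> Q y -> Q (x + y)) ->
    (forall x y, I x -> J y -> Q (x * y)) -> idealM I J `<=` Q.
Proof.
move=> Q0 QD QM _ [s [sP ->]]; rewrite big_seq.
by elim/big_ind: _ => // p /sP[]; apply: QM.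
Qed.

Lemma idealM0 I J : idealM I J 0.
Proof. by exists [::]; rewrite big_nil. Qed.

Lemma idealMD I J x y : idealM I J x -> idealM I J y -> idealM I J (x + y).
Proof.
move=> [s [sP ->]] [t [tP ->]]; exists (s ++ t); rewrite big_cat; split=> // p.
by rewrite mem_cat => /orP[/sP|/tP].
Qed.

Lemma idealMC I J : idealM I J = idealM J I.
Proof.
by apply/seteqP; split; apply: idealM_ind; do ?[exact: idealM0|exact: idealMD];
   move=> x y Ix Jy; rewrite mulrC; apply: mem_idealM.
Qed.

Lemma idealMA_sub I J P : idealM I (idealM J P) `<=` idealM (idealM I J) P.
Proof.
apply: idealM_ind; do ?[exact: idealM0|exact: idealMD] => x y Ix.
move: y; apply: idealM_ind => [|y z|y z Jy Pz].
- by rewrite mulr0; apply: idealM0.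
- by rewrite mulrDr; apply: idealMD.
- by rewrite mulrA; do 2!apply: mem_idealM => //.
Qed.

Lemma idealMA I J P : idealM I (idealM J P) = idealM (idealM I J) P.
Proof.
apply/seteqP; split; first exact: idealMA_sub.
rewrite (idealMC _ P) (idealMC I J) (idealMC I) (idealMC J P).
exact: idealMA_sub.
Qed.

Lemma idealM1 D I : is_submodule D I -> idealM [set` D] I = I.
Proof.
move=> [I0 ID IZ]; apply/seteqP; split; first exact: idealM_ind.
by move=> x Ix; rewrite -[x]mul1r; apply: mem_idealM => //=; apply: rpred1.
Qed.

Lemma idealM_fractional D I J :
  is_fractional D I -> is_fractional D J -> is_fractional D (idealM I J).
Proof.
move=> [[I0 ID IZ] [x Ix x0] [c [cD c0 cI]]] [_ [y Jy y0] [d [dD d0 dJ]]].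
split; first split; [exact: idealM0|exact: idealMD| |..].
- move=> a z aD; move: z; apply: idealM_ind => [|z t|z t Iz Jt].
  + by rewrite mulr0; apply: idealM0.
  + by rewrite mulrDr; apply: idealMD.
  + by rewrite mulrA; apply: mem_idealM => //; apply: IZ.
- by exists (x * y); [apply: mem_idealM|rewrite mulf_neq0].
- exists (c * d); split; [exact: rpredM|by rewrite mulf_neq0|].
  apply: idealM_ind => [|z t|z t Iz Jt].
  + by rewrite mulr0 rpred0.
  + by rewrite mulrDr; apply: rpredD.
  + by rewrite mulrACA rpredM ?cI ?dJ.
Qed.

Lemma idealV_submodule D I : is_submodule D (idealV D I).
Proof.
split=> [y _|x y Ix Iy z Iz|a x aD Ix z Iz]; first by rewrite mul0r rpred0.
- by rewrite mulrDl rpredD ?Ix ?Iy.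
- by rewrite -mulrA rpredM ?Ix.
Qed.

Lemma idealV_fractional D I : is_fractional D I -> is_fractional D (idealV D I).
Proof.
move=> [_ [x Ix x0] [c [cD c0 cI]]]; split; first exact: idealV_submodule.
- by exists c.
- exists (c * x); split; [exact: cI|by rewrite mulf_neq0|] => y Vy.
  by rewrite -mulrA rpredM // mulrC Vy.
Qed.

Lemma set1D_fractional D : is_fractional D [set` D].
Proof.
split; first by split=> [|x y|a x]; [exact: rpred0|exact: rpredD|exact: rpredM].
- by exists 1; [exact: rpred1|exact: oner_neq0].
- by exists 1; split=> [||x]; rewrite ?rpred1 ?oner_neq0 // mul1r.
Qed.

Lemma invertible_of D I J :
  is_fractional D I -> idealM I J = [set` D] -> is_invertible D I.
Proof.
move=> fI IJ; split=> //; apply/seteqP; split.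
  apply: idealM_ind => [|x y|x y Ix Vy] /=; [exact: rpred0|exact: rpredD|].
  by rewrite mulrC; apply: Vy.
rewrite -IJ; apply: idealM_ind; do ?[exact: idealM0|exact: idealMD].
move=> x y Ix Jy; apply: mem_idealM => // z Iz; rewrite mulrC.
by have := mem_idealM Iz Jy; rewrite IJ.
Qed.

Section Picard.
Variable D : subringClosed K.

(* The group of invertible fractional ideals under idealM.  It is written
   additively so that its quotients are available as zmodTypes. *)
Record invideal := InvIdeal { ival :> set K; ivalP : `[< is_invertible D ival >] }.
HB.instance Definition _ := [isSub for ival].
HB.instance Definition _ := [Choice of invideal by <:].

Fact invideal_add (I J : invideal) : `[< is_invertible D (idealM I J) >].
Proof.
apply/asboolP; have /asboolP[fI iI] := ivalP I; have /asboolP[fJ iJ] := ivalP J.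
apply: (@invertible_of _ _ (idealM (idealV D I) (idealV D J))).
  exact: idealM_fractional.
rewrite -idealMA (idealMA J) (idealMC J) -(idealMA _ J) iJ (idealMC _ [set` D]).
by rewrite idealM1 ?iI //; apply: idealV_submodule.
Qed.

Fact invideal_opp (I : invideal) : `[< is_invertible D (idealV D I) >].
Proof.
apply/asboolP; have /asboolP[fI iI] := ivalP I.
apply: (@invertible_of _ _ I); first exact: idealV_fractional.
by rewrite idealMC.
Qed.

Fact invideal_zero : `[< is_invertible D [set` D] >].
Proof.
apply/asboolP; apply: (@invertible_of _ _ [set` D]); first exact: set1D_fractional.
by apply: idealM1; case: (set1D_fractional D).
Qed.

Definition invideal0 := InvIdeal invideal_zero.
Definition invidealD (I J : invideal) := InvIdeal (invideal_add I J).
Definition invidealN (I : invideal) := InvIdeal (invideal_opp I).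

Fact invidealDA : associative invidealD.
Proof. by move=> I J L; apply/val_inj/idealMA. Qed.
Fact invidealDC : commutative invidealD.
Proof. by move=> I J; apply/val_inj/idealMC. Qed.
Fact invideal0D : left_id invideal0 invidealD.
Proof.
by move=> I; apply/val_inj/idealM1; have /asboolP[[]] := ivalP I.
Qed.
Fact invidealND : left_inverse invideal0 invidealN invidealD.
Proof.
move=> I; apply/val_inj; rewrite /= idealMC.
by have /asboolP[] := ivalP I.
Qed.

HB.instance Definition _ :=
  GRing.isZmodule.Build invideal invidealDA invidealDC invideal0D invidealND.

Definition principal : {pred invideal} :=
  fun I : invideal => `[< is_principal D I >].

Fact principal_closed : zmod_closed principal.
Proof.
split.
  apply/asboolP; exists 1; apply/seteqP; split=> [x xD|_ [x xD <-]].
    by exists x; rewrite ?mul1r.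
  by rewrite mul1r.
move=> I J /asboolP[x Ix] /asboolP[y Jy]; apply/asboolP; exists (x / y).
have y0 : y != 0.
  apply/eqP => y0; have /asboolP[[_ [z Jz /eqP]]] := ivalP J.
  by move: Jz; rewrite Jy => -[a _ <-]; rewrite y0 mul0r.
rewrite /= Ix Jy; apply/seteqP; split.
  apply: idealM_ind => [|_ _ [a aD <-] [b bD <-]|_ z [a aD <-] Vz].
  - by exists 0; rewrite ?mulr0 //=; apply: rpred0.
  - by exists (a + b); rewrite ?mulrDr //=; apply: rpredD.
  - have Vy : z * y \in D.
      by apply: Vz; exists 1; rewrite ?mulr1 //=; apply: rpred1.
    by exists (a * (z * y)); [exact: rpredM|field].
move=> _ [a aD <-]; rewrite -mulrA; apply: mem_idealM.
  by exists 1; rewrite ?mulr1 //=; apply: rpred1.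
move=> _ [b bD <-]; rewrite mulrC mulrACA divff // mul1r.
exact: rpredM.
Qed.
HB.instance Definition _ := GRing.isZmodClosed.Build invideal principal
  principal_closed.

Definition Pic : zmodType := Quotient.quot principal.

Definition ideal_class (I : invideal) : Pic := \pi_Pic I.

End Picard.

(* Every ideal class contains a prime ideal of D coprime to I. *)
Definition primes_in_all_classes D I :=
  forall c : Pic D, exists P : invideal D,
    [/\ is_prime D P, coprime_ideals D P I & ideal_class P = c].

Record spec D := Spec { prime_set :> set K; spec_prime : is_prime D prime_set }.

Section Localization.
Variables (D : subringClosed K) (p : spec D).

Definition localization : {pred K} :=
  fun x => `[< exists a s, [/\ a \in D, s \in D, ~ prime_set p s & x = a / s] >].

Fact localization_closed : subring_closed localization.
Proof.
have [[[p0 _ _] _] p1 pM] := spec_prime p.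
have n0 s : ~ prime_set p s -> s != 0 by move=> ps; apply/eqP => s0; rewrite s0 in ps.
split.
- apply/asboolP; exists 1, 1; split; rewrite ?rpred1 ?divr1 //.
- move=> _ _ /asboolP[a [s [aD sD ps ->]]] /asboolP[b [t [bD tD pt ->]]].
  apply/asboolP; exists (a * t - b * s), (s * t).
  split; rewrite ?rpredB ?rpredM //; first by move/(pM _ _ sD tD) => [].
  by field; rewrite !n0.
- move=> _ _ /asboolP[a [s [aD sD ps ->]]] /asboolP[b [t [bD tD pt ->]]].
  apply/asboolP; exists (a * b), (s * t).
  split; rewrite ?rpredM //; first by move/(pM _ _ sD tD) => [].
  by field; rewrite !n0.
Qed.
HB.instance Definition _ :=
  GRing.isSubringClosed.Build K localization localization_closed.

End Localization.

(* pi generates the maximal ideal of the local ring V. *)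
Definition is_uniformizer (V : set K) (pi : K) :=
  pi != 0 /\
  [set x | V x /\ ~ ring_unit V x] = [set pi * y | y in V].

(* The normalized valuation of a discrete valuation ring V of K at x != 0
   (junk value 0 if x is not of the form e * pi ^ n). *)
Definition dvr_val (V : set K) (x : K) : int :=
  xget 0 [set n : int | exists pi e,
            [/\ is_uniformizer V pi, ring_unit V e & x = e * pi ^ n] ].

(* The integral closure of O_p is a discrete valuation ring when exactly one
   prime ideal of the integral closure of O lies over p != 0. *)
Definition vp (O : subringClosed K) (p : spec O) : K -> int :=
  dvr_val (intclosure (localization p)).

Definition lies_over (R O : subringClosed K) (P : spec R) (p : spec O) :=
  P `&` [set` O] = p.

End Domains.

Definition torsion (G : zmodType) :=
  forall g : G, exists2 n, (0 < n)%N & (g *+ n = 0)%R.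

(* The class group of a Dedekind domain R: all its nonzero fractional ideals
   are invertible. *)
Notation Cl R := (Pic R).

Definition has_two_elements (T : Type) := [set: T] #= `I_2.

(* Main.v *)
(* Let theta : O -> B be a transfer homomorphism to a Krull monoid and let c be
   a nonzero element of the conductor.  As B is completely integrally closed,
   r |-> theta(c r) / theta(c) maps R to B; this extends "theta x ~ theta y" to a
   congruence on R for which every factorization in R of an element u of O can be
   lifted to O.  Lifting powers of elements of R and counting prime factors shows
   first that the primes containing the conductor are determined by their
   contractions to O, so that every element of R has a power in O, then that an
   element of R coprime to the conductor is a product of an element of O and a
   unit of R, and finally that an element u of O with v_P(u) > 0 has locally at P
   a divisor of value 1 (or of value 2, when |Cl(R)| = 2 and P is nonprincipal).
   The last step replaces u by an element of O with the same local behaviour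
   whose other prime factors lie in prescribed classes.

   Conversely, elements of O can be glued from local data, so that under (a) an
   element u of O splits along a principal divisor of R as soon as it splits
   locally at each P containing the conductor.  Hence under (a) and (b) the
   inclusion into R is a transfer homomorphism, and so is the map to the
   zero-sum sequence of classes of prime factors.  If |Cl(R)| = 2, all
   factorizations of u have the same length, and this length is a transfer
   homomorphism to the additive monoid of natural numbers. *)
Require Import Defs.
From HB Require Import structures.
From mathcomp Require Import all_boot all_order all_algebra.
From mathcomp Require Import ring zify finmap multiset.
From mathcomp Require Import boolp classical_sets cardinality.
Set Implicit Arguments.
Unset Strict Implicit.
Unset Printing Implicit Defensive.
Import Order.TTheory GRing.Theory Num.Theory.
Local Open Scope classical_set_scope.
Local Open Scope ring_scope.

(** * Ideals of Dedekind domains *)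

Section Ideals.
Variables (K : fieldType) (R : subringClosed K).
Implicit Types (x y a b : K) (I J P : set K).

Lemma setR_ideal : is_ideal R [set` R].
Proof.
by split=> //; split=> [|x y|a x]; [exact: rpred0|exact: rpredD|exact: rpredM].
Qed.

Lemma setR_submodule : is_submodule R [set` R].
Proof. by case: setR_ideal. Qed.

Lemma sub0 I : is_submodule R I -> I 0. Proof. by case. Qed.
Lemma subD I x y : is_submodule R I -> I x -> I y -> I (x + y).
Proof. by case=> _ + _; apply. Qed.
Lemma subM I a x : is_submodule R I -> a \in R -> I x -> I (a * x).
Proof. by case=> _ _; apply. Qed.
Lemma subN I x : is_submodule R I -> I x -> I (- x).
Proof. by move=> sI Ix; rewrite -mulN1r; apply: subM => //; apply: rpredN1. Qed.
Lemma subB I x y : is_submodule R I -> I x -> I y -> I (x - y).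
Proof. by move=> sI Ix Iy; apply: subD => //; apply: subN. Qed.
Lemma sub_sum I (T : Type) (r : seq T) (p : pred T) (f : T -> K) :
  is_submodule R I -> (forall i, p i -> I (f i)) -> I (\sum_(i <- r | p i) f i).
Proof.
by move=> sI H; elim/big_ind: _ => //; [exact: sub0|move=> x y; apply: subD].
Qed.

Lemma Dspan_mem (s : seq K) z : z \in s -> Dspan R s z.
Proof.
move=> zs; exists (fun i : 'I_(size s) => (i == index z s :> nat)%:R).
split=> [i|]; first by case: eqP => _; [exact: rpred1|exact: rpred0].
have zi : (index z s < size s)%N by rewrite index_mem.
rewrite (bigD1 (Ordinal zi)) //= eqxx mul1r nth_index // big1 ?addr0 // => i /eqP ni.
case: eqP => [e|_]; last by rewrite mul0r.
by case: ni; apply/val_inj.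
Qed.

Lemma Dspan_sub (s : seq K) I :
  is_submodule R I -> (forall z, z \in s -> I z) -> Dspan R s `<=` I.
Proof.
move=> sI sin _ [c [cR ->]]; apply: sub_sum => // i _.
by apply: subM => //; apply: sin; apply: mem_nth.
Qed.

Lemma idealM_sub I J L : is_submodule R L ->
  (forall x y, I x -> J y -> L (x * y)) -> idealM I J `<=` L.
Proof. by move=> sL; apply: idealM_ind; [exact: sub0|move=> x y; exact: subD]. Qed.

Lemma idealM_submodule I J : is_submodule R I -> is_submodule R (idealM I J).
Proof.
move=> sI; split; [exact: idealM0|exact: idealMD|] => a x aR.
move: x; apply: idealM_ind => [|x y|x y Ix Jy].
- by rewrite mulr0; apply: idealM0.
- by rewrite mulrDr; apply: idealMD.
- by rewrite mulrA; apply: mem_idealM => //; apply: subM.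
Qed.

Lemma idealM_mono I J I' J' : I `<=` I' -> J `<=` J' -> idealM I J `<=` idealM I' J'.
Proof.
move=> II JJ; apply: idealM_ind; [exact: idealM0|exact: idealMD|].
by move=> x y /II Ix /JJ Jy; apply: mem_idealM.
Qed.

Definition idealD I J : set K := [set x + y | x in I & y in J].

Lemma idealD_submodule I J :
  is_submodule R I -> is_submodule R J -> is_submodule R (idealD I J).
Proof.
move=> sI sJ; split.
- by exists 0; [exact: sub0|exists 0; [exact: sub0|rewrite addr0]].
- move=> _ _ [x Ix [y Jy <-]] [z Iz [t Jt <-]]; exists (x + z); first exact: subD.
  by exists (y + t); [exact: subD|rewrite addrACA].
- move=> a _ aR [x Ix [y Jy <-]]; exists (a * x); first exact: subM.
  by exists (a * y); [exact: subM|rewrite mulrDr].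
Qed.

Lemma sub_idealDl I J : is_submodule R J -> I `<=` idealD I J.
Proof. by move=> sJ x Ix; exists x => //; exists 0; [exact: sub0|rewrite addr0]. Qed.
Lemma sub_idealDr I J : is_submodule R I -> J `<=` idealD I J.
Proof. by move=> sJ x Ix; exists 0; [exact: sub0|exists x; rewrite ?add0r]. Qed.
Lemma idealD_sub I J L :
  is_submodule R L -> I `<=` L -> J `<=` L -> idealD I J `<=` L.
Proof. by move=> sL IL JL _ [x /IL Lx [y /JL Ly <-]]; apply: subD. Qed.

Definition idealP x : set K := [set x * a | a in [set` R]].

Lemma idealP_submodule x : is_submodule R (idealP x).
Proof.
split.
- by exists 0; [exact: rpred0|rewrite mulr0].
- by move=> _ _ [a aR <-] [b bR <-]; exists (a + b); [exact: rpredD|rewrite mulrDr].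
- by move=> a _ aR [b bR <-]; exists (a * b); [exact: rpredM|rewrite mulrCA].
Qed.

Lemma idealP_mem x : idealP x x.
Proof. by exists 1; [exact: rpred1|rewrite mulr1]. Qed.

Lemma idealP_sub x I : is_submodule R I -> I x -> idealP x `<=` I.
Proof. by move=> sI Ix _ [a aR <-]; rewrite mulrC; apply: subM. Qed.

Lemma ideal_zorn (F : set (set K)) :
    F !=set0 -> (forall I, F I -> is_ideal R I) ->
    (forall C : set (set K), C `<=` F -> C !=set0 -> total_on C subset ->
       is_ideal R (\bigcup_(X in C) X) -> F (\bigcup_(X in C) X)) ->
  exists I, F I /\ forall J, F J -> I `<=` J -> J = I.
Proof.
move=> [I0 FI0] Fid FU.
have [|A [PA maxA]] := @Zorn_bigcup K (fun X => X = set0 \/ F X).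
  move=> C CP Ctot; pose C' := C `&` F; set U := \bigcup_(X in C) X.
  have UE : U = \bigcup_(X in C') X.
    apply/seteqP; split=> x [X CX Xx]; last by case: CX => CX _; exists X.
    by exists X => //; split=> //; case: (CP _ CX) Xx => // ->.
  have [C'0|/existsNP[X0 /contrapT CX0]] := pselect (forall X, ~ C' X).
    by left; apply/seteqP; split=> // x; rewrite UE => -[X /C'0].
  right; rewrite UE; apply: FU => [X []//||X Y [CX _] [CY _]|]; [by exists X0|exact: Ctot|].
  have up X Y : C' X -> C' Y -> exists Z, [/\ C' Z, X `<=` Z & Y `<=` Z].
    move=> CX CY; have [XY|YX] := Ctot _ _ (proj1 CX) (proj1 CY).
      by exists Y; split.
    by exists X; split.
  split; first split.
  - by exists X0 => //; have [[]] := Fid _ (proj2 CX0).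
  - move=> x y [X CX Xx] [Y CY Yy]; have [Z [CZ XZ YZ]] := up _ _ CX CY.
    exists Z => //; have [[_ ZD _] _] := Fid _ (proj2 CZ).
    by apply: ZD; [exact: XZ|exact: YZ].
  - move=> a x aR [X CX Xx]; exists X => //.
    by have [[_ _ XM] _] := Fid _ (proj2 CX); apply: XM.
  by move=> x [X CX Xx]; have [_ XR] := Fid _ (proj2 CX); apply: XR.
have FA : F A.
  case: PA => // A0; exfalso; apply: (maxA I0); last by right.
  rewrite A0; rewrite properEneq; split=> //.
  by apply/eqP => e; have [[]] := Fid _ FI0; rewrite -e.
exists A; split=> // J FJ AJ; apply: contrapT => JA; apply: (maxA J); last by right.
by rewrite properEneq; split=> //; apply/eqP => e; apply: JA.
Qed.

Lemma noetherian_max (F : set (set K)) :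
    noetherian R -> F !=set0 -> (forall I, F I -> is_ideal R I) ->
  exists I, F I /\ forall J, F J -> I `<=` J -> J = I.
Proof.
move=> noeR F0 Fid; apply: ideal_zorn => // C CF [X0 CX0] Ctot Uid.
set U := \bigcup_(X in C) X in Uid *.
have [s Us] := noeR _ Uid.
have sU z : z \in s -> U z by rewrite Us; apply: Dspan_mem.
have [X [CX sX]] : exists X, C X /\ forall z, z \in s -> X z.
  elim: (s) sU => [_|z t IH sU]; first by exists X0.
  have [|X [CX tX]] := IH; first by move=> y yt; apply: sU; rewrite inE yt orbT.
  have [Y CY Yz] : U z by apply: sU; rewrite inE eqxx.
  have [XY|YX] := Ctot _ _ CX CY.
    by exists Y; split=> // y; rewrite inE => /predU1P[->//|/tX/XY].
  by exists X; split=> // y; rewrite inE => /predU1P[->|/tX//]; apply: YX.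
suff -> : U = X by apply: CF.
apply/seteqP; split; last by move=> x Xx; exists X.
by rewrite Us; apply: Dspan_sub => //; have [] := Fid _ (CF _ CX).
Qed.

Lemma exists_prime I : is_ideal R I -> ~ I 1 -> exists P, is_prime R P /\ I `<=` P.
Proof.
move=> idI I1; pose G := [set J | [/\ is_ideal R J, ~ J 1 & I `<=` J]].
have [|||P [[idP P1 IP] maxP]] := @ideal_zorn G; first by exists I; split.
- by move=> J [].
- move=> C CG [X CX] _ idU; split=> //; first by move=> [Y /CG[_ Y1 _] /Y1].
  by move=> x Ix; exists X => //; have [_ _ IX] := CG _ CX; apply: IX.
have [sP PR] := idP.
exists P; split=> //; split=> // x y xR yR Pxy.
have [|Px] := pselect (P x); first by left.
right; have sD : is_submodule R (idealD P (idealP x)).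
  by apply: idealD_submodule => //; apply: idealP_submodule.
have PD : P `<=` idealD P (idealP x) by apply: sub_idealDl; apply: idealP_submodule.
have [[z Pz [_ [t tR <-] e]]|D1] := pselect (idealD P (idealP x) 1).
  rewrite -[y]mulr1 -e mulrDr; apply: (subD sP); first by apply: (subM sP).
  have -> : y * (x * t) = t * (x * y) by ring.
  by apply: (subM sP).
case: Px; rewrite -(maxP (idealD P (idealP x))) //.
  by apply: (sub_idealDr sP); apply: idealP_mem.
split=> //; last exact: subset_trans IP PD.
split=> //; apply: idealD_sub => //; first exact: setR_submodule.
by move=> _ [a aR <-]; apply: rpredM.
Qed.

Lemma intclosure_noetherian c x : noetherian R -> c != 0 ->
  (forall n, c * x ^+ n \in R) -> intclosure R x.
Proof.
move=> noeR c0 cx.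
pose I n := [set y | exists p : {poly K},
  [/\ p \is a polyOver R, (size p <= n)%N & y = c * p.[x]]].
have [||_ [[N _ <-] maxI]] := @noetherian_max (range I) noeR.
- by exists (I 0%N); exists 0%N.
- move=> _ [n _ <-]; split; first split.
  + by exists 0; rewrite rpred0 size_poly0 horner0 mulr0.
  + move=> y z [p [pR ps ->]] [q [qR qs ->]]; exists (p + q).
    rewrite rpredD // hornerD mulrDr; split=> //.
    by rewrite (leq_trans (size_polyD _ _)) // geq_max ps.
  + move=> a y aR [p [pR ps ->]]; exists (a *: p); split.
    * by apply/polyOverP => i; rewrite coefZ rpredM // (polyOverP pR).
    * by rewrite (leq_trans (size_scale_leq _ _)).
    * by rewrite hornerZ mulrCA.
  + move=> y [p [pR ps ->]] /=; rewrite horner_coef mulr_sumr rpred_sum // => i _.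
    by rewrite mulrCA rpredM // (polyOverP pR).
have IN : I N.+1 = I N.
  apply: maxI; first by exists N.+1.
  by move=> y [p [pR ps ->]]; exists p; split=> //; apply: leqW.
have : I N.+1 (c * x ^+ N).
  by exists 'X^N; rewrite rpredX ?polyOverX // size_polyXn hornerXn.
rewrite IN => -[p [pR ps /(mulfI c0) e]]; exists ('X^N - p); split.
- by rewrite monicE lead_coefDl ?size_polyN ?size_polyXn // lead_coefXn.
- by rewrite rpredB // rpredX ?polyOverX.
- by rewrite rootE hornerD hornerN hornerXn e subrr.
Qed.

Definition prodI (s : seq (set K)) : set K := foldr (@idealM K) [set` R] s.

Lemma prodI_submodule s : (forall I, I \in s -> is_submodule R I) -> is_submodule R (prodI s).
Proof.
elim: s => [_|I s IH sI]; first exact: setR_submodule.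
by apply: idealM_submodule; apply: sI; rewrite inE eqxx.
Qed.

Lemma prodI_cat s t : (forall I, I \in t -> is_submodule R I) ->
  prodI (s ++ t) = idealM (prodI s) (prodI t).
Proof.
move=> tI; elim: s => [|I s IH] /=; first by rewrite idealM1 //; apply: prodI_submodule.
by rewrite IH idealMA.
Qed.

Lemma prodI_mid s P t : prodI (s ++ P :: t) = idealM P (prodI (s ++ t)).
Proof. by elim: s => //= I s ->; rewrite !idealMA (idealMC I). Qed.

Lemma prodI_R s : (forall I, I \in s -> I `<=` [set` R]) -> prodI s `<=` [set` R].
Proof.
elim: s => [_ //|I s IH sR]; apply: idealM_sub; first exact: setR_submodule.
move=> a b Ia sb; apply: rpredM; first by apply: sR Ia; rewrite inE eqxx.
by apply: IH sb => J Js; apply: sR; rewrite inE Js orbT.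
Qed.

Lemma prime_prodI s P : is_prime R P -> prodI s `<=` P ->
  (forall I, I \in s -> is_ideal R I) -> exists2 Q, Q \in s & Q `<=` P.
Proof.
move=> [[sP PR] P1 PM]; elim: s => [H _|I s IH H idI].
  by case: P1; apply: H; apply: rpred1.
have [sI IR] : is_ideal R I by apply: idI; rewrite inE eqxx.
have [IP|/existsNP[x /not_implyP[Ix Px]]] := pselect (forall x, I x -> P x).
  by exists I; rewrite ?inE ?eqxx.
have [|J Js|Q Qs QP] := IH.
- move=> y sy; have yR : y \in R.
    by apply: prodI_R sy => J Js; apply: (proj2 (idI _ _)); rewrite inE Js orbT.
  by have [] // := PM x y (IR _ Ix) yR; apply: H; apply: mem_idealM.
- by apply: idI; rewrite inE Js orbT.
- by exists Q => //; rewrite inE Qs orbT.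
Qed.

End Ideals.

Section Dedekind.
Variables (K : fieldType) (R : subringClosed K).
Hypothesis dedR : dedekind R.
Implicit Types (x y a b : K) (I J P : set K).

Let noeR : noetherian R. Proof. by case: dedR. Qed.

Lemma dedekind_cic c x : c != 0 -> (forall n, c * x ^+ n \in R) -> x \in R.
Proof.
move=> c0 cx; have [_ icR _] := dedR.
have := intclosure_noetherian noeR c0 cx.
by have -> : intclosure (R : {pred K}) = [set` R] by [].
Qed.

Definition nonzero I := exists2 x, I x & x != 0.

Lemma prime_max P Q : is_prime R P -> nonzero P -> is_prime R Q -> P `<=` Q -> Q = P.
Proof.
move=> pP [x Px x0] [idQ Q1 _] PQ; have [_ _ dim] := dedR.
have [|_ _ H] := dim _ pP; last exact: H.
by apply/eqP => P0; move: Px; rewrite P0 /= => xe; rewrite xe eqxx in x0.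
Qed.

Lemma ideal_prod_primes I : is_ideal R I -> nonzero I ->
  exists s, (forall P, P \in s -> is_prime R P /\ nonzero P) /\ prodI R s `<=` I.
Proof.
move=> idI nI; apply: contrapT => bad.
pose F := [set J | [/\ is_ideal R J, nonzero J & ~ exists s,
  (forall P, P \in s -> is_prime R P /\ nonzero P) /\ prodI R s `<=` J]].
have [||L [[idL nL badL] maxL]] := @noetherian_max _ _ F noeR.
- by exists I.
- by move=> J [].
have [sL LR] := idL.
apply: badL; have [L1|L1] := pselect (L 1).
  by exists [::]; split=> // x xR; rewrite -[x]mulr1; apply: (subM sL).
have [pL|npL] := pselect (is_prime R L).
  exists [:: L]; split; first by move=> P; rewrite inE => /eqP ->.
  by rewrite /= idealMC idealM1.
have [x [y [xR yR Lxy Lx Ly]]] : exists x y, [/\ x \in R, y \in R, L (x * y), ~ L x & ~ L y].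
  apply: contrapT => H; apply: npL; split=> // x y xR yR Lxy.
  have [|Lx] := pselect (L x); first by left.
  by right; apply: contrapT => Ly; apply: H; exists x, y.
have big z : z \in R -> ~ L z -> exists s,
    (forall P, P \in s -> is_prime R P /\ nonzero P) /\ prodI R s `<=` idealD L (idealP R z).
  move=> zR Lz; apply: contrapT => H; apply: Lz.
  have sD : is_submodule R (idealD L (idealP R z)).
    by apply: idealD_submodule => //; apply: idealP_submodule.
  have LD : L `<=` idealD L (idealP R z) by apply: sub_idealDl; apply: idealP_submodule.
  rewrite -(maxL (idealD L (idealP R z))) //.
    by apply: (sub_idealDr sL); apply: idealP_mem.
  split; [split=> // | by have [t Lt t0] := nL; exists t; [exact: LD|] | exact: H].
  apply: (@idealD_sub _ R) => //; first exact: setR_submodule.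
  by move=> _ [a aR <-]; apply: rpredM.
have [s [ps sx]] := big _ xR Lx; have [t [pt ty]] := big _ yR Ly.
exists (s ++ t); split; first by move=> P; rewrite mem_cat => /orP[/ps|/pt].
rewrite prodI_cat; last by move=> P /pt[[[]]].
apply: subset_trans (idealM_mono sx ty) _.
apply: (@idealM_sub _ R) => // _ _ [a La [_ [b bR <-] <-]] [c Lc [_ [d dR <-] <-]].
have aR : a \in R by apply: LR.
rewrite mulrDl; apply: (subD sL).
  rewrite mulrC; apply: (subM sL) => //; apply: rpredD; first exact: LR.
  exact: rpredM.
rewrite mulrDr; apply: (subD sL); first by apply: (subM sL) => //; apply: rpredM.
by rewrite mulrACA mulrC; apply: (subM sL) => //; apply: rpredM.
Qed.

Lemma prime_fractional I : is_ideal R I -> nonzero I -> is_fractional R I.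
Proof.
move=> [sI IR] nI; split=> //; exists 1; split; [exact: rpred1|exact: oner_neq0|].
by move=> x Ix; rewrite mul1r; apply: IR.
Qed.

Lemma prime_inverse P : is_prime R P -> nonzero P ->
  exists x, x \notin R /\ forall y, P y -> x * y \in R.
Proof.
move=> pP [a Pa a0]; have [[sP PR] P1 _] := pP.
have aR : a \in R by apply: PR.
have ida : is_ideal R (idealP R a).
  by split; [exact: idealP_submodule|move=> _ [b bR <-]; apply: rpredM].
pose B n := `[< exists s, [/\ size s = n, forall P, P \in s -> is_prime R P /\ nonzero P
                  & prodI R s `<=` idealP R a] >].
have exB : exists n, B n.
  have [|s [ps sa]] := ideal_prod_primes ida; first by exists a => //; apply: idealP_mem.
  by exists (size s); apply/asboolP; exists s.
case: (ex_minnP exB) => n /asboolP[s [ss ps sa]] minn.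
have aP : idealP R a `<=` P by apply: idealP_sub.
have [|Q Qs QP] := prime_prodI pP (subset_trans sa aP).
  by move=> I /ps[[]].
have [pQ nQ] := ps _ Qs.
have PQ : P = Q by apply: prime_max.
subst Q; case/splitPr: s / Qs ss ps sa => s1 s2 ss ps sa.
have : ~ (prodI R (s1 ++ s2) `<=` idealP R a).
  move=> H; have := minn (size (s1 ++ s2)).
  have -> : B (size (s1 ++ s2)).
    apply/asboolP; exists (s1 ++ s2); split=> // Q.
    by rewrite mem_cat => /orP[] Q12; apply: ps; rewrite mem_cat ?inE Q12 ?orbT.
  by move=> /(_ isT); rewrite -ss !size_cat /= addnS ltnn.
move=> /existsNP[b /not_implyP[sb ab]]; exists (b / a); split.
  apply/negP => H; apply: ab; exists (b / a) => //.
  by rewrite mulrCA divff // mulr1.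
move=> y Py; have : idealP R a (y * b) by apply: sa; rewrite prodI_mid; apply: mem_idealM.
move=> [c cR e]; suff -> : b / a * y = c by [].
by rewrite mulrAC -(mulrC y) -e mulrAC divff // mul1r.
Qed.

Lemma ideal_cic I x : is_ideal R I -> nonzero I ->
  (forall y, I y -> I (x * y)) -> x \in R.
Proof.
move=> [sI IR] [c Ic c0] H; apply: (dedekind_cic c0) => n; apply: IR.
elim: n => [|n IH]; first by rewrite expr0 mulr1.
by rewrite exprS mulrCA; apply: H.
Qed.

Lemma prime_invertible P : is_prime R P -> nonzero P -> is_invertible R P.
Proof.
move=> pP nP; have [idP P1 _] := pP; have [sP PR] := idP.
have [x [xR xP]] := prime_inverse pP nP.
have fP := prime_fractional idP nP.
split=> //; set J := idealM _ _.
have PJ : P `<=` J.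
  move=> y Py; rewrite -[y]mulr1; apply: mem_idealM => // z Pz.
  by rewrite mul1r; apply: PR.
have sJ : is_submodule R J by apply: idealM_submodule.
have JR : J `<=` [set` R].
  apply: (@idealM_sub _ R); first exact: setR_submodule.
  by move=> a b Pa Vb; rewrite /= mulrC; apply: Vb.
have [J1|J1] := pselect (J 1).
  apply/seteqP; split=> // y yR; rewrite -[y]mulr1; exact: (subM sJ).
have JP : J = P.
  have [_ _ dim] := dedR; have [|_ _ H] := dim _ pP; last exact: H.
  apply/eqP => P0; have [z Pz z0] := nP.
  by move: Pz; rewrite P0 /= => ze; rewrite ze eqxx in z0.
case/negP: xR; apply: (ideal_cic idP nP) => y Py; rewrite -JP mulrC.
exact: mem_idealM.
Qed.

Lemma invideal_fractional (I : invideal R) : is_fractional R I.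
Proof. by have /asboolP[] := ivalP I. Qed.
Lemma invideal_submodule (I : invideal R) : is_submodule R I.
Proof. by have [] := invideal_fractional I. Qed.
Lemma invideal_nonzero (I : invideal R) : nonzero I.
Proof. by have [_ [x Ix x0] _] := invideal_fractional I; exists x. Qed.

Lemma ideal_factorization I : is_ideal R I -> nonzero I ->
  exists s : seq (invideal R),
    (forall P : invideal R, P \in s -> is_prime R P) /\ I = ival (\sum_(P <- s) P).
Proof.
move=> idI nI; apply: contrapT => bad.
pose F := [set J | [/\ is_ideal R J, nonzero J & ~ exists s : seq (invideal R),
    (forall P : invideal R, P \in s -> is_prime R P) /\ J = ival (\sum_(P <- s) P)]].
have [||L [[idL nL badL] maxL]] := @noetherian_max _ _ F noeR.
- by exists I.
- by move=> J [].
have [sL LR] := idL.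
have [L1|L1] := pselect (L 1).
  apply: badL; exists [::]; split=> //; rewrite big_nil; apply/seteqP; split=> //.
  by move=> x xR; rewrite -[x]mulr1; apply: (subM sL).
have [P [pP LP]] := exists_prime idL L1.
have nP : nonzero P by have [z Lz z0] := nL; exists z => //; apply: LP.
have iP := prime_invertible pP nP; have [fP PV] := iP.
pose Q : invideal R := InvIdeal (asboolT iP).
have [x [xR xP]] := prime_inverse pP nP.
pose J := idealM L (idealV R P).
have idJ : is_ideal R J.
  split; first exact: idealM_submodule.
  apply: (@idealM_sub _ R); first exact: setR_submodule.
  by move=> a b /LP Pa Vb; rewrite /= mulrC; apply: Vb.
have LJ : L `<=` J.
  move=> y Ly; rewrite -[y]mulr1; apply: mem_idealM => // z Pz.
  by rewrite mul1r; have [[_ PR] _ _] := pP; apply: PR.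
have nJ : nonzero J by have [z Lz z0] := nL; exists z => //; apply: LJ.
have [[s [ps sJ]]|badJ] := pselect (exists s : seq (invideal R),
    (forall P : invideal R, P \in s -> is_prime R P) /\ J = ival (\sum_(P <- s) P)).
  apply: badL; exists (Q :: s); split.
    by move=> P'; rewrite inE => /predU1P[->|/ps].
  rewrite big_cons /= -sJ /J idealMC -idealMA (idealMC (idealV R P)) PV.
  by rewrite idealMC idealM1.
have JL : J = L by apply: maxL.
case/negP: xR; apply: (ideal_cic idL nL) => y Ly; rewrite -JL mulrC.
exact: mem_idealM.
Qed.

End Dedekind.

Record dedDomain (K : fieldType) := DedDomain {
  ded_ring :> subringClosed K;
  ded_qf : is_quotient_field ded_ring;
  ded_ded : dedekind ded_ring }.

Section IdealGroup.
Variables (K : fieldType) (R : dedDomain K).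
Implicit Types (x y : K) (I J P Q : invideal R) (s t : seq (invideal R)).

Definition integral_ideal I := ival I `<=` [set` R].
Definition prime_ideal P := is_prime R (ival P).
Definition pid x : invideal R := insubd (0 : invideal R) (idealP R x).
Definition primes_seq s := forall P, P \in s -> prime_ideal P.

Lemma idealP_mul x y : idealM (idealP R x) (idealP R y) = idealP R (x * y).
Proof.
apply/seteqP; split.
  apply: (@idealM_sub _ R); first exact: idealP_submodule.
  move=> _ _ [a aR <-] [b bR <-]; exists (a * b); first exact: rpredM.
  by rewrite mulrACA.
move=> _ [a aR <-]; rewrite -mulrA; apply: mem_idealM; first exact: idealP_mem.
by exists a.
Qed.

Lemma idealP1 : idealP R 1 = [set` R].
Proof.
apply/seteqP; split=> [_ [a aR <-]|x xR]; first by rewrite mul1r.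
by exists x; rewrite ?mul1r.
Qed.

Let qfR := ded_qf R.
Let dedR := ded_ded R.

Lemma val_pid x : x != 0 -> ival (pid x) = idealP R x.
Proof.
move=> x0; apply: (@insubdK _ _ (invideal R)); apply/asboolP.
apply: (@invertible_of _ _ _ (idealP R x^-1)).
  split; first exact: idealP_submodule.
    by exists x => //; apply: idealP_mem.
  have [a [b [aR bR b0 xe]]] := qfR x; exists b; split=> //.
  move=> _ [c cR <-]; have -> : b * (x * c) = a * c by rewrite xe; field.
  exact: rpredM.
by rewrite idealP_mul divff // idealP1.
Qed.

Lemma pid1 : pid 1 = 0.
Proof. by apply/val_inj; rewrite /= val_pid ?oner_neq0 // idealP1. Qed.

Lemma pidM x y : x != 0 -> y != 0 -> pid (x * y) = pid x + pid y.
Proof.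
by move=> x0 y0; apply/val_inj; rewrite /= !val_pid ?mulf_neq0 // idealP_mul.
Qed.

Lemma pidV x : x != 0 -> pid x^-1 = - pid x.
Proof.
move=> x0; apply/eqP; rewrite -addr_eq0 -pidM ?invr_neq0 // mulVf //.
by rewrite pid1.
Qed.

Lemma pid_div x y : x != 0 -> y != 0 -> pid (x / y) = pid x - pid y.
Proof. by move=> x0 y0; rewrite pidM ?invr_neq0 // pidV. Qed.

Lemma pidX x n : x != 0 -> pid (x ^+ n) = pid x *+ n.
Proof.
move=> x0; elim: n => [|n IH]; first by rewrite pid1 mulr0n.
by rewrite exprS pidM ?expf_neq0 // IH mulrS.
Qed.

Lemma pid_prin x : x != 0 -> pid x \in @principal K R.
Proof. by move=> x0; apply/asboolP; exists x; rewrite val_pid. Qed.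

Lemma prinP I : I \in @principal K R -> exists2 x, x != 0 & I = pid x.
Proof.
move=> /asboolP[x Ix].
have x0 : x != 0.
  apply/eqP => x0; have [y] := invideal_nonzero I.
  by rewrite Ix x0 => -[a _ <-]; rewrite mul0r eqxx.
by exists x => //; apply/val_inj; rewrite /= val_pid.
Qed.

Lemma ival_sub I : is_submodule R (ival I). Proof. exact: invideal_submodule. Qed.

Lemma leI I J : ival I `<=` ival J <-> integral_ideal (I - J).
Proof.
split=> [IJ|IJ].
  rewrite /integral_ideal (_ : [set` R] = ival (J - J)); last by rewrite subrr.
  exact: idealM_mono.
rewrite -[I](subrK J); apply: (@idealM_sub _ R); first exact: ival_sub.
by move=> x y /IJ xR Jy; apply: (subM (ival_sub J)).
Qed.

Lemma integralD I J : integral_ideal I -> integral_ideal J -> integral_ideal (I + J).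
Proof.
move=> IR JR; apply: (@idealM_sub _ R); first exact: setR_submodule.
by move=> x y /IR xR /JR yR; apply: rpredM.
Qed.

Lemma integral0 : integral_ideal 0. Proof. by []. Qed.

Lemma integral_sum s : (forall I, I \in s -> integral_ideal I) ->
  integral_ideal (\sum_(I <- s) I).
Proof.
move=> sR; rewrite big_seq; elim/big_ind: _ => //; exact: integralD.
Qed.

Lemma prime_integral P : prime_ideal P -> integral_ideal P.
Proof. by case=> -[]. Qed.

Lemma primes_integral s : primes_seq s -> integral_ideal (\sum_(I <- s) I).
Proof. by move=> ps; apply: integral_sum => P /ps/prime_integral. Qed.

Lemma integral_anti I : integral_ideal I -> integral_ideal (- I) -> I = 0.
Proof.
move=> IR NR; apply/val_inj/seteqP; split=> //.
by apply/(leI 0 I); rewrite sub0r.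
Qed.

Lemma integral_ideal_ideal I : integral_ideal I -> is_ideal R (ival I).
Proof. by move=> iI; split=> //; apply: ival_sub. Qed.

Lemma mem_pid I x : x != 0 -> ival I x <-> integral_ideal (pid x - I).
Proof.
move=> x0; split=> [Ix|/leI H]; last by apply: H; rewrite val_pid //; apply: idealP_mem.
by apply/leI; rewrite val_pid //; apply: idealP_sub => //; apply: ival_sub.
Qed.

Lemma pid_integral x : x != 0 -> integral_ideal (pid x) <-> x \in R.
Proof. by move=> x0; have := mem_pid 0 x0; rewrite subr0 => <-. Qed.

Lemma prime_le P I J : prime_ideal P -> integral_ideal I -> integral_ideal J ->
  ival (I + J) `<=` ival P -> ival I `<=` ival P \/ ival J `<=` ival P.
Proof.
move=> [idP P1 PM] iI iJ IJ; have [|/existsNP[x /not_implyP[Ix Px]]] :=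
  pselect (ival I `<=` ival P); first by left.
right=> y Jy; have [] // := PM x y (iI _ Ix) (iJ _ Jy).
by apply: IJ; apply: mem_idealM.
Qed.

Lemma prime_eq P Q : prime_ideal P -> prime_ideal Q -> ival P `<=` ival Q -> P = Q.
Proof.
move=> pP pQ PQ; apply/val_inj/esym/(prime_max dedR) => //.
exact: invideal_nonzero.
Qed.

Lemma prime_le_sum P s : prime_ideal P -> primes_seq s ->
  ival (\sum_(Q <- s) Q) `<=` ival P -> P \in s.
Proof.
move=> pP; elim: s => [_|Q s IH ps].
  by rewrite big_nil => H; have [_ P1 _] := pP; case: P1; apply: H; exact: rpred1.
have pQ : prime_ideal Q by apply: ps; rewrite inE eqxx.
have ps' : primes_seq s by move=> J Js; apply: ps; rewrite inE Js orbT.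
rewrite big_cons inE => /prime_le[] //.
- exact: prime_integral.
- exact: primes_integral.
- by move=> QP; rewrite (prime_eq pQ pP QP) eqxx.
- by move=> /(IH ps') ->; rewrite orbT.
Qed.

Lemma factorization_uniq s t : primes_seq s -> primes_seq t ->
  \sum_(P <- s) P = \sum_(P <- t) P -> perm_eq s t.
Proof.
elim: s t => [|P s IH] t ps pt.
  case: t pt => // Q t pt; rewrite big_nil big_cons => e.
  have pQ : prime_ideal Q by apply: pt; rewrite inE eqxx.
  have [_ Q1 _] := pQ; case: Q1.
  have /leI : integral_ideal (0 - Q).
    rewrite e addrC addKr; apply: primes_integral => J Jt.
    by apply: pt; rewrite inE Jt orbT.
  by apply; apply: rpred1.
have pP : prime_ideal P by apply: ps; rewrite inE eqxx.
have ps' : primes_seq s by move=> J Js; apply: ps; rewrite inE Js orbT.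
rewrite big_cons => e.
have Pt : P \in t.
  apply: prime_le_sum => //; rewrite -e; apply/leI; rewrite addrC addKr.
  exact: primes_integral.
have pr : perm_eq t (P :: rem P t) by apply: perm_to_rem.
rewrite (perm_big _ pr) big_cons /= in e; move/addrI: e => e.
rewrite perm_sym (permPl pr) perm_cons perm_sym; apply: IH => //.
by move=> Q /mem_rem/pt.
Qed.

Lemma integral_factor I : integral_ideal I ->
  exists s, primes_seq s /\ I = \sum_(P <- s) P.
Proof.
move=> iI; have [|s [ps e]] := ideal_factorization dedR (integral_ideal_ideal iI).
  exact: invideal_nonzero.
by exists s; split=> //; apply/val_inj.
Qed.

Lemma fractional_factor I : exists s t,
  [/\ primes_seq s, primes_seq t & I = \sum_(P <- s) P - \sum_(P <- t) P].
Proof.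
have [_ _ [c [cR c0 cI]]] := invideal_fractional I.
have iI : integral_ideal (pid c + I).
  apply: (@idealM_sub _ R); first exact: setR_submodule.
  rewrite val_pid // => _ y [a aR <-] /cI cy /=.
  by rewrite mulrAC; apply: rpredM.
have [s [ps es]] := integral_factor iI.
have [t [pt et]] := integral_factor (proj2 (pid_integral c0) cR).
by exists s, t; split=> //; rewrite -es -et addrC addKr.
Qed.

Definition factors I : seq (invideal R) * seq (invideal R) :=
  xget ([::], [::]) [set st | [/\ primes_seq st.1, primes_seq st.2
    & I = \sum_(P <- st.1) P - \sum_(P <- st.2) P]].

Lemma factorsP I : [/\ primes_seq (factors I).1, primes_seq (factors I).2
    & I = \sum_(P <- (factors I).1) P - \sum_(P <- (factors I).2) P].
Proof.
rewrite /factors; case: xgetP => [_ _ []//|H].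
by have [s [t H']] := fractional_factor I; have := H (s, t) H'.
Qed.

Definition ord P I : int := (count_mem P (factors I).1)%:Z - (count_mem P (factors I).2)%:Z.
Definition deg I : int := (size (factors I).1)%:Z - (size (factors I).2)%:Z.

Lemma factors_perm I s t : primes_seq s -> primes_seq t ->
  I = \sum_(P <- s) P - \sum_(P <- t) P -> perm_eq (s ++ (factors I).2) ((factors I).1 ++ t).
Proof.
move=> ps pt e; have [p1 p2 e'] := factorsP I.
have pc s1 s2 : primes_seq s1 -> primes_seq s2 -> primes_seq (s1 ++ s2).
  by move=> q1 q2 P; rewrite mem_cat => /orP[/q1|/q2].
apply: factorization_uniq; [exact: pc|exact: pc|].
have {}e : \sum_(P <- s) P = I + \sum_(P <- t) P by rewrite e subrK.
have {}e' : \sum_(P <- (factors I).1) P = I + \sum_(P <- (factors I).2) P.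
  by rewrite [X in X + _]e' subrK.
by rewrite !big_cat /= e e' addrAC.
Qed.

Lemma ord_eq P I s t : primes_seq s -> primes_seq t ->
  I = \sum_(P <- s) P - \sum_(P <- t) P ->
  ord P I = (count_mem P s)%:Z - (count_mem P t)%:Z.
Proof.
move=> ps pt e; have /permP/(_ (pred1 P)) := factors_perm ps pt e.
by rewrite !count_cat /ord; lia.
Qed.

Lemma deg_eq I s t : primes_seq s -> primes_seq t ->
  I = \sum_(P <- s) P - \sum_(P <- t) P -> deg I = (size s)%:Z - (size t)%:Z.
Proof.
move=> ps pt e; have := perm_size (factors_perm ps pt e).
have -> : size (s ++ (factors I).2) = (size s + size (factors I).2)%N := size_cat _ _.
have -> : size ((factors I).1 ++ t) = (size (factors I).1 + size t)%N := size_cat _ _.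
by rewrite /deg; lia.
Qed.

Lemma primes_cat s t : primes_seq s -> primes_seq t -> primes_seq (s ++ t).
Proof. by move=> ps pt P; rewrite mem_cat => /orP[/ps|/pt]. Qed.

Lemma factorsB I J : let s := (factors I).1 ++ (factors J).2 in
  let t := (factors I).2 ++ (factors J).1 in
  [/\ primes_seq s, primes_seq t & I - J = \sum_(P <- s) P - \sum_(P <- t) P].
Proof.
have [p1 p2 e] := factorsP I; have [q1 q2 e'] := factorsP J.
split; [exact: primes_cat|exact: primes_cat|].
by rewrite !big_cat /= {1}e {1}e' opprB addrACA -opprD.
Qed.

Lemma ordB P I J : ord P (I - J) = ord P I - ord P J.
Proof.
have [ps pt e] := factorsB I J; rewrite (ord_eq P ps pt e) !count_cat /ord; lia.
Qed.
Lemma degB I J : deg (I - J) = deg I - deg J.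
Proof.
have [ps pt e] := factorsB I J; rewrite (deg_eq ps pt e) !size_cat /deg; lia.
Qed.

Lemma ord0 P : ord P 0 = 0. Proof. by have := ordB P 0 0; rewrite !subr0; lia. Qed.
Lemma deg0 : deg 0 = 0. Proof. by have := degB 0 0; rewrite !subr0; lia. Qed.
Lemma ordN P I : ord P (- I) = - ord P I.
Proof. by have := ordB P 0 I; rewrite sub0r ord0 sub0r. Qed.
Lemma degN I : deg (- I) = - deg I.
Proof. by have := degB 0 I; rewrite sub0r deg0 sub0r. Qed.
Lemma ordD P I J : ord P (I + J) = ord P I + ord P J.
Proof. by have := ordB P I (- J); rewrite ordN !opprK. Qed.
Lemma degD I J : deg (I + J) = deg I + deg J.
Proof. by have := degB I (- J); rewrite degN !opprK. Qed.
Lemma ordMn P I n : ord P (I *+ n) = ord P I *+ n.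
Proof. by elim: n => [|n IH]; rewrite ?ord0 // !mulrS ordD IH. Qed.
Lemma degMn I n : deg (I *+ n) = deg I *+ n.
Proof. by elim: n => [|n IH]; rewrite ?deg0 // !mulrS degD IH. Qed.
Lemma ord_sum P (T : Type) (r : seq T) (f : T -> invideal R) :
  ord P (\sum_(i <- r) f i) = \sum_(i <- r) ord P (f i).
Proof. by elim: r => [|i r IH]; rewrite ?big_nil ?ord0 // !big_cons ordD IH. Qed.
Lemma deg_sum (T : Type) (r : seq T) (f : T -> invideal R) :
  deg (\sum_(i <- r) f i) = \sum_(i <- r) deg (f i).
Proof. by elim: r => [|i r IH]; rewrite ?big_nil ?deg0 // !big_cons degD IH. Qed.

Lemma ord_primes P s : primes_seq s -> ord P (\sum_(Q <- s) Q) = (count_mem P s)%:Z.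
Proof.
by move=> ps; rewrite (@ord_eq P _ s [::]) ?big_nil ?subr0.
Qed.
Lemma deg_primes s : primes_seq s -> deg (\sum_(Q <- s) Q) = (size s)%:Z.
Proof. by move=> ps; rewrite (@deg_eq _ s [::]) ?big_nil ?subr0. Qed.

Lemma primes_seq1 P : prime_ideal P -> primes_seq [:: P].
Proof. by move=> pP Q; rewrite inE => /eqP ->. Qed.
Lemma ord_prime P Q : prime_ideal Q -> ord P Q = (Q == P)%:Z.
Proof.
move=> pQ; have := ord_primes P (primes_seq1 pQ); rewrite big_seq1 => -> /=.
by rewrite addn0.
Qed.
Lemma deg_prime P : prime_ideal P -> deg P = 1.
Proof. by move=> pP; have := deg_primes (primes_seq1 pP); rewrite big_seq1 => ->. Qed.

Lemma ord_ge0 P I : integral_ideal I -> 0 <= ord P I.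
Proof. by move=> /integral_factor[s [ps ->]]; rewrite ord_primes. Qed.
Lemma deg_ge0 I : integral_ideal I -> 0 <= deg I.
Proof. by move=> /integral_factor[s [ps ->]]; rewrite deg_primes. Qed.
Lemma ord_le_deg P I : integral_ideal I -> ord P I <= deg I.
Proof.
by move=> /integral_factor[s [ps ->]]; rewrite ord_primes // deg_primes // lez_nat count_size.
Qed.
Lemma ord_nonprime P I : ~ prime_ideal P -> ord P I = 0.
Proof.
move=> pP; have [ps pt _] := factorsP I; rewrite /ord.
have z s : primes_seq s -> count_mem P s = 0%N by move=> q; apply/count_memPn/negP => /q.
by rewrite !z.
Qed.

Lemma integralP I : integral_ideal I <-> forall P, prime_ideal P -> 0 <= ord P I.
Proof.
split=> [iI P _|H]; first exact: ord_ge0.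
have [ps pt e] := factorsP I.
have /count_subseqP[t' sub pr] : forall P, (count_mem P (factors I).2 <= count_mem P (factors I).1)%N.
  move=> P; have [/H|np] := pselect (prime_ideal P); first by rewrite /ord; lia.
  by have := ord_nonprime I np; rewrite /ord; lia.
have [r pr'] := perm_to_subseq sub.
rewrite e (perm_big _ pr) (perm_big _ pr') big_cat /= addrAC subrr add0r.
by apply: primes_integral => P Pr; apply: ps; rewrite (perm_mem pr') mem_cat Pr orbT.
Qed.

Lemma ord_inj I J : (forall P, prime_ideal P -> ord P I = ord P J) -> I = J.
Proof.
move=> H; apply/eqP; rewrite -subr_eq0; apply/eqP.
by apply: integral_anti; apply/integralP => P /H; rewrite ?ordN ordB; lia.
Qed.
End IdealGroup.

Section IdealCalculus.
Variables (K : fieldType) (R : dedDomain K).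
Implicit Types (x y : K) (I J P Q : invideal R) (s t : seq (invideal R)).

Definition pval P x : int := ord P (pid R x).

Lemma pvalM P x y : x != 0 -> y != 0 -> pval P (x * y) = pval P x + pval P y.
Proof. by move=> x0 y0; rewrite /pval pidM // ordD. Qed.
Lemma pvalV P x : x != 0 -> pval P x^-1 = - pval P x.
Proof. by move=> x0; rewrite /pval pidV // ordN. Qed.
Lemma pval_div P x y : x != 0 -> y != 0 -> pval P (x / y) = pval P x - pval P y.
Proof. by move=> x0 y0; rewrite pvalM ?invr_neq0 // pvalV. Qed.
Lemma pvalX P x n : x != 0 -> pval P (x ^+ n) = pval P x *+ n.
Proof. by move=> x0; rewrite /pval pidX // ordMn. Qed.
Lemma pval1 P : pval P 1 = 0.
Proof. by rewrite /pval pid1 ord0. Qed.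

Lemma mem_ord I x : x != 0 -> ival I x <-> forall P, prime_ideal P -> ord P I <= pval P x.
Proof.
move=> x0; rewrite mem_pid // integralP; split=> H P /H; rewrite ordB /pval; lia.
Qed.

Lemma pval_ge0 P x : x != 0 -> x \in R -> 0 <= pval P x.
Proof. by move=> x0 xR; apply/ord_ge0/pid_integral. Qed.

Lemma mem_R_val x : x != 0 -> (forall P, prime_ideal P -> 0 <= pval P x) -> x \in R.
Proof. by move=> x0 H; apply/pid_integral => //; apply/integralP. Qed.

Lemma le_prime P I : prime_ideal P -> integral_ideal I ->
  ival I `<=` ival P <-> 1 <= ord P I.
Proof.
move=> pP iI; rewrite leI integralP; split=> [/(_ P pP)|H Q pQ].
  by rewrite ordB (ord_prime P pP) eqxx; lia.
rewrite ordB (ord_prime Q pP); have := ord_ge0 Q iI; case: eqP => [<-|_] /=; lia.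
Qed.

Lemma prime_mem P x : prime_ideal P -> x != 0 -> x \in R -> ival P x <-> 1 <= pval P x.
Proof.
move=> pP x0 xR; rewrite -le_prime ?val_pid //; last exact/pid_integral.
split=> [Px|]; last by apply; exact: idealP_mem.
by apply: idealP_sub => //; exact: ival_sub.
Qed.

Lemma prime_nmem P x : prime_ideal P -> x \in R -> ~ ival P x -> x != 0 /\ pval P x = 0.
Proof.
move=> pP xR Px; have x0 : x != 0.
  by apply/eqP => x0; apply: Px; rewrite x0; apply: (sub0 (ival_sub P)).
have H : ~ (1 <= pval P x) by move/(prime_mem pP x0 xR).
by split=> //; have := pval_ge0 P x0 xR; lia.
Qed.

Lemma pid_eq0 x : x != 0 -> pid R x = 0 <-> ring_unit [set` R] x.
Proof.
move=> x0; split=> [e|[_ xR xVR]].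
  split=> //=; first by apply/pid_integral => //; rewrite e.
  by apply/pid_integral; rewrite ?invr_neq0 // pidV // e oppr0.
apply: integral_anti; first exact/pid_integral.
by rewrite -pidV //; apply/pid_integral; rewrite ?invr_neq0.
Qed.

Lemma pid_inj x y : x != 0 -> y != 0 -> pid R x = pid R y -> ring_unit [set` R] (x / y).
Proof.
move=> x0 y0 e; apply/pid_eq0; first by rewrite mulf_neq0 ?invr_neq0.
by rewrite pid_div // e subrr.
Qed.

Lemma pid_unit e x : ring_unit [set` R] e -> x != 0 -> pid R (e * x) = pid R x.
Proof.
by move=> ue x0; have [e0 _ _] := ue; rewrite pidM // (proj2 (pid_eq0 e0) ue) add0r.
Qed.

Lemma nonunit_prime I : integral_ideal I -> I != 0 -> exists2 P, prime_ideal P & 1 <= ord P I.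
Proof.
move=> /integral_factor[[|P s] [ps ->]]; first by rewrite big_nil eqxx.
have pP : prime_ideal P by apply: ps; rewrite inE eqxx.
move=> _; exists P; rewrite ?ord_primes //= eqxx; lia.
Qed.

Definition support I := undup ((factors I).1 ++ (factors I).2).

Lemma support_prime I : primes_seq (support I).
Proof.
move=> P; have [p1 p2 _] := factorsP I.
by rewrite mem_undup mem_cat => /orP[/p1|/p2].
Qed.

Lemma ord_support P I : ord P I != 0 -> P \in support I.
Proof.
rewrite mem_undup mem_cat -!has_pred1 !has_count /ord.
by case: (count_mem P _) => //; case: (count_mem P _).
Qed.

Lemma ideal_of_ords (L : seq (invideal R)) (g : invideal R -> int) :
  uniq L -> primes_seq L ->
  exists I, forall P, ord P I = if P \in L then g P else 0.
Proof.
elim: L => [|Q L IH] /=; first by exists 0 => P; rewrite ord0.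
move=> /andP[QL uL] pL; have pQ : prime_ideal Q by apply: pL; rewrite inE eqxx.
have [|I HI] := IH uL; first by move=> P PL; apply: pL; rewrite inE PL orbT.
have [J HJ] : exists J, forall P, ord P J = g Q * (Q == P)%:Z.
  case: (g Q) => n.
    by exists (Q *+ n) => P; rewrite ordMn ord_prime //; lia.
  by exists (- (Q *+ n.+1)) => P; rewrite ordN ordMn ord_prime //; lia.
exists (J + I) => P; rewrite ordD HI HJ inE eq_sym.
by case: eqP => [->|_] /=; [rewrite (negPf QL); lia|lia].
Qed.

Lemma pval_add P x y k : prime_ideal P -> x != 0 -> y != 0 -> x + y != 0 ->
  k <= pval P x -> k <= pval P y -> k <= pval P (x + y).
Proof.
move=> pP x0 y0 xy0 kx ky.
pose L := undup (support (pid R x) ++ support (pid R y)).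
have pL : primes_seq L.
  by move=> Q; rewrite mem_undup mem_cat => /orP[] /support_prime.
have [I HI] := ideal_of_ords (fun Q => Num.min (pval Q x) (pval Q y)) (undup_uniq _) pL.
have ordI Q : ord Q I = Num.min (pval Q x) (pval Q y).
  rewrite HI; case: ifPn => //; rewrite mem_undup mem_cat negb_or => /andP[nx ny].
  have -> : pval Q x = 0 by apply/eqP; apply: contraNT nx; exact: ord_support.
  by have -> : pval Q y = 0 by apply/eqP; apply: contraNT ny; exact: ord_support.
have Ix : ival I x by apply/mem_ord => // Q _; rewrite ordI; lia.
have Iy : ival I y by apply/mem_ord => // Q _; rewrite ordI; lia.
have /mem_ord/(_ P pP) := subD (ival_sub I) Ix Iy.
by rewrite ordI => /(_ xy0); lia.
Qed.

Lemma ideal_of_set (A : set K) : is_ideal R A -> nonzero A -> exists I, ival I = A.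
Proof.
move=> idA nA; have [s [_ ->]] := ideal_factorization (ded_ded R) idA nA.
by eexists.
Qed.

Lemma crt I J : integral_ideal I -> integral_ideal J ->
  (forall P, prime_ideal P -> 1 <= ord P I -> 1 <= ord P J -> False) ->
  exists x y, [/\ ival I x, ival J y & x + y = 1].
Proof.
move=> iI iJ cop; pose D := idealD (ival I) (ival J).
have sD : is_submodule R D by apply: idealD_submodule; exact: ival_sub.
have ID : ival I `<=` D by apply: sub_idealDl; exact: (ival_sub J).
have JD : ival J `<=` D by apply: sub_idealDr; exact: (ival_sub I).
have [[x Ix [y Jy e]]|D1] := pselect (D 1); first by exists x, y.
have [|P0 [pP DP]] := @exists_prime _ R D _ D1.
  by split=> //; apply: idealD_sub => //; exact: setR_submodule.
have [z Iz z0] := invideal_nonzero I.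
have [||P PE] := @ideal_of_set P0; first by case: pP.
  by exists z; [exact/DP/ID|].
subst P0; exfalso; apply: (cop P) => //; apply/le_prime => //; exact: subset_trans DP.
Qed.

Lemma ideal_avoid P I : prime_ideal P -> integral_ideal I -> ord P I = 0 ->
  exists2 x, ival I x & ~ ival P x.
Proof.
move=> pP iI oI; apply: contrapT => H.
have /le_prime : ival I `<=` ival P.
  by move=> x Ix; apply: contrapT => Px; apply: H; exists x.
by rewrite oI => /(_ pP iI).
Qed.

Lemma class_eq I J : ideal_class I = ideal_class J <-> I - J \in @principal K R.
Proof. by rewrite Quotient.idealrBE; split=> /eqP. Qed.

Lemma class_eq0 I : ideal_class I = 0 <-> I \in @principal K R.
Proof.
have <- : ideal_class 0 = 0 :> Cl R by rewrite /ideal_class piE.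
by rewrite class_eq subr0.
Qed.

Lemma classD I J : ideal_class (I + J) = ideal_class I + ideal_class J.
Proof. by rewrite /ideal_class piE. Qed.
Lemma class0 : ideal_class (0 : invideal R) = 0.
Proof. by rewrite /ideal_class piE. Qed.
Lemma classMn I n : ideal_class (I *+ n) = ideal_class I *+ n.
Proof. by elim: n => [|n IH]; rewrite ?class0 // !mulrS classD IH. Qed.
Lemma class_sum (T : Type) (r : seq T) (f : T -> invideal R) :
  ideal_class (\sum_(i <- r) f i) = \sum_(i <- r) ideal_class (f i).
Proof. by elim: r => [|i r IH]; rewrite ?big_nil ?class0 // !big_cons classD IH. Qed.
Lemma class_surj (c : Cl R) : exists I, ideal_class I = c.
Proof. by exists (repr c); rewrite /ideal_class reprK. Qed.

Lemma torsion_principal : torsion (Cl R) -> forall I, exists2 n, (0 < n)%N & I *+ n \in @principal K R.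
Proof.
move=> tor I; have [n n0 e] := tor (ideal_class I); exists n => //.
by apply/class_eq0; rewrite classMn.
Qed.

End IdealCalculus.

Record orderIn (K : fieldType) (R : dedDomain K) := OrderIn {
  ord_ring :> subringClosed K;
  ord_sub : {subset ord_ring <= R};
  ord_cond : nonzero (conductor R ord_ring);
  ord_fin : finite_set (residue R (conductor R ord_ring)) }.

(** * Orders and their conductors *)

Section Orders.
Variables (K : fieldType) (R : dedDomain K) (O : orderIn R).
Implicit Types (x y a b : K) (I J P Q : invideal R).

Definition cond : set K := conductor R O.

Lemma cond_ideal : is_ideal R cond.
Proof.
split; last by move=> x [].
split.
- by split=> [|r _]; rewrite ?mul0r rpred0.
- move=> x y [xR xO] [yR yO]; split=> [|r rR]; first exact: rpredD.
  by rewrite mulrDl rpredD ?xO ?yO.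
- move=> a x aR [xR xO]; split=> [|r rR]; first exact: rpredM.
  by rewrite (mulrC a) -mulrA; apply: xO; exact: rpredM.
Qed.

Lemma cond_sub : is_submodule R cond. Proof. by case: cond_ideal. Qed.
Lemma cond_R x : cond x -> x \in R. Proof. by case. Qed.
Lemma cond_O x : cond x -> x \in O.
Proof. by case=> _ /(_ 1); rewrite mulr1; apply; exact: rpred1. Qed.
Lemma O_R x : x \in O -> x \in R. Proof. exact: ord_sub. Qed.

Definition cgr x y := cond (x - y).

Lemma cgr_refl x : cgr x x.
Proof. by rewrite /cgr subrr; exact: (sub0 cond_sub). Qed.
Lemma cgr_sym x y : cgr x y -> cgr y x.
Proof. by rewrite /cgr => /(subN cond_sub); rewrite opprB. Qed.
Lemma cgr_trans y x z : cgr x y -> cgr y z -> cgr x z.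
Proof. by move=> xy /(subD cond_sub xy); rewrite addrA subrK. Qed.
Lemma cgrMl a x y : a \in R -> cgr x y -> cgr (a * x) (a * y).
Proof. by move=> aR; rewrite /cgr -mulrBr; apply: (subM cond_sub). Qed.
Lemma cgrMr a x y : a \in R -> cgr x y -> cgr (x * a) (y * a).
Proof. by rewrite !(mulrC _ a); exact: cgrMl. Qed.
Lemma cgrM x y z t : y \in R -> z \in R -> cgr x y -> cgr z t -> cgr (x * z) (y * t).
Proof. by move=> yR zR /(cgrMr zR) + /(cgrMl yR); exact: cgr_trans. Qed.
Lemma cgrX x y n : x \in R -> y \in R -> cgr x y -> cgr (x ^+ n) (y ^+ n).
Proof.
move=> xR yR xy; elim: n => [|n IH]; first exact: cgr_refl.
by rewrite !exprS; apply: cgrM => //; exact: rpredX.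
Qed.
Lemma cgr_O x y : cgr x y -> y \in O -> x \in O.
Proof. by move=> /cond_O xy yO; rewrite -[x](subrK y) rpredD. Qed.

Lemma pigeonhole_cond (f : nat -> K) : (forall n, f n \in R) ->
  exists i j, (i < j)%N /\ cgr (f j) (f i).
Proof.
move=> fR; apply: contrapT => H; apply: infinite_nat.
pose c x : set K := [set x + y | y in cond].
have inj : injective (fun n => c (f n)).
  move=> i j e; have ij : cgr (f i) (f j).
    have [y yc ye] : c (f j) (f i).
      by rewrite -e; exists 0; rewrite ?addr0 //; exact: (sub0 cond_sub).
    by rewrite /cgr -ye addrC addKr.
  case: (ltngtP i j) => // lt; case: H; last by exists j, i.
  by exists i, j; split=> //; exact: cgr_sym.
have -> : [set: nat] = (fun n => c (f n)) @^-1` (residue R cond).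
  by apply/seteqP; split=> // n _; exists (f n) => //; exact: fR.
by apply: finite_preimage; [move=> i j _ _; exact: inj|exact: ord_fin].
Qed.

Lemma power_cgr x : x \in R -> exists i j, (i < j)%N /\ cgr (x ^+ j) (x ^+ i).
Proof. by move=> xR; apply: pigeonhole_cond => n; exact: rpredX. Qed.

Lemma power_idem x : x \in R -> exists2 k, (0 < k)%N & cgr (x ^+ k * x ^+ k) (x ^+ k).
Proof.
move=> xR; have [i [j [ij c]]] := power_cgr xR.
pose d := (j - i)%N.
have c1 n : (i <= n)%N -> cgr (x ^+ (n + d)) (x ^+ n).
  move=> le_in; have -> : (n + d = n - i + j)%N by rewrite /d; lia.
  by rewrite -{2}(subnK le_in) !exprD; apply: cgrMl => //; exact: rpredX.
have c2 l n : (i <= n)%N -> cgr (x ^+ (n + l * d)) (x ^+ n).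
  move=> le_in; elim: l => [|l IH]; first by rewrite addn0; exact: cgr_refl.
  apply: cgr_trans IH; have -> : (n + l.+1 * d = n + l * d + d)%N by lia.
  by apply: c1; lia.
have d0 : (0 < d)%N by rewrite subn_gt0.
exists (i.+1 * d)%N; first by rewrite muln_gt0.
by rewrite -exprD; apply: c2; rewrite (leq_trans (leqnSn i)) // leq_pmulr.
Qed.

Definition cop x := x \in R /\ exists2 y, y \in R & cgr (x * y) 1.

Lemma cop1 : cop 1.
Proof. by split; [exact: rpred1|exists 1; rewrite ?rpred1 ?mulr1 //; exact: cgr_refl]. Qed.

Lemma copM x y : cop x -> cop y -> cop (x * y).
Proof.
move=> [xR [x' x'R xx]] [yR [y' y'R yy]]; split; first exact: rpredM.
exists (x' * y'); first exact: rpredM.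
rewrite mulrACA -[1]mulr1; apply: cgrM => //; [exact: rpred1|exact: rpredM].
Qed.

Lemma cop_pow x : cop x -> exists2 k, (0 < k)%N & cgr (x ^+ k) 1.
Proof.
move=> [xR [y yR xy]]; have [i [j [ij c]]] := power_cgr xR.
exists (j - i)%N; first lia.
have c1 : cgr ((x * y) ^+ i * x ^+ (j - i)) ((x * y) ^+ i).
  have -> : (x * y) ^+ i * x ^+ (j - i) = y ^+ i * x ^+ j.
    by rewrite exprMn mulrAC -exprD subnKC ?(ltnW ij) // mulrC.
  by rewrite exprMn (mulrC (x ^+ i)); apply: cgrMl => //; exact: rpredX.
have c2 : cgr ((x * y) ^+ i) 1.
  by rewrite -(expr1n _ i); apply: cgrX; [exact: rpredM|exact: rpred1|].
apply: cgr_trans (cgr_trans c1 c2); apply: cgr_sym.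
by rewrite -[X in cgr _ X]mul1r; apply: cgrMr => //; exact: rpredX.
Qed.

Lemma division t x : t \in O -> cop t -> x \in R -> t * x \in O -> x \in O.
Proof.
move=> tO ct xR tx; have [[|k] // _ ck] := cop_pow ct.
have c : cgr x (t ^+ k.+1 * x).
  by apply: cgr_sym; rewrite -[X in cgr _ X]mul1r; apply: cgrMr.
by apply: (cgr_O c); rewrite exprSr -mulrA rpredM // rpredX.
Qed.

Lemma unit_O u : u \in O -> u != 0 -> u^-1 \in R -> u^-1 \in O.
Proof.
move=> uO u0 uR; apply: (division uO) => //; last by rewrite divff // rpred1.
by split; [exact: O_R|exists u^-1; rewrite ?divff //; exact: cgr_refl].
Qed.

Definition above P := prime_ideal P /\ cond `<=` ival P.

Definition condI : invideal R := xget 0 [set I | ival I = cond].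
Lemma condIE : ival condI = cond.
Proof.
rewrite /condI; case: xgetP => // H.
have [I IE] := ideal_of_set cond_ideal (ord_cond O).
by have := H I; rewrite /= IE.
Qed.
Lemma condI_integral : integral_ideal condI.
Proof. by rewrite /integral_ideal condIE; exact: cond_R. Qed.

Lemma above_ord P : prime_ideal P -> above P <-> 1 <= ord P condI.
Proof.
move=> pP; rewrite -le_prime //; last exact: condI_integral.
by rewrite condIE; split=> [[]|].
Qed.

Lemma cop_nmem P x : above P -> cop x -> ~ ival P x.
Proof.
move=> [[_ P1 _] fP] [xR [y yR c]] Px; apply: P1.
have -> : 1 = x * y - (x * y - 1) by ring.
apply: (subB (ival_sub P)); last exact: fP.
by rewrite mulrC; apply: (subM (ival_sub P)).
Qed.

Lemma cop_of_primes x : x \in R -> x != 0 -> (forall P, above P -> ~ ival P x) -> cop x.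
Proof.
move=> xR x0 H; have [||P pP|y [z [xy cz e]]] := @crt _ _ (pid R x) condI.
- exact/pid_integral.
- exact: condI_integral.
- move=> Px cP; apply: (H P); first exact/above_ord.
  exact/prime_mem.
- split=> //; move: xy e; rewrite val_pid // => -[r rR <-] e.
  exists r => //; rewrite /cgr -e opprD addNKr.
  by rewrite condIE in cz; exact: (subN cond_sub).
Qed.

Lemma prime_disjoint (S : set K) (J : set K) :
    (forall a b, S a -> S b -> S (a * b)) -> S 1 -> S `<=` [set` R] ->
    is_ideal R J -> nonzero J -> (forall x, J x -> ~ S x) ->
  exists P, [/\ prime_ideal P, J `<=` ival P & forall x, ival P x -> ~ S x].
Proof.
move=> SM S1 SR idJ nJ JS.
pose G := [set I | [/\ is_ideal R I, J `<=` I & forall x, I x -> ~ S x]].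
have noeR : noetherian R by case: (ded_ded R).
have [||P [[idP JP PS] maxP]] := @noetherian_max _ _ G noeR.
- by exists J; split.
- by move=> I [].
have [sP PR] := idP.
have meet x : x \in R -> ~ P x -> exists p r, [/\ P p, r \in R & S (p + x * r)].
  move=> xR Px; apply: contrapT => H; apply: Px.
  have sD : is_submodule R (idealD P (idealP R x)).
    by apply: idealD_submodule => //; apply: idealP_submodule.
  have PD : P `<=` idealD P (idealP R x) by apply: sub_idealDl; apply: idealP_submodule.
  rewrite -(maxP (idealD P (idealP R x))) //.
    by apply: (sub_idealDr sP); apply: idealP_mem.
  split; [split=> //|exact: subset_trans JP PD|].
    apply: (@idealD_sub _ R) => //; first exact: setR_submodule.
    by move=> _ [a aR <-]; apply: rpredM.
  by move=> _ [p Pp [_ [r rR <-] <-]] Sx; apply: H; exists p, r.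
have pP : is_prime R P.
  split=> //; first by move=> P1; exact: (PS 1).
  move=> x y xR yR Pxy; apply: contrapT => /not_orP[Px Py].
  have [p [r [Pp rR Sp]]] := meet _ xR Px; have [q [s [Pq sR Sq]]] := meet _ yR Py.
  apply: (PS _ _ (SM _ _ Sp Sq)).
  have -> : (p + x * r) * (q + y * s) = (q + y * s) * p + (x * r * q + r * s * (x * y)) by ring.
  have xrR : x * r \in R by apply: rpredM.
  apply: (subD sP); first by apply: (subM sP) => //; rewrite rpredD ?rpredM //; exact: PR.
  apply: (subD sP); first exact: (subM sP).
  by apply: (subM sP) => //; exact: rpredM.
have [||I IE] := @ideal_of_set _ R P => //.
  by have [z Jz z0] := nJ; exists z; [exact: JP|].
by subst P; exists I; split.
Qed.

Lemma contraction_maximal P a : prime_ideal P -> a \in O -> ~ ival P a ->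
  exists2 b, b \in O & ival P (a * b - 1).
Proof.
move=> pP aO Pa; have [[sP PR] P1 PM] := pP; have aR := O_R aO.
have Pexp x n : x \in R -> ival P (x ^+ n) -> ival P x.
  move=> xR; elim: n => [/P1 //|n IH]; rewrite exprS => /PM[] //; exact: rpredX.
have [fP|/existsNP[c /not_implyP[cf Pc]]] := pselect (cond `<=` ival P).
  have [i [j [ij c]]] := power_cgr aR; exists (a ^+ (j - i).-1); first exact: rpredX.
  rewrite -exprS prednK ?subn_gt0 //.
  have /PM[] // : ival P (a ^+ i * (a ^+ (j - i) - 1)).
    by rewrite mulrBr mulr1 -exprD subnKC ?(ltnW ij) //; exact: fP.
  - exact: rpredX.
  - by rewrite rpredB ?rpredX ?rpred1.
  - by move/(Pexp _ _ aR).
have cR := cond_R cf; have Pac : ~ ival P (a * c) by move/(PM _ _ aR cR) => [].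
have acR : a * c \in R by apply: rpredM.
have [ac0 vac] := prime_nmem pP acR Pac.
have [||Q pQ|x [y [+ Py e]]] := @crt _ _ (pid R (a * c)) P.
- exact/pid_integral.
- exact: prime_integral.
- rewrite (ord_prime Q pP); case: eqP => [<-|//].
  by rewrite -/(pval P _) vac.
- rewrite val_pid // => -[r rR xe]; exists (c * r).
    by apply: cond_O; rewrite mulrC; apply: (subM cond_sub).
  by rewrite mulrA xe -e opprD addNKr; apply: (subN sP).
Qed.

Lemma prime_over_idem (p : set K) g : is_prime O p -> cond `<=` p -> g \in R ->
    cgr (g * g) g -> (forall s, s \in O -> ~ p s -> ~ cond (s * g)) ->
  exists P, [/\ above P, ~ ival P g & forall a, a \in O -> (ival P a <-> p a)].
Proof.
move=> [[sp pO] p1 pM] fp gR gg H.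
pose S := [set y | y \in R /\ exists s, [/\ s \in O, ~ p s & cgr y s \/ cgr y (s * g)]].
have [||||||P [pP fP PS]] := @prime_disjoint S cond.
- move=> a b [aR [s [sO ps sa]]] [bR [t [tO pt tb]]]; split; first exact: rpredM.
  have sR := O_R sO; have tR := O_R tO.
  exists (s * t); split; [exact: rpredM|by move/(pM _ _ sO tO) => []|].
  case: sa tb => [ca|ca] [cb|cb]; [left|right|right|right].
  + exact: cgrM.
  + by rewrite -mulrA; exact: cgrM.
  + by rewrite mulrAC; apply: cgrM => //; exact: rpredM.
  + have c1 : cgr (a * b) (s * g * (t * g)) by apply: cgrM => //; exact: rpredM.
    apply: (cgr_trans c1); rewrite mulrACA; apply: cgrMl => //; exact: rpredM.
- split; first exact: rpred1.
  by exists 1; split; [exact: rpred1|done|left; exact: cgr_refl].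
- by move=> x [].
- exact: cond_ideal.
- exact: ord_cond.
- move=> x fx [xR [s [sO ps [c|c]]]]; apply: (H s sO ps).
    have := subB cond_sub fx c; rewrite opprB addrC subrK => fs.
    by rewrite mulrC; apply: (subM cond_sub).
  by have := subB cond_sub fx c; rewrite opprB addrC subrK.
have Pp a : a \in O -> ival P a -> p a.
  move=> aO Pa; apply: contrapT => pa; apply: (PS _ Pa); split; first exact: O_R.
  by exists a; split=> //; left; exact: cgr_refl.
exists P; split=> //.
- move=> Pg; apply: (PS _ Pg); split=> //.
  by exists 1; split; [exact: rpred1|done|right; rewrite mul1r; exact: cgr_refl].
- move=> a aO; split; first exact: Pp.
  move=> pa; apply: contrapT => Pa; have [b bO Pab] := contraction_maximal pP aO Pa.
  apply: p1; have -> : 1 = a * b - (a * b - 1) by ring.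
  apply: (subB sp); first by rewrite mulrC; apply: (subM sp).
  by apply: Pp => //; rewrite rpredB ?rpredM ?rpred1.
Qed.

Definition same_contraction P Q := forall a, a \in O -> (ival P a <-> ival Q a).

Lemma idempotent_O g : g \in R -> cgr (g * g) g ->
  (forall P Q, above P -> above Q -> same_contraction P Q -> ival P g -> ival Q g) ->
  g \in O.
Proof.
move=> gR gg H; apply: contrapT => gO.
pose A := [set x | exists a b, [/\ a \in O, b \in O, cond (a * g), cond (b * (1 - g)) & x = a + b]].
have idA : is_ideal O A.
  split; last by move=> _ [a [b [aO bO _ _ ->]]]; apply: rpredD.
  split.
  - by exists 0, 0; rewrite !mul0r addr0 rpred0; split=> //; exact: (sub0 cond_sub).
  - move=> _ _ [a [b [aO bO ca cb ->]]] [c [d [cO dO cc cd ->]]].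
    exists (a + c), (b + d); split; rewrite ?rpredD ?mulrDl //; last exact: addrACA.
      exact: (subD cond_sub).
    exact: (subD cond_sub).
  - move=> r _ rO [a [b [aO bO ca cb ->]]]; exists (r * a), (r * b).
    have rR := O_R rO.
    split; rewrite ?rpredM // -?mulrA; [exact: (subM cond_sub)|exact: (subM cond_sub)|].
    by rewrite mulrDr.
have [[a [b [aO bO ca cb e]]]|A1] := pselect (A 1).
  apply: gO; have -> : g = a * g + b - b * (1 - g) by rewrite -{1}[g]mul1r {1}e; ring.
  by rewrite rpredB ?rpredD //; exact: cond_O.
have [p [pp Ap]] := exists_prime idA A1.
have [[sp pO] p1 pM] := pp.
have fp : cond `<=` p.
  move=> x fx; apply: Ap; exists x, 0; rewrite addr0 mul0r; split=> //.
  - exact: cond_O.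
  - exact: rpred0.
  - by rewrite mulrC; apply: (subM cond_sub).
  - exact: (sub0 cond_sub).
have hR : 1 - g \in R by rewrite rpredB ?rpred1.
have [|P [aP Pg Pp]] := prime_over_idem pp fp gR gg.
  move=> s sO ps cs; apply: ps; apply: Ap; exists s, 0.
  by rewrite addr0 mul0r rpred0; split=> //; exact: (sub0 cond_sub).
have [||Q [aQ Qg Qp]] := prime_over_idem pp fp hR.
- rewrite /cgr; have -> : (1 - g) * (1 - g) - (1 - g) = g * g - g by ring.
  exact: gg.
- move=> s sO ps cs; apply: ps; apply: Ap; exists 0, s.
  by rewrite add0r mul0r rpred0; split=> //; exact: (sub0 cond_sub).
apply: Pg; apply: (H Q) => // [a aO|]; first by rewrite Pp ?Qp.
have [[_ Q1 QM] fQ] := aQ; have [] // := QM g (1 - g) gR hR.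
have -> : g * (1 - g) = - (g * g - g) by ring.
by apply: (subN (ival_sub Q)); exact: fQ.
Qed.

Lemma power_O x : x \in R ->
  (forall P Q, above P -> above Q -> same_contraction P Q -> ival P x -> ival Q x) ->
  exists2 k, (0 < k)%N & x ^+ k \in O.
Proof.
move=> xR H; have [k k0 ck] := power_idem xR; exists k => //.
apply: idempotent_O => // [|P Q aP aQ PQ Px]; first exact: rpredX.
have [[_ P1 PM] _] := aP.
have Px' : ival P x.
  elim: (k) Px => [/P1 //|n IH]; rewrite exprS => /PM[] //; exact: rpredX.
have := H P Q aP aQ PQ Px'; case: (k) k0 => // n _ Qx.
by rewrite exprSr; apply: (subM (ival_sub Q)) => //; exact: rpredX.
Qed.

End Orders.

Section Localisation.
Variables (K : fieldType) (R : dedDomain K) (O : orderIn R).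
Implicit Types (x y a b r s t u : K) (I J P Q : invideal R).

Lemma denominator P x J : prime_ideal P -> x != 0 -> integral_ideal J ->
    ord P J <= pval P x ->
  exists r, [/\ r \in R, ~ ival P r & ival J (r * x)].
Proof.
move=> pP x0 iJ le_Jx.
have [I HI] := ideal_of_ords (fun Q => Num.max 0 (ord Q (J - pid R x)))
  (undup_uniq _) (@support_prime _ _ (J - pid R x)).
have ordI Q : ord Q I = Num.max 0 (ord Q J - pval Q x).
  rewrite HI -ordB; case: ifPn => // /(contraNN (@ord_support _ _ _ _)).
  by rewrite negbK => /eqP ->; rewrite maxxx.
have iI : integral_ideal I by apply/integralP => Q _; rewrite ordI; lia.
have [|r Ir Pr] := ideal_avoid pP iI; first by rewrite ordI; lia.
have rR := iI _ Ir; exists r; split=> //.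
have [r0 _] := prime_nmem pP rR Pr.
apply/mem_ord => [|Q pQ]; first by rewrite mulf_neq0.
by rewrite pvalM //; have /mem_ord/(_ Q pQ) := Ir; rewrite ordI => /(_ r0); lia.
Qed.

Lemma mem_primeX P x k : prime_ideal P -> x \in R -> x != 0 ->
  ival (P *+ k) x <-> k%:Z <= pval P x.
Proof.
move=> pP xR x0; rewrite mem_ord //; split=> [/(_ P pP)|H Q pQ].
  by rewrite ordMn ord_prime // eqxx; lia.
rewrite ordMn ord_prime //; have := pval_ge0 Q x0 xR; case: eqP => [<-|_] /=; lia.
Qed.

Definition inj_contraction :=
  forall P Q, above O P -> above O Q -> same_contraction O P Q -> P = Q.

Lemma inj_contraction_all P Q : inj_contraction -> prime_ideal P -> prime_ideal Q ->
  same_contraction O P Q -> P = Q.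
Proof.
move=> inj pP pQ PQ.
have [fP|/existsNP[c /not_implyP[fc Pc]]] := pselect (cond O `<=` ival P).
  by apply: inj => //; split=> // x fx; apply/PQ; [exact: cond_O|exact: fP].
have cO := cond_O fc; have cR := O_R cO.
have Qc : ~ ival Q c by move=> Qc; apply/Pc/PQ.
apply: prime_eq => // x Px; have xR := prime_integral pP Px.
have [_ _ QM] := pQ; have [] // := QM c x cR xR.
apply/PQ; last by apply: (subM (ival_sub P)).
by apply: cond_O; rewrite mulrC; apply: (subM (cond_sub O)).
Qed.

Lemma cop_pval x P : above O P -> x \in R -> x != 0 -> cop O x -> pval P x = 0.
Proof. by move=> aP xR x0 /(cop_nmem aP)/(prime_nmem (proj1 aP) xR)[]. Qed.

Lemma pval_cop x : x \in R -> x != 0 -> (forall P, above O P -> pval P x = 0) -> cop O x.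
Proof.
move=> xR x0 H; apply: cop_of_primes => // P aP.
by move/(prime_mem (proj1 aP) x0 xR); rewrite H.
Qed.

Lemma cop_factor x y : x \in R -> y \in R -> cop O (x * y) -> cop O y.
Proof.
move=> xR yR [_ [z zR c]]; split=> //; exists (x * z); first exact: rpredM.
by rewrite mulrCA mulrA.
Qed.

(* For coprime elements of O, [orderly] ideals are those generated by their
   quotients: the principal ideals trivial in Pic(O). *)
Definition orderly : {pred invideal R} := fun I => `[< exists a b,
  [/\ a \in O /\ b \in O, a != 0 /\ b != 0, cop O a, cop O b & I = pid R a - pid R b] >].

Fact orderly_closed : zmod_closed orderly.
Proof.
split.
  apply/asboolP; exists 1, 1; rewrite subrr rpred1 oner_neq0.
  by split=> //; exact: cop1.
move=> _ _ /asboolP[a [b [[aO bO] [a0 b0] ca cb ->]]] /asboolP[c [d [[cO dO] [c0 d0] cc cd ->]]].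
apply/asboolP; exists (a * d), (b * c); rewrite !mulf_neq0 // !rpredM //.
split=> //; [exact: copM|exact: copM|].
by rewrite !pidM // opprB addrACA -opprD.
Qed.
HB.instance Definition _ := GRing.isZmodClosed.Build (invideal R) orderly orderly_closed.

Lemma orderly_prin I : I \in orderly -> I \in @principal K R.
Proof.
by move=> /asboolP[a [b [_ [a0 b0] _ _ ->]]]; rewrite rpredB ?pid_prin.
Qed.

Lemma orderly_pid x : x \in O -> x != 0 -> cop O x -> pid R x \in orderly.
Proof.
move=> xO x0 cx; apply/asboolP; exists x, 1; rewrite pid1 subr0 rpred1 oner_neq0.
by split=> //; exact: cop1.
Qed.

Lemma orderly_gen I : I \in orderly -> integral_ideal I ->
  exists x, [/\ x \in O, x != 0, cop O x & I = pid R x].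
Proof.
move=> /asboolP[a [b [[aO bO] [a0 b0] ca cb ->]]]; rewrite -pid_div // => iI.
have x0 : a / b != 0 by rewrite mulf_neq0 ?invr_neq0.
have xR : a / b \in R by apply/pid_integral.
have e : b * (a / b) = a by field.
exists (a / b); split=> //; first by apply: (division bO cb xR); rewrite e.
by apply: (@cop_factor b) => //; [exact: (@O_R _ _ O)|rewrite e].
Qed.

Definition coprimeI I := forall P, above O P -> ord P I = 0.

Definition units_full := forall I, coprimeI I -> I \in @principal K R -> I \in orderly.

Definition factor_units := forall x, x \in R <->
  exists a e, [/\ a \in O, ring_unit [set` R] e & x = a * e].

Lemma coprime_denominator x : x != 0 -> coprimeI (pid R x) ->
  exists t, [/\ t \in R, t != 0, cop O t & t * x \in R /\ cop O (t * x)].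
Proof.
move=> x0 cx.
have [I HI] := ideal_of_ords (fun Q => Num.max 0 (ord Q (- pid R x)))
  (undup_uniq _) (@support_prime _ _ (- pid R x)).
have ordI Q : ord Q I = Num.max 0 (- pval Q x).
  rewrite HI -ordN; case: ifPn => // /(contraNN (@ord_support _ _ _ _)).
  by rewrite negbK => /eqP ->; rewrite maxxx.
have iI : integral_ideal I by apply/integralP => Q _; rewrite ordI; lia.
have [||t [z [It cz e]]] := @crt _ _ I (condI O) iI; first exact: condI_integral.
  move=> P pP; rewrite ordI => oP /(above_ord O pP) aP.
  by have := cx P aP; rewrite -/(pval P x); lia.
have tR := iI _ It; rewrite condIE in cz.
have ct : cop O t.
  split=> //; exists 1; first exact: rpred1.
  by rewrite mulr1 /cgr -e opprD addNKr; exact: (subN (cond_sub O)).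
have [t0|t0] := eqVneq t 0.
  have aO1 P : above O P -> False.
    by move=> aP; apply: (cop_nmem aP ct); rewrite t0; exact: (sub0 (ival_sub P)).
  have [a [b [aR bR b0 xe]]] := ded_qf R x.
  have a0 : a != 0 by apply: contraNneq x0 => a0; rewrite xe a0 mul0r.
  have cc y : y \in R -> y != 0 -> cop O y by move=> yR y0; apply: cop_of_primes => // P /aO1.
  by exists b; split=> //; [exact: cc|rewrite xe mulrCA divff // mulr1; split=> //; exact: cc].
have txR : t * x \in R.
  apply: mem_R_val => [|P pP]; first by rewrite mulf_neq0.
  by rewrite pvalM //; have /mem_ord/(_ P pP) := It; rewrite ordI => /(_ t0); lia.
exists t; split=> //; split=> //; apply: pval_cop; rewrite ?mulf_neq0 // => P aP.
by rewrite pvalM // cop_pval // add0r /pval cx.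
Qed.

Lemma factor_units_full : factor_units -> units_full.
Proof.
move=> fu I cI /prinP[x x0 Ix]; rewrite Ix in cI *.
have [t [tR t0 ct [txR ctx]]] := coprime_denominator x0 cI.
have gen y : y \in R -> y != 0 -> cop O y -> pid R y \in orderly.
  move=> /fu[a [e [aO ue ye]]] y0 cy; have [e0 eR _] := ue.
  have a0 : a != 0 by apply: contraNneq y0 => a0; rewrite ye a0 mul0r.
  rewrite ye mulrC pid_unit //; apply: orderly_pid => //.
  by apply: (@cop_factor e) => //; [exact: (@O_R _ _ O)|rewrite mulrC -ye].
have -> : pid R x = pid R (t * x) - pid R t by rewrite pidM // addrC addKr.
by apply: rpredB; apply: gen => //; rewrite mulf_neq0.
Qed.

Lemma factor_units_inj : factor_units -> inj_contraction.
Proof.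
move=> fu P Q [pP _] [pQ _] PQ; apply: prime_eq => // x Px.
have /fu[a [e [aO [e0 eR eVR] xe]]] := prime_integral pP Px.
have aE : a = e^-1 * x by rewrite xe; field.
have Pa : ival P a by rewrite aE; apply: (subM (ival_sub P)).
by rewrite xe mulrC; apply: (subM (ival_sub Q)) => //; apply/PQ.
Qed.

Section Injective.
Hypothesis inj : inj_contraction.

Lemma root_O x : x \in R -> exists2 k, (0 < k)%N & x ^+ k \in O.
Proof. by move=> xR; apply: power_O => // P Q aP aQ /(inj aP aQ) ->. Qed.

Lemma nmem_prime_exp P x k : prime_ideal P -> x \in R -> ~ ival P x -> ~ ival P (x ^+ k).
Proof.
move=> [_ P1 PM] xR Px; elim: k => [//|k IH]; rewrite exprS.
by move/PM => [] //; exact: rpredX.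
Qed.

Lemma nmem_prime_mul P x y : prime_ideal P -> x \in R -> y \in R ->
  ~ ival P x -> ~ ival P y -> ~ ival P (x * y).
Proof. by move=> [_ _ PM] xR yR Px Py /(PM _ _ xR yR)[]. Qed.

Lemma idempotent_at P N : above O P -> exists e,
  [/\ e \in O, ival (P *+ N) (1 - e) & forall Q, above O Q -> Q != P -> ival Q e].
Proof.
move=> aP; have [pP fP] := aP.
have fge Q := ord_ge0 Q (@condI_integral _ _ O).
pose m := (absz (ord P (condI O)) + N)%N.
pose J := condI O - P *~ ord P (condI O).
have ordMz Q (k : int) : ord Q (P *~ k) = (P == Q)%:Z *~ k.
  by case: k => n; rewrite ?ordN ordMn ord_prime.
have ordJ Q : ord Q J = if P == Q then 0 else ord Q (condI O).
  rewrite ordB ordMz; case: eqP => [<-|_] /=; lia.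
have iJ : integral_ideal J.
  by apply/integralP => Q _; rewrite ordJ; case: ifP => // _; exact: fge.
have iX k : integral_ideal (P *+ k).
  by apply/integralP => Q _; rewrite ordMn ord_prime //; case: eqP => _ /=; lia.
have [|x [e [Px Je xe]]] := @crt _ _ (P *+ m) J (iX _) iJ.
  move=> Q pQ; rewrite ordMn ord_prime // ordJ; case: eqP => //= _; lia.
have eR : e \in R := iJ _ Je; have xR : x \in R := iX _ _ Px.
have x1e : 1 - e = x by rewrite -xe addrK.
have idem : cgr O (e * e) e.
  have [x0|x0] := eqVneq x 0.
    have -> : e = 1 by rewrite -xe x0 add0r.
    by rewrite mulr1; exact: cgr_refl.
  have [->|e0] := eqVneq e 0; first by rewrite mulr0; exact: cgr_refl.
  rewrite /cgr; have -> : e * e - e = - (x * e) by rewrite -x1e; ring.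
  apply: (subN (cond_sub O)); rewrite -condIE; apply/mem_ord; first exact: mulf_neq0.
  move=> Q pQ; rewrite pvalM //.
  have /mem_ord/(_ Q pQ) := Px; rewrite ordMn ord_prime // => /(_ x0) Hx.
  have /mem_ord/(_ Q pQ) := Je; rewrite ordJ => /(_ e0) He.
  have := fge Q; move: Hx He; case: eqP => [<-|_] /=; rewrite /m; lia.
exists e; split.
- by apply: idempotent_O => // A B aA aB /(inj aA aB) ->.
- rewrite x1e; have [->|x0] := eqVneq x 0; first exact: (sub0 (ival_sub _)).
  by apply/mem_primeX => //; have /(mem_primeX _ pP xR x0) := Px; rewrite /m; lia.
- move=> Q aQ QP; have [pQ _] := aQ; have [->|e0] := eqVneq e 0.
    exact: (sub0 (ival_sub _)).
  apply/prime_mem => //; have /mem_ord/(_ Q pQ) := Je; rewrite ordJ (eq_sym P) (negPf QP).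
  by move=> /(_ e0); have /(above_ord O pQ) := aQ; lia.
Qed.

Definition sim P u u' := exists s t,
  [/\ s \in O, t \in O, ~ ival P s, ~ ival P t & s * u' = t * u].

Lemma sim_pval P u u' : prime_ideal P -> u != 0 -> sim P u u' -> u' != 0 /\ pval P u' = pval P u.
Proof.
move=> pP u0 [s [t [sO tO Ps Pt e]]].
have [s0 vs] := prime_nmem pP (O_R sO) Ps; have [t0 vt] := prime_nmem pP (O_R tO) Pt.
have u'0 : u' != 0.
  apply/eqP => u'0; move/eqP: e; rewrite u'0 mulr0 eq_sym mulf_eq0.
  by rewrite (negPf t0) (negPf u0).
by split=> //; move/(congr1 (pval P)): e; rewrite !pvalM // vs vt; lia.
Qed.

Lemma sim_mull P a u u' : prime_ideal P -> a \in O -> ~ ival P a -> sim P u u' -> sim P u (a * u').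
Proof.
move=> pP aO Pa [s [t [sO tO Ps Pt e]]]; exists s, (a * t).
split=> //; [exact: rpredM|by apply: nmem_prime_mul => //; exact: (@O_R _ _ O)|].
by rewrite mulrCA e mulrA.
Qed.

Lemma sim_trans P u u' u'' : prime_ideal P -> sim P u u' -> sim P u' u'' -> sim P u u''.
Proof.
move=> pP [s [t [sO tO Ps Pt e]]] [s' [t' [sO' tO' Ps' Pt' e']]].
exists (s * s'), (t * t'); split; rewrite ?rpredM //.
- by apply: nmem_prime_mul => //; exact: (@O_R _ _ O).
- by apply: nmem_prime_mul => //; exact: (@O_R _ _ O).
- by rewrite -mulrA e' mulrCA e mulrCA mulrA.
Qed.

Lemma localize P u : above O P -> u \in O -> u != 0 -> exists u',
  [/\ u' \in O, u' != 0, sim P u u' & forall Q, above O Q -> Q != P -> ~ ival Q u'].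
Proof.
move=> aP uO u0; have [pP fP] := aP; have uR := O_R uO.
have [n nE] : exists n : nat, pval P u = n%:Z.
  by exists (absz (pval P u)); rewrite gez0_abs // pval_ge0.
have [m mE] : exists m : nat, ord P (condI O) = m%:Z.
  by exists (absz (ord P (condI O))); rewrite gez0_abs // ord_ge0 //; exact: condI_integral.
have [e [eO Pe Qe]] := idempotent_at (n + m.+1) aP.
have eR := O_R eO; have e1R : 1 - e \in R by rewrite rpredB ?rpred1.
have sub k : is_submodule R (ival (P *+ k)) by exact: ival_sub.
have Pk k : (k <= n + m.+1)%N -> ival (P *+ k) (1 - e).
  move=> kN; have [->|x0] := eqVneq (1 - e) 0; first exact: (sub0 (sub _)).
  apply/mem_primeX => //; have /(mem_primeX _ pP e1R x0) := Pe.
  by apply: le_trans; rewrite lez_nat.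
have nPe : ~ ival P e.
  move=> Pe'; have [_ P1 _] := pP; apply: P1.
  have := Pk 1%N; rewrite mulr1n addnS => /(_ isT) P1e.
  by have := subD (ival_sub P) P1e Pe'; rewrite subrK.
have [e0 ve] := prime_nmem pP eR nPe.
pose u' := u * e + (1 - e).
have u'O : u' \in O by rewrite rpredD ?rpredM // rpredB ?rpred1.
have u'R := O_R u'O.
have ue0 : u * e != 0 by rewrite mulf_neq0.
have ueR : u * e \in R by rewrite rpredM.
have vue : pval P (u * e) = n%:Z by rewrite pvalM // ve nE addr0.
have nu' : ~ ival (P *+ n.+1) u'.
  have Pe1 : ival (P *+ n.+1) (1 - e) by apply: Pk; rewrite addnS ltnS leq_addr.
  move=> /(subB (sub _))/(_ Pe1); rewrite /u' addrK => /(mem_primeX _ pP ueR ue0).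
  by rewrite vue lez_nat ltnn.
have u'0 : u' != 0 by apply/eqP => u'0; apply: nu'; rewrite u'0; exact: (sub0 (sub _)).
exists u'; split=> //; last first.
  move=> Q aQ QP Qu'; have [[_ Q1 _] _] := aQ; apply: Q1.
  have Q_e := Qe Q aQ QP.
  have -> : 1 = u' + (1 - u) * e by rewrite /u'; ring.
  apply: (subD (ival_sub Q)) => //; apply: (subM (ival_sub Q)) => //.
  by rewrite rpredB ?rpred1.
have vu' : pval P u' = n%:Z.
  apply/eqP; rewrite eq_le; apply/andP; split.
    rewrite leNgt; apply/negP => lt_n; apply: nu'.
    by apply/mem_primeX.
  apply/mem_primeX => //; apply: (subD (sub _)); last by apply: Pk; exact: leq_addr.
  by apply/mem_primeX; rewrite ?vue.
have [s [sO Ps sf]] : exists s, [/\ s \in O, ~ ival P s & cond O (s * ((1 - e) / u))].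
  have [x0|x0] := eqVneq (1 - e) 0.
    exists 1; rewrite rpred1 x0 mul0r mulr0; split=> //; first by case: pP.
    exact: (sub0 (cond_sub O)).
  have [||||r [rR Pr fr]] := @denominator P ((1 - e) / u) (condI O).
  - exact: pP.
  - by rewrite mulf_neq0 ?invr_neq0.
  - exact: condI_integral.
  - rewrite pval_div // mE nE lerBrDr -PoszD addnC.
    apply/mem_primeX => //; apply: Pk; by rewrite leq_add2l.
  have [[|k] // _ rk] := root_O rR; exists (r ^+ k.+1); split=> //.
    exact: nmem_prime_exp.
  rewrite condIE in fr; rewrite exprSr -mulrA; apply: (subM (cond_sub O)) => //.
  exact: rpredX.
have tO : s * e + s * ((1 - e) / u) \in O by apply: rpredD; [exact: rpredM|exact: cond_O sf].
have st : s * u' = (s * e + s * ((1 - e) / u)) * u by rewrite /u'; field.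
exists s, (s * e + s * ((1 - e) / u)); split=> //.
have [s0 vs] := prime_nmem pP (O_R sO) Ps.
set t := (s * e + _) in tO st *.
have t0 : t != 0.
  by apply: contraTneq (mulf_neq0 s0 u'0) => t0; rewrite st t0 mul0r eqxx.
move=> /(prime_mem pP t0 (O_R tO)).
move/(congr1 (pval P)): st; rewrite !pvalM // vs vu' nE add0r.
by move=> /eqP; rewrite -subr_eq subrr => /eqP <-.
Qed.

Lemma glue (L : seq (invideal R)) (f : invideal R -> K) :
  uniq L -> (forall P, P \in L -> [/\ above O P, f P \in O & f P != 0]) ->
  exists b, [/\ b \in O, b != 0, forall P, P \in L -> sim P (f P) b
    & forall Q, above O Q -> Q \notin L -> ~ ival Q b].
Proof.
elim: L => [_ _|P L IH /= /andP[PL uL] HL].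
  exists 1; rewrite rpred1 oner_neq0; split=> // Q [[_ Q1 _] _] _ //.
have [|b [bO b0 sb nb]] := IH uL.
  by move=> Q QL; apply: HL; rewrite inE QL orbT.
have [aP fO f0] : [/\ above O P, f P \in O & f P != 0] by apply: HL; rewrite inE eqxx.
have [u [uO u0 su nu]] := localize aP fO f0.
exists (b * u); split; rewrite ?mulf_neq0 ?rpredM //.
- move=> Q; rewrite inE; case: eqP => [-> _|/eqP QP /= QL].
    by apply: sim_mull => //; [case: aP|exact: nb].
  rewrite mulrC; have [aQ _ _] : [/\ above O Q, f Q \in O & f Q != 0].
    by apply: HL; rewrite inE QL orbT.
  by apply: sim_mull => //; [case: aQ|exact: nu|exact: sb].
- move=> Q aQ; rewrite inE negb_or => /andP[QP QL].
  by apply: nmem_prime_mul; rewrite ?(@O_R _ _ O) //; [case: aQ|exact: nb|exact: nu].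
Qed.

Definition above_seq := [seq P <- support (condI O) | `[< above O P >]].

Lemma above_seqP P : P \in above_seq <-> above O P.
Proof.
rewrite mem_filter; split=> [/andP[/asboolP]//|aP]; apply/andP; split; first exact/asboolP.
by apply: ord_support; have /(above_ord O (proj1 aP)) := aP; lia.
Qed.

Lemma above_seq_uniq : uniq above_seq.
Proof. by rewrite filter_uniq // undup_uniq. Qed.

Lemma local_global x : x \in R ->
  (forall P, above O P -> exists s, [/\ s \in O, ~ ival P s & s * x \in O]) -> x \in O.
Proof.
move=> xR H.
have [[P0 aP0]|noP] := pselect (exists P, above O P); last first.
  have [f1|f1] := pselect (cond O 1).
    by case: f1 => _ /(_ x xR); rewrite mul1r.
  have [P [pP fP]] := exists_prime (cond_ideal O) f1.
  have [||I IE] := @ideal_of_set _ R P; first by case: pP.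
    by have [z fz z0] := ord_cond O; exists z; [exact: fP|].
  by subst P; case: noP; exists I.
have [s [sO sx ns]] : exists s, [/\ s \in O, s * x \in O & forall P, above O P -> ~ ival P s].
  suff : forall L, uniq L -> (forall P, P \in L -> above O P) ->
      exists s, [/\ s \in O, s * x \in O & (forall P, P \in L -> ~ ival P s)
        /\ forall P, above O P -> P \notin L -> ival P s].
    move=> /(_ _ above_seq_uniq)[P /above_seqP //|s [sO sx [ns _]]].
    by exists s; split=> // P /above_seqP/ns.
  elim=> [_ _|P L IH /= /andP[PL uL] aL].
    by exists 0; rewrite mul0r rpred0; split=> //; split=> // P _ _; exact: (sub0 (ival_sub _)).
  have aP : above O P by apply: aL; rewrite inE eqxx.
  have [|s [sO sx [ns s0]]] := IH uL.
    by move=> Q QL; apply: aL; rewrite inE QL orbT.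
  have [t [tO Pt tx]] := H P aP.
  have [e [eO Pe Qe]] := idempotent_at 1 aP.
  rewrite mulr1n in Pe; have [pP _] := aP; have [_ P1 PM] := pP.
  exists (s + t * e); split; first by rewrite rpredD ?rpredM.
    by rewrite mulrDl mulrAC; apply: rpredD => //; apply: rpredM.
  split=> Q.
    rewrite inE; case: eqP => [-> _|/eqP QP /= QL].
      have nPe : ~ ival P e.
        by move=> Pe'; apply: P1; have := subD (ival_sub P) Pe Pe'; rewrite subrK.
      have Ps := s0 P aP PL.
      move=> /(subB (ival_sub P))/(_ Ps); rewrite addrC addKr.
      by move/(PM _ _ (O_R tO) (O_R eO)) => [].
    have aQ : above O Q by apply: aL; rewrite inE QL orbT.
    have Qte : ival Q (t * e) by apply: (subM (ival_sub Q)); [exact: (@O_R _ _ O)|exact: Qe].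
    by move=> /(subB (ival_sub Q))/(_ Qte); rewrite addrK; exact: ns.
  move=> aQ; rewrite inE negb_or => /andP[QP QL].
  apply: (subD (ival_sub Q)); first exact: s0.
  by apply: (subM (ival_sub Q)); [exact: (@O_R _ _ O)|exact: Qe].
have s0 : s != 0.
  by apply/eqP => s0; apply: (ns _ aP0); rewrite s0; exact: (sub0 (ival_sub _)).
by apply: (division sO) => //; apply: cop_of_primes => //; exact: (@O_R _ _ O).
Qed.

End Injective.

End Localisation.

Lemma sumz_ge (T : eqType) (s : seq T) (f : T -> int) (k : int) :
  (forall p, p \in s -> k <= f p) -> k *+ size s <= \sum_(p <- s) f p.
Proof.
elim: s => [_|p s IH H]; first by rewrite big_nil.
rewrite big_cons mulrS lerD ?H ?inE ?eqxx //.
by apply: IH => q qs; apply: H; rewrite inE qs orbT.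
Qed.

Lemma prod_nseq (A : pzSemiRingType) (x : A) n : \prod_(y <- nseq n x) y = x ^+ n.
Proof. by elim: n => [|n IH]; rewrite ?big_nil // big_cons IH exprS. Qed.

(** * Lifting factorizations along a transfer homomorphism *)

Section Lifting.
Variables (K : fieldType) (R : dedDomain K) (O : orderIn R).
Implicit Types (x y a b r s t u v w : K) (I J P Q : invideal R).

Definition nz (D : subringClosed K) x := x \in D /\ x != 0.

Lemma nz1 (D : subringClosed K) : nz D 1.
Proof. by split; rewrite ?rpred1 ?oner_neq0. Qed.
Lemma nzM (D : subringClosed K) x y : nz D x -> nz D y -> nz D (x * y).
Proof. by move=> [xD x0] [yD y0]; split; rewrite ?rpredM ?mulf_neq0. Qed.
Lemma nzX (D : subringClosed K) x n : nz D x -> nz D (x ^+ n).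
Proof. by move=> [xD x0]; split; rewrite ?rpredX ?expf_neq0. Qed.
Lemma nz_R x : nz O x -> nz R x.
Proof. by move=> [/O_R]. Qed.
Lemma nz_unit e : ring_unit [set` R] e -> nz R e.
Proof. by case. Qed.

(* An abstraction of "theta x and theta y are associated", for the extension of
   a transfer homomorphism theta from O to R. *)

Record lifting (eqv : K -> K -> Prop) : Prop := Lifting {
  lift_unit : forall e x, ring_unit [set` R] e -> nz R x -> eqv (e * x) x;
  lift_sym : forall x y, eqv x y -> eqv y x;
  lift_trans : forall y x z, eqv x y -> eqv y z -> eqv x z;
  liftM : forall x y z t, eqv x y -> eqv z t -> eqv (x * z) (y * t);
  lift_split : forall u a b, nz O u -> nz R a -> nz R b -> eqv u (a * b) ->
    exists v w, [/\ nz O v, nz O w, u = v * w, eqv v a & eqv w b];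
  lift_one : forall u, nz O u -> eqv u 1 -> u^-1 \in R }.

Section TransferLifting.
Variables (B : cmonoidType) (theta : dot O -> B).
Hypotheses (krB : krull B) (trB : transfer_hom theta).

Let thetaM (x y : dot O) : theta (x * y)%g = (theta x * theta y)%g.
Proof. by have [[_ ->]] := trB. Qed.
Let theta1 : theta 1%g = 1%g.
Proof. by have [[->]] := trB. Qed.

Let thetaX (x : dot O) n : theta (x ^+ n)%g = (theta x ^+ n)%g.
Proof. by elim: n => [|n IH]; rewrite ?theta1 // !expgS thetaM IH. Qed.

Definition mkdot (D : subringClosed K) x (h : nz D x) : dot D :=
  Defs.Dot (introT andP (conj (proj1 h) (proj2 h))).

Lemma dot_nz (D : subringClosed K) (x : dot D) : nz D (dotval x).
Proof. by have /andP := dotP x. Qed.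

Let c0_ex : exists c, cond O c /\ nz O c.
Proof.
by have [c fc c0] := ord_cond O; exists c; split=> //; split=> //; exact: (@cond_O _ _ O).
Qed.

Lemma dot_expE (D : subringClosed K) (x : dot D) n : dotval (x ^+ n)%g = dotval x ^+ n.
Proof. by elim: n => [|n IH] //; rewrite expgS exprS /= IH. Qed.

(* theta (c r) / theta c lies in B since theta c times its n-th power is
   theta (c r^n). *)
Let ext (c : K) (fc : cond O c) (cO : nz O c) : exists th : dot R -> B, forall (r : dot R) (y : dot O),
  dotval y = c * dotval r -> theta y = (th r * theta (mkdot cO))%g.
Proof.
suff /choice[th thP] : forall r : dot R, exists b : B, forall y : dot O,
    dotval y = c * dotval r -> theta y = (b * theta (mkdot cO))%g by exists th.
move=> r; have [rR r0] := dot_nz r; have [cO' c0] := cO.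
have crn s : nz R s -> nz O (c * s).
  by move=> [sR s0]; split; [by have [_] := fc; apply|rewrite mulf_neq0].
have [cic _] := krB.
have [|b _ /qfracP e] := cic (qfrac (theta (mkdot (crn _ (dot_nz r)))) (theta (mkdot cO))).
- exists (theta (mkdot cO)) => n.
  exists (theta (mkdot (crn _ (nzX n (dot_nz r))))) => //.
  have qX (a d : B) : (qfrac a d ^+ n)%g = qfrac (a ^+ n)%g (d ^+ n)%g.
    elim: n => [|n IH]; first by [].
    by rewrite !expgS IH; exact: qmulE.
  rewrite qX /qinj; apply/esym; rewrite [LHS]qmulE; apply/qfracP.
  rewrite mulg1 mul1g -!thetaX -!thetaM; congr theta; apply/val_inj => /=.
  by rewrite !dot_expE /= exprMn; ring.
- by exists b => y ye; rewrite e mulg1; congr theta; apply/val_inj.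
Qed.

Lemma transfer_lifting : exists eqv, lifting eqv.
Proof.
have [c [fc cO]] := c0_ex; have [cO' c0] := cO.
have [th thP] := ext fc cO.
have crn s : nz R s -> nz O (c * s).
  by move=> [sR s0]; split; [by have [_] := fc; apply|rewrite mulf_neq0].
have thE (r : dot R) : theta (mkdot (crn _ (dot_nz r))) = (th r * theta (mkdot cO))%g by exact: thP.
have thM (r s : dot R) : th (r * s)%g = (th r * th s)%g.
  have cI (a b d : B) : (a * d = b * d)%g -> a = b.
    by rewrite !(cmulgC _ d) => /cmulgI.
  apply: (cI _ _ (theta (mkdot cO))); apply: (cI _ _ (theta (mkdot cO))).
  have -> : (th r * th s * theta (mkdot cO) * theta (mkdot cO) =
      (th r * theta (mkdot cO)) * (th s * theta (mkdot cO)))%g.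
    by rewrite cmulgACA !mulgA.
  rewrite -!thE -!thetaM; congr theta; apply/val_inj => /=; ring.
have thO (u : dot O) (r : dot R) : dotval u = dotval r -> theta u = th r.
  move=> ur; have cI (a b d : B) : (a * d = b * d)%g -> a = b.
    by rewrite !(cmulgC _ d) => /cmulgI.
  apply: (cI _ _ (theta (mkdot cO))); rewrite -thE -thetaM; congr theta; apply/val_inj => /=.
  by rewrite ur mulrC.
have asym (a b : B) : massoc a b -> massoc b a.
  move=> [e [e' ee] ->]; exists e'; first by exists e; rewrite cmulgC.
  by rewrite mulgA (cmulgC e') ee mul1g.
have atrans (a b d : B) : massoc a b -> massoc b d -> massoc a d.
  move=> [e [e' ee] ->] [f [f' ff] ->]; exists (e * f)%g; last by rewrite mulgA.
  by exists (e' * f')%g; rewrite cmulgACA ee ff mulg1.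
have aM (a b d f : B) : massoc a b -> massoc d f -> massoc (a * d)%g (b * f)%g.
  move=> [e [e' ee] ->] [g [g' gg] ->]; exists (e * g)%g; last by rewrite cmulgACA.
  by exists (e' * g')%g; rewrite cmulgACA ee gg mulg1.
have arefl (a : B) : massoc a a by exists 1%g; rewrite ?mul1g //; exists 1%g; rewrite mulg1.
have th1 : th 1%g = 1%g.
  by rewrite -(thO 1%g) ?theta1.
have thR (r s : dot R) : dotval r = dotval s -> th r = th s by move=> /val_inj ->.
exists (fun x y => exists r s : dot R, [/\ dotval r = x, dotval s = y & massoc (th r) (th s)]).
have [_ [_ t1] t2] := trB.
split.
- move=> e x ue xR; have [e0 eR eVR] := ue; have [xR' x0] := xR.
  have eV0 : nz R e^-1 by split; rewrite ?invr_neq0.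
  exists (mkdot (nzM (nz_unit ue) xR)), (mkdot xR); split=> //.
  exists (th (mkdot (nz_unit ue))).
    exists (th (mkdot eV0)); rewrite -thM -th1; apply: thR => /=; exact: divff.
  by rewrite -thM; apply: thR.
- by move=> x y [r [s [rx sy rs]]]; exists s, r; split=> //; exact: asym.
- move=> y x z [r [s [rx sy rs]]] [s' [t [sy' tz st]]]; exists r, t; split=> //.
  by apply: atrans rs _; have -> : s = s' by apply/val_inj; rewrite /= sy sy'.
- move=> x y z t [r [s [<- <- rs]]] [r' [s' [<- <- rs']]].
  by exists (r * r')%g, (s * s')%g; split=> //; rewrite !thM; exact: aM.
- move=> u a b uO aR bR [r [s [ru sab [e [e' ee] re]]]].
  have e1 : theta (mkdot uO) = ((e * th (mkdot aR)) * th (mkdot bR))%g.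
    rewrite -mulgA -thM -(thR s) ?sab // -re; exact: thO.
  have [v [w [uE va wb]]] := t2 _ _ _ e1.
  have vR : nz R (dotval v) := nz_R (dot_nz v); have wR : nz R (dotval w) := nz_R (dot_nz w).
  exists (dotval v), (dotval w); split; [exact: dot_nz|exact: dot_nz|by move/(congr1 val): uE| |].
    exists (mkdot vR), (mkdot aR); split=> //; rewrite -(thO v) //.
    by apply: (atrans _ _ _ va); exists e => //; exists e'.
  by exists (mkdot wR), (mkdot bR); split=> //; rewrite -(thO w).
- move=> u uO [r [s [ru s1 [e [e' ee] re]]]].
  have : munit (theta (mkdot uO)).
    rewrite (thO _ r) // re (thR s 1%g) // th1 mulg1; by exists e'.
  move=> /t1[w /(congr1 val)/= uw]; have [_ u0] := uO.
  have -> : u^-1 = dotval w by apply: (mulfI u0); rewrite divff.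
  by have [/O_R] := dot_nz w.
Qed.

End TransferLifting.

Section Lift.
Variable eqv : K -> K -> Prop.
Hypothesis lft : lifting eqv.

Lemma lift_refl x : nz R x -> eqv x x.
Proof.
move=> xR; rewrite -{1}[x]mul1r; apply: (lift_unit lft) => //.
by split; rewrite /= ?invr1 ?oner_neq0 ?rpred1.
Qed.

Lemma liftX x y n : nz R x -> eqv x y -> eqv (x ^+ n) (y ^+ n).
Proof.
move=> xR xy; elim: n => [|n IH]; first by apply: lift_refl; exact: nz1.
by rewrite !exprS; apply: (liftM lft).
Qed.

Lemma lift_seq (rs : seq K) u : nz O u -> (forall r, r \in rs -> nz R r) ->
    eqv u (\prod_(r <- rs) r) ->
  exists ps : seq (K * K), [/\ unzip2 ps = rs, forall p, p \in ps -> nz O p.1 /\ eqv p.1 p.2,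
    pid R u = \sum_(p <- ps) pid R p.1 & forall p, p \in ps -> exists2 w, w \in O & u = p.1 * w].
Proof.
elim: rs u => [|r rs IH] u uO rsR; rewrite ?big_nil ?big_cons => euv.
  exists [::]; split=> //; rewrite big_nil; have [uO' u0] := uO; apply/pid_eq0 => //.
  by split=> //; [exact: O_R uO'|exact: (lift_one lft uO)].
have rR : nz R r by apply: rsR; rewrite inE eqxx.
have rsR' s : s \in rs -> nz R s by move=> srs; apply: rsR; rewrite inE srs orbT.
have prR : nz R (\prod_(s <- rs) s).
  by rewrite big_seq; elim/big_ind: _ => [|x y|s]; [exact: nz1|exact: nzM|exact: rsR'].
have [v [w [vO wO uE vr wrs]]] := lift_split lft uO rR prR euv.
have [ps [psE psP pidw dvw]] := IH w wO rsR' wrs.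
exists ((v, r) :: ps); split.
- by rewrite /= psE.
- by move=> p; rewrite inE => /predU1P[->//|/psP].
- by rewrite big_cons uE pidM ?pidw //; [case: vO|case: wO].
- move=> p; rewrite inE => /predU1P[-> /=|/dvw[z zO we]].
    by exists w => //; case: wO.
  by exists (v * z); [by apply: rpredM => //; case: vO|rewrite uE we mulrCA].
Qed.

Lemma pid_eq0_lift x : nz R x -> pid R x = 0 -> eqv x 1.
Proof.
move=> [xR x0] /(pid_eq0 _ x0) ux; rewrite -[x]mulr1; apply: (lift_unit lft) => //.
exact: nz1.
Qed.

Lemma deg_ge_ord2 P Q I : prime_ideal P -> prime_ideal Q -> integral_ideal I -> P != Q ->
  ord P I + ord Q I <= deg I.
Proof.
move=> pP pQ /integral_factor[s [ps ->]] PQ; rewrite !ord_primes // deg_primes //.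
elim: s {ps} => //= J s; rewrite -PoszD !lez_nat => IH.
rewrite addnACA -add1n leq_add //.
by have [->|_] := eqVneq J P; [rewrite (negPf PQ)|case: eqP].
Qed.

Hypothesis torR : torsion (Cl R).

Lemma bad_prime_lift P Q x n : above O P -> above O Q -> same_contraction O P Q -> P != Q ->
  x != 0 -> (0 < n)%N -> Q *+ n = pid R x -> eqv x 1.
Proof.
move=> aP aQ PQ nPQ x0 n0 xE; apply: contrapT => nx.
have [pP fP] := aP; have [pQ fQ] := aQ.
have xR : x \in R.
  apply/pid_integral => //; rewrite -xE; apply/integralP => A pA.
  by rewrite ordMn ord_prime //; case: eqP => _ /=; lia.
have [c fc c0] := ord_cond O; have cR : c \in R := cond_R fc.
pose N := (absz (deg (pid R c))).+1.
have cxO : nz O (c * x ^+ N).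
  split; last by rewrite mulf_neq0 ?expf_neq0.
  by apply: cond_O; rewrite mulrC; apply: (subM (cond_sub O)) => //; exact: rpredX.
have cxR := nz_R cxO.
have [||ps [psE psP pidu _]] := @lift_seq (c :: nseq N x) _ cxO.
- by move=> r; rewrite inE => /predU1P[->//|/nseqP[-> _]].
- by rewrite big_cons prod_nseq; exact: lift_refl.
case: ps psE psP pidu => // p0 ps [p0c psE] psP.
rewrite big_cons => pidu.
have {}psE : unzip2 ps = nseq N x by exact: psE.
pose d I : int := deg I - ord Q I.
have dD I J : d (I + J) = d I + d J by rewrite /d degD ordD; lia.
have dsum : d (\sum_(p <- ps) pid R p.1) = \sum_(p <- ps) d (pid R p.1).
  elim: (ps) => [|p l IH]; first by rewrite !big_nil /d deg0 ord0.
  by rewrite !big_cons dD IH.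
have big1 : 1 *+ size ps <= \sum_(p <- ps) d (pid R p.1).
  apply: sumz_ge => p pps.
  have [pO ep] : nz O p.1 /\ eqv p.1 p.2 by apply: psP; rewrite inE pps orbT.
  have p2 : p.2 = x.
    have : p.2 \in unzip2 ps by apply: map_f.
    by rewrite psE mem_nseq => /andP[_ /eqP].
  rewrite p2 in ep; have [pO' p10] := pO; have pR := O_R pO'.
  have ip : integral_ideal (pid R p.1) by apply/pid_integral.
  have [A pA oA] : exists2 A, prime_ideal A & 1 <= ord A (pid R p.1).
    apply: nonunit_prime => //; apply/eqP => p1; apply: nx.
    by apply: (lift_trans lft (lift_sym lft ep)); apply: pid_eq0_lift => //; exact: nz_R.
  have [A' [pA' oA' AQ]] : exists A', [/\ prime_ideal A', 1 <= ord A' (pid R p.1) & A' != Q].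
    have [AQ|AQ] := eqVneq A Q; last by exists A.
    exists P; split=> //; apply/prime_mem => //; apply/PQ => //.
    by rewrite AQ in oA; apply/prime_mem.
  by rewrite /d lerBrDr; apply: le_trans (deg_ge_ord2 pA' pQ ip AQ); rewrite lerD2r.
have szps : size ps = N by rewrite -(size_map snd) -/(unzip2 ps) psE size_nseq.
have d0 : 0 <= d (pid R p0.1).
  have [[p0O p00] _] : nz O p0.1 /\ eqv p0.1 p0.2 by apply: psP; rewrite inE eqxx.
  have := @ord_le_deg _ _ Q (pid R p0.1); rewrite /d subr_ge0; apply.
  by apply/pid_integral => //; exact: O_R p0O.
have := congr1 d pidu; rewrite dD dsum pidM ?expf_neq0 // pidX // -xE dD.
have -> : d (Q *+ n *+ N) = 0.
  by rewrite /d !degMn !ordMn ord_prime // deg_prime // eqxx subrr.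
move: big1 d0; rewrite szps; move: (\sum_(p <- ps) _) (d (pid R p0.1)) => A C.
have : d (pid R c) < N%:Z.
  rewrite /d; have := ord_ge0 Q (proj2 (pid_integral _ c0) cR).
  have := deg_ge0 (proj2 (pid_integral _ c0) cR).
  by rewrite /N; move: (deg _) (ord _ _) => D E; clear; lia.
by move: (d _) => D; rewrite -mulr_natr mul1r natz; clear; lia.
Qed.

(* If distinct primes share their contraction, then a power of an element with
   exactly these primes as divisors lies in O, while each element with just one
   prime divisor among them is equivalent to 1: c x^k cannot split off arbitrarily
   many nonunits of O, since these all have other primes as divisors. *)
Lemma lifting_inj : inj_contraction O.
Proof.
move=> P Q aP aQ PQ; apply: contrapT => /eqP nPQ.
have /choice[g gP] : forall A : invideal R, exists xn : K * nat,
    [/\ xn.1 != 0, (0 < xn.2)%N & A *+ xn.2 = pid R xn.1].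
  move=> A; have [n n0 /prinP[x x0 e]] := torsion_principal torR A.
  by exists (x, n).
pose L := [seq A <- above_seq O | `[< same_contraction O P A >]].
have LP A : A \in L <-> above O A /\ same_contraction O P A.
  rewrite mem_filter; split=> [/andP[/asboolP ? /above_seqP]//|[aA PA]].
  by apply/andP; split; [exact/asboolP|exact/above_seqP].
have gR A : prime_ideal A -> nz R (g A).1.
  have [x0 n0 e] := gP A; move=> pA; split=> //; apply/pid_integral => //.
  by rewrite -e; apply/integralP => A' pA'; rewrite ordMn ord_prime //; case: eqP => _ /=; lia.
have bad A : A \in L -> nz R (g A).1 /\ eqv (g A).1 1.
  move=> /LP[aA PA]; have [x0 n0 e] := gP A.
  split; first by apply: gR; case: aA.
  have [AP|AP] := eqVneq P A; last exact: (bad_prime_lift aP aA PA AP x0 n0 e).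
  subst A; apply: (bad_prime_lift aQ aP _ _ x0 n0 e); last by rewrite eq_sym.
  by move=> a aO; have := PQ a aO; tauto.
pose x := \prod_(A <- L) (g A).1.
have [xR x1] : nz R x /\ eqv x 1.
  rewrite /x; elim: (L) bad => [_|A l IH H].
    by rewrite big_nil; split; [exact: nz1|apply: lift_refl; exact: nz1].
  have [|A1 A2] := H A; first by rewrite inE eqxx.
  have [B1 B2] := IH (fun B Bl => H B (mem_behead (s := A :: l) Bl)).
  rewrite big_cons; split; first exact: nzM.
  by have := liftM lft A2 B2; rewrite mulr1.
have [xR' x0] := xR.
have pidx : pid R x = \sum_(A <- L) A *+ (g A).2.
  rewrite /x; elim: (L) bad => [_|A l IH H]; first by rewrite !big_nil pid1.
  have H' B : B \in l -> nz R (g B).1 /\ eqv (g B).1 1 by move=> Bl; apply: H; rewrite inE Bl orbT.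
  have [[AR A0] _] : nz R (g A).1 /\ eqv (g A).1 1 by apply: H; rewrite inE eqxx.
  rewrite !big_cons pidM //.
    by rewrite IH //; have [_ _ ->] := gP A.
  rewrite prodf_seq_neq0; apply/allP => B /H'[[]] //.
have memx A : above O A -> ival A x <-> A \in L.
  move=> aA; have [pA _] := aA; rewrite prime_mem // /pval pidx ord_sum.
  have ordt B : B \in L -> ord A (B *+ (g B).2) = (B == A)%:Z *+ (g B).2.
    by move=> /LP[[pB _] _]; rewrite ordMn ord_prime.
  split=> [H|AL].
    apply: contrapT => /negP AL; move: H.
    rewrite big_seq big1 // => B BL; rewrite ordt //; case: eqP => [e|_]; last by rewrite mul0rn.
    by move: AL; rewrite -e BL.
  rewrite (big_rem A) //= ordt // eqxx /=.
  have : 0 <= \sum_(B <- rem A L) ord A (B *+ (g B).2).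
    rewrite big_seq; apply: sumr_ge0 => B /mem_rem BL; rewrite ordt //.
    by case: eqP => _ /=; lia.
  have [_ n0 _] := gP A => z0; rewrite -[leLHS]addr0 lerD //.
  by rewrite -[1%Z *+ _]/(_%:R) natz lez_nat.
have [|k k0 xkO] := @power_O _ _ O x xR'.
  move=> A A' aA aA' AA' /(memx _ aA)/LP[_ PA]; apply/memx => //; apply/LP; split=> //.
  by move=> a aO; rewrite (PA a aO); exact: AA'.
have xk1 : eqv (x ^+ k) 1 by rewrite -(expr1n _ k); apply: liftX.
have xkN : nz O (x ^+ k) by split=> //; rewrite expf_neq0.
have xu := lift_one lft xkN xk1.
have : pid R (x ^+ k) = 0.
  by apply/pid_eq0; [rewrite expf_neq0|split; [rewrite expf_neq0|exact: O_R xkO|exact: xu]].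
move=> /(congr1 (ord P)); rewrite ord0 pidX // ordMn.
have : 1 <= pval P x.
  by apply/prime_mem => //; [case: aP|apply/memx => //; apply/LP; split].
rewrite /pval => ge1 /eqP; rewrite mulrn_eq0 => /orP[/eqP k00|/eqP e].
  by rewrite k00 in k0.
by rewrite e in ge1.
Qed.

Lemma lift_nonunit v r : nz O v -> nz R r -> eqv v r -> pid R r != 0 -> pid R v != 0.
Proof.
move=> vO rR vr; apply: contra_neq => v0.
have vR := nz_R vO; have [rR' r0] := rR.
have r1 : eqv r 1 by apply: (lift_trans lft (lift_sym lft vr)); exact: pid_eq0_lift.
have [k k0 rkO] := root_O lifting_inj rR'.
have rkN : nz O (r ^+ k) by split=> //; rewrite expf_neq0.
have rk1 : eqv (r ^+ k) 1 by rewrite -(expr1n _ k); apply: liftX.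
have ru := lift_one lft rkN rk1.
have : pid R (r ^+ k) = 0.
  by apply/pid_eq0; [rewrite expf_neq0|split; [rewrite expf_neq0|exact: O_R rkO|exact: ru]].
rewrite pidX // => e; apply: ord_inj => P pP; rewrite ord0.
move/(congr1 (ord P)): e; rewrite ord0 ordMn => /eqP; rewrite mulrn_eq0.
by case/orP => /eqP // k00; rewrite k00 in k0.
Qed.

End Lift.

End Lifting.

Lemma intMn n k : (n%:R : int) *+ k = (n * k)%:Z.
Proof. by rewrite -mulrnA natz. Qed.

(** * Elements coprime to the conductor *)

Section Arithmetic.
Variables (K : fieldType) (R : dedDomain K) (O : orderIn R).
Implicit Types (x y a b q r s t u v w : K) (I J P Q X Y : invideal R).
Variable eqv : K -> K -> Prop.
Hypothesis lft : lifting O eqv.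
Hypothesis torR : torsion (Cl R).

Local Notation Prin := (@principal K R).
Local Notation Ord := (orderly O).

Let inj : inj_contraction O := lifting_inj lft torR.

Definition divides_in u v := exists2 w, w \in O & u = v * w.

Lemma eqv_pid x y : nz R x -> nz R y -> pid R x = pid R y -> eqv x y.
Proof.
move=> [xR x0] yR e; have [yR' y0] := yR.
have -> : x = x / y * y by field.
by apply: (lift_unit lft) => //; exact: pid_inj.
Qed.

Lemma divides_integral u v : nz O u -> nz O v -> divides_in u v -> integral_ideal (pid R u - pid R v).
Proof.
move=> [uO u0] [vO v0] [w wO e].
have w0 : w != 0 by apply: contraNneq u0 => w0; rewrite e w0 mulr0.
rewrite e pidM // addrC addKr; apply/pid_integral => //; exact: O_R wO.
Qed.

Lemma lift_power u q k : nz O u -> nz R q -> pid R q != 0 -> pid R u = pid R q *+ k ->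
  exists vs : seq K, [/\ size vs = k,
    forall v, v \in vs -> [/\ nz O v, pid R v != 0 & divides_in u v]
    & pid R u = \sum_(v <- vs) pid R v].
Proof.
move=> uO qR q1 e; have [_ q0] := qR.
have [||ps [psE psP pidu dvu]] := @lift_seq _ _ _ _ lft (nseq k q) u uO.
- by move=> r /nseqP[->].
- rewrite prod_nseq; apply: eqv_pid; [exact: nz_R uO|exact: nzX|by rewrite pidX].
exists (unzip1 ps); split.
- by rewrite size_map -(size_map snd) -/(unzip2 ps) psE size_nseq.
- move=> v /mapP[p pps ->]; have [pO ep] := psP _ pps; split=> //; last exact: dvu.
  have pq : p.2 = q.
    have : p.2 \in unzip2 ps by apply: map_f.
    by rewrite psE mem_nseq => /andP[_ /eqP].
  by apply: (lift_nonunit lft torR pO qR) => //; rewrite -pq.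
- by rewrite big_map.
Qed.

Lemma divisor_ord I J P : integral_ideal I -> integral_ideal (J - I) -> 0 <= ord P I <= ord P J.
Proof.
by move=> iI iJI; have := ord_ge0 P iI; have := ord_ge0 P iJI; rewrite ordB subr_ge0 => -> ->.
Qed.

Lemma divisor_primeX I P n : prime_ideal P -> integral_ideal I -> integral_ideal (P *+ n - I) ->
  exists k, I = P *+ k.
Proof.
move=> pP iI iJ; exists (absz (ord P I)); apply: ord_inj => Q pQ.
rewrite ordMn (ord_prime Q pP); have [<-|PQ] := eqVneq P Q.
  by rewrite natz gez0_abs // ord_ge0.
have /andP[] := divisor_ord Q iI iJ.
by rewrite ordMn (ord_prime Q pP) (negPf PQ) mul0rn => ge le; apply/eqP; rewrite mul0rn eq_le le.
Qed.

Lemma pid_nz_integral v : nz O v -> integral_ideal (pid R v).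
Proof. by move=> [vO v0]; apply/pid_integral => //; exact: O_R vO. Qed.

Lemma orderly_of v : nz O v -> coprimeI O (pid R v) -> pid R v \in Ord.
Proof.
move=> [vO v0] cv; apply: orderly_pid => //; apply: pval_cop => //; exact: O_R vO.
Qed.

Lemma coprimeID I J : coprimeI O I -> coprimeI O J -> coprimeI O (I + J).
Proof. by move=> cI cJ P aP; rewrite ordD cI // cJ // addr0. Qed.
Lemma coprimeIMn I n : coprimeI O I -> coprimeI O (I *+ n).
Proof. by move=> cI P aP; rewrite ordMn cI // mul0rn. Qed.
Lemma coprimeI_prime P : prime_ideal P -> ~ above O P -> coprimeI O P.
Proof.
by move=> pP nP Q aQ; rewrite ord_prime //; case: eqP => // PQ; case: nP; rewrite PQ.
Qed.

Lemma principal_pow_orderly I : integral_ideal I -> coprimeI O I -> I \in Prin ->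
  exists q k, [/\ nz R q, I = pid R q, (0 < k)%N & nz O (q ^+ k)].
Proof.
move=> iI cI /prinP[q q0 e]; rewrite e in iI cI.
have qR : q \in R by apply/pid_integral.
have [k k0 ck] := cop_pow (pval_cop qR q0 cI).
exists q, k; split=> //; split; last by rewrite expf_neq0.
by apply: (cgr_O ck); exact: rpred1.
Qed.

Lemma cyclic_orderly Q j : prime_ideal Q -> ~ above O Q -> Q *+ j \in Prin -> Q *+ j \in Ord.
Proof.
move=> pQ nQ; have cQ := coprimeI_prime pQ nQ.
have iQ n : integral_ideal (Q *+ n).
  by apply/integralP => P _; rewrite ordMn ord_prime //; case: eqP => _ /=; lia.
have exO n : (0 < n)%N -> Q *+ n \in Prin -> exists k, (0 < k)%N && (Q *+ (n * k) \in Ord).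
  move=> n0 /(principal_pow_orderly (iQ n) (coprimeIMn n cQ))[q [k [qR e k0 qkO]]].
  exists k; rewrite k0 mulrnA e -pidX; last by case: qR.
  apply: orderly_of => //; rewrite pidX; last by case: qR.
  by rewrite -e; do 2 apply: coprimeIMn.
have exP : exists n, (0 < n)%N && (Q *+ n \in Prin).
  by have [n n0 Pn] := torsion_principal torR Q; exists n; rewrite n0.
case: (ex_minnP exP) => m /andP[m0 mP] minm.
have exM : exists n, (0 < n)%N && (Q *+ n \in Ord).
  by have [k /andP[k0 kO]] := exO m m0 mP; exists (m * k)%N; rewrite muln_gt0 m0 k0.
case: (ex_minnP exM) => m' /andP[m'0 m'O] minm'.
have dvdm n : Q *+ n \in Prin -> (m %| n)%N.
  move=> nP; rewrite /dvdn; apply: contraT; rewrite -lt0n => lt0.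
  have := minm (n %% m)%N; rewrite lt0 /= leqNgt ltn_mod m0; apply.
  have -> : Q *+ (n %% m) = Q *+ n - Q *+ m *+ (n %/ m).
    by rewrite {2}(divn_eq n m) mulrnDr mulnC mulrnA addrC addKr.
  by rewrite rpredB // rpredMn.
have /dvdnP[k m'E] := dvdm _ (orderly_prin m'O).
have [q q0 qE] := prinP mP.
have qR : nz R q by split=> //; apply/pid_integral => //; rewrite -qE.
have [u [uO u0 cu uE]] := orderly_gen m'O (iQ _).
have q1 : pid R q != 0.
  rewrite -qE; apply/eqP => /(congr1 (ord Q)); rewrite ord0 ordMn ord_prime // eqxx.
  by move: m0; clear; case: m => // m _; rewrite natz.
have [||vs [szv vP pu]] := @lift_power u q k _ qR q1.
- by [].
- by rewrite -uE -qE m'E mulnC mulrnA.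
have big : (m'%:Z) *+ size vs <= \sum_(v <- vs) deg (pid R v).
  apply: sumz_ge => v /vP[vO v1 dv]; have iv := pid_nz_integral vO.
  have [|n vE] := @divisor_primeX (pid R v) Q m' pQ iv.
    by rewrite uE; exact: divides_integral.
  have n0 : (0 < n)%N by case: n vE v1 => // ->; rewrite eqxx.
  rewrite vE degMn deg_prime // natz lez_nat; apply: minm'; rewrite n0 /= -vE.
  by apply: orderly_of => //; rewrite vE; exact: coprimeIMn.
move: big; rewrite -deg_sum -pu -uE degMn deg_prime // szv.
have -> : m'%:Z *+ k = (m' * k)%:Z by rewrite -mulr_natr natz.
rewrite natz lez_nat => le.
have k1 : k = 1%N.
  have k0 : (0 < k)%N by case: (k) m'E m'0 => // ->.
  by move: le m'0 k0; clear; case: k => [|[|k]] //; rewrite !mulnS; lia.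
rewrite m'E k1 mul1n in m'O.
by move=> /dvdm/dvdnP[l ->]; rewrite mulnC mulrnA rpredMn.
Qed.

Definition nonprin_prime X := prime_ideal X /\ X \notin Prin.

Lemma deg_ge2 I : integral_ideal I -> I \in Prin -> I != 0 ->
  (forall P, prime_ideal P -> 1 <= ord P I -> P \notin Prin) -> 2 <= deg I.
Proof.
move=> iI pI I0 H; have [s [ps Is]] := integral_factor iI.
rewrite Is deg_primes //; case: s ps Is => [|P [|Q s]] // ps Is.
  by rewrite Is big_nil eqxx in I0.
have pP : prime_ideal P by apply: ps; rewrite inE eqxx.
move: (H P pP); rewrite Is big_seq1 ord_prime // eqxx => /(_ isT)/negP[].
by rewrite Is big_seq1 in pI.
Qed.

Lemma pair_split X Y k u : prime_ideal X -> prime_ideal Y -> X + Y \in Prin ->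
    X *+ 2 \notin Prin -> (0 < k)%N -> nz O u -> pid R u = (X + Y) *+ k ->
  exists v, [/\ nz O v, divides_in u v & pid R v = X + Y].
Proof.
move=> pX pY XY X2 k0 uO uE; apply: contrapT => no.
have [q q0 qE] := prinP XY.
have iXY : integral_ideal (X + Y) by apply: integralD; exact: prime_integral.
have qR : nz R q by split=> //; apply/pid_integral => //; rewrite -qE.
have q1 : pid R q != 0.
  by rewrite -qE; apply/eqP => /(congr1 (@deg _ _)); rewrite deg0 degD !deg_prime //.
have [|vs [szv vP pu]] := @lift_power u q k uO qR q1; first by rewrite -qE.
have nX : X \notin Prin by apply: contra X2 => pX'; rewrite rpredMn.
have nY : Y \notin Prin.
  by apply: contra nX => pY'; rewrite -[X](addrK Y) rpredB.
have nYX : X != Y by apply: contraNneq X2 => e; rewrite mulr2n {2}e.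
have big : 3 *+ size vs <= \sum_(v <- vs) deg (pid R v).
  apply: sumz_ge => v /vP[vO v1 dv]; have iv := pid_nz_integral vO.
  have vPrin : pid R v \in Prin by apply: pid_prin; case: vO.
  have iuv := divides_integral uO vO dv.
  have [s [ps vs']] := integral_factor iv.
  have sXY P : P \in s -> (P == X) || (P == Y).
    move=> Ps; have pP := ps P Ps; have := ord_ge0 P iuv.
    rewrite ordB uE vs' ord_primes // ordMn ordD !ord_prime //.
    have : (0 < count_mem P s)%N by rewrite -has_count has_pred1.
    rewrite !(eq_sym P); case: (X == P) => //; case: (Y == P) => //=.
    by rewrite mul0rn; clear; lia.
  rewrite vs' deg_primes // in v1 vPrin *.
  case: s ps vs' sXY v1 vPrin => [|A [|B [|C s]]] ps vs' sXY v1 vPrin //.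
  - by rewrite big_nil eqxx in v1.
  - move: vPrin; rewrite big_seq1 => AP.
    by case/orP: (sXY A (mem_head _ _)) => /eqP e; rewrite e in AP; [rewrite AP in nX|rewrite AP in nY].
  - move: vPrin; rewrite big_cons big_seq1 => AB.
    have Bs : B \in [:: A; B] by rewrite !inE eqxx orbT.
    case/orP: (sXY A (mem_head _ _)) => /eqP eA; case/orP: (sXY B Bs) => /eqP eB.
    + by rewrite eA eB -mulr2n (negPf X2) in AB.
    + by case: no; exists v; rewrite vs' big_cons big_seq1 eA eB.
    + by case: no; exists v; rewrite vs' big_cons big_seq1 eA eB addrC.
    + case/negP: X2; have -> : X *+ 2 = (X + Y) *+ 2 - (A + B).
        by rewrite eA eB -mulr2n mulrnDl addrK.
      by rewrite rpredB // rpredMn.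
move: big; rewrite -deg_sum -pu uE degMn degD !deg_prime // szv.
have -> : (1 + 1 : int) *+ k = (2 * k)%:Z by rewrite -mulr_natr natz.
rewrite (intMn 3 k).
by rewrite lez_nat; move: k0; clear; lia.
Qed.

Lemma pair_orderly X Y : prime_ideal X -> prime_ideal Y -> ~ above O X -> ~ above O Y ->
  X + Y \in Prin -> X *+ 2 \notin Prin -> X + Y \in Ord.
Proof.
move=> pX pY nX nY XY X2.
have iXY : integral_ideal (X + Y) by apply: integralD; exact: prime_integral.
have cXY : coprimeI O (X + Y) by apply: coprimeID; exact: coprimeI_prime.
have [q [k [qR e k0 qkO]]] := principal_pow_orderly iXY cXY XY.
have [|v [vO _ vE]] := pair_split pX pY XY X2 k0 qkO.
  by rewrite pidX -?e //; case: qR.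
by rewrite -vE; apply: orderly_of => //; rewrite vE.
Qed.

Lemma pair_split2 X Y k u : nonprin_prime X -> nonprin_prime Y -> X + Y \in Prin ->
    nz O u -> pid R u = (X + Y) *+ k ->
  exists vs : seq K, [/\ size vs = k,
    forall v, v \in vs -> [/\ nz O v, deg (pid R v) = 2 & divides_in u v]
    & pid R u = \sum_(v <- vs) pid R v].
Proof.
move=> [pX nX] [pY nY] XY uO uE.
have [q q0 qE] := prinP XY.
have iXY : integral_ideal (X + Y) by apply: integralD; exact: prime_integral.
have qR : nz R q by split=> //; apply/pid_integral => //; rewrite -qE.
have q1 : pid R q != 0.
  by rewrite -qE; apply/eqP => /(congr1 (@deg _ _)); rewrite deg0 degD !deg_prime //.
have [|vs [szv vP pu]] := @lift_power u q k uO qR q1; first by rewrite -qE.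
exists vs; split=> //.
have ge2 v : v \in vs -> 2 <= deg (pid R v).
  move=> /vP[vO v1 dv]; have iv := pid_nz_integral vO.
  have vPrin : pid R v \in Prin by apply: pid_prin; case: vO.
  have iuv := divides_integral uO vO dv.
  apply: deg_ge2 => // P pP; have /andP[_ le] := divisor_ord P iv iuv.
  move=> /le_trans/(_ le); rewrite uE ordMn ordD !ord_prime //.
  by have [<- //|_] := eqVneq X P; have [<- //|_] := eqVneq Y P; rewrite mul0rn.
move=> v vvs; have [vO v1 dv] := vP _ vvs; split=> //.
apply/eqP; rewrite eq_le ge2 // andbT.
have := congr1 (@deg _ _) pu; rewrite uE degMn degD (deg_prime pX) (deg_prime pY) deg_sum (big_rem v) //=.
have : 2 *+ size (rem v vs) <= \sum_(w <- rem v vs) deg (pid R w).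
  by apply: sumz_ge => w /mem_rem; exact: ge2.
rewrite size_rem // szv; move: (\sum_(_ <- _) _) (deg _) => A D.
have k0 : (0 < k)%N by rewrite -szv; case: (vs) vvs.
have -> : (1 + 1 : int) *+ k = (2 * k)%:Z by rewrite -mulr_natr natz.
rewrite (intMn 2).
by move: k0; clear; lia.
Qed.

(* Lifting q^j = r1^j r2^j to O gives 2j nonunits, each with at least two prime
   factors as the X_i are nonprincipal; but q^j has only 3j prime factors. *)
Lemma no_two_factors X1 X2 X3 q r1 r2 : nonprin_prime X1 -> nonprin_prime X2 -> nonprin_prime X3 ->
    nz R q -> pid R q = X1 + X2 + X3 -> nz R r1 -> nz R r2 -> pid R r1 != 0 -> pid R r2 != 0 ->
    eqv q (r1 * r2) -> False.
Proof.
move=> [p1 n1] [p2 n2] [p3 n3] qR qE r1R r2R r11 r21 e.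
have [qR' q0] := qR.
have [j j0 qjO] := root_O inj qR'.
have qjN : nz O (q ^+ j) by split=> //; rewrite expf_neq0.
have [||ps [psE psP pidu dvu]] := @lift_seq _ _ _ _ lft (nseq j r1 ++ nseq j r2) _ qjN.
- by move=> r; rewrite mem_cat => /orP[]/nseqP[->].
- by rewrite big_cat /= !prod_nseq -exprMn; apply: (liftX lft).
have big : 2 *+ size ps <= \sum_(p <- ps) deg (pid R p.1).
  apply: sumz_ge => p pps; have [pO ep] := psP _ pps; have dv := dvu _ pps.
  have ip := pid_nz_integral pO.
  have pPrin : pid R p.1 \in Prin by apply: pid_prin; case: pO.
  have iuv := divides_integral qjN pO dv.
  apply: deg_ge2 => //.
    have : p.2 \in unzip2 ps by apply: map_f.
    by rewrite psE mem_cat => /orP[]/nseqP[pe _]; rewrite pe in ep;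
      apply: (lift_nonunit lft torR pO _ ep).
  move=> P pP; have /andP[_ le] := divisor_ord P ip iuv.
  move=> /le_trans/(_ le); rewrite pidX // qE ordMn !ordD !ord_prime //.
  by have [<- //|_] := eqVneq X1 P; have [<- //|_] := eqVneq X2 P;
    have [<- //|_] := eqVneq X3 P; rewrite mul0rn.
move: big; rewrite -deg_sum -pidu pidX // qE degMn !degD !deg_prime //.
rewrite -(size_map snd) -/(unzip2 ps) psE size_cat !size_nseq.
have -> : (1 + 1 + 1: int) *+ j = (3 * j)%:Z by rewrite -mulr_natr natz.
rewrite (intMn 2).
by rewrite lez_nat; move: j0; clear; lia.
Qed.

Definition tri q := exists X1 X2 X3, [/\ nonprin_prime X1, nonprin_prime X2, nonprin_prime X3,
  nz R q & pid R q = X1 + X2 + X3].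

Lemma tri_no_split q v A B : tri q -> nz O v -> eqv v q -> pid R v = A + B ->
  integral_ideal A -> integral_ideal B -> A \in Prin -> A != 0 -> B != 0 -> False.
Proof.
move=> [X1 [X2 [X3 [n1 n2 n3 qR qE]]]] vO vq vE iA iB pA A0 B0.
have pB : B \in Prin.
  by rewrite -[B](addKr A) -vE rpredD ?rpredN // pid_prin //; case: vO.
have [a a0 aE] := prinP pA; have [b b0 bE] := prinP pB.
have aR : nz R a by split=> //; apply/pid_integral => //; rewrite -aE.
have bR : nz R b by split=> //; apply/pid_integral => //; rewrite -bE.
apply: (no_two_factors n1 n2 n3 qR qE aR bR); rewrite -?aE -?bE //.
apply: (lift_trans lft (lift_sym lft vq)); apply: eqv_pid; [exact: nz_R vO|exact: nzM|].
by rewrite vE pidM // -aE -bE.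
Qed.

Lemma halves v w q q' A B I1 I2 I3 : tri q -> tri q' -> nz O v -> nz O w ->
    eqv v q -> eqv w q' -> pid R v = A + I3 -> pid R w = B -> A + B = I1 + I2 ->
    integral_ideal A -> integral_ideal B ->
    integral_ideal I1 -> integral_ideal I2 -> integral_ideal I3 ->
    I1 \in Prin -> I2 \in Prin -> I3 \in Prin -> I1 != 0 -> I2 != 0 -> I3 != 0 ->
  False.
Proof.
move=> tq tq' vO wO vq wq vE wE AB iA iB i1 i2 i3 p1 p2 p3 n1 n2 n3.
have [A0|A0] := eqVneq A 0.
  rewrite A0 add0r in AB; rewrite AB in wE.
  by apply: (tri_no_split tq' wO wq wE).
by apply: (@tri_no_split q v I3 A) => //; rewrite addrC.
Qed.

Definition pick2 (c : bool) X Y := if c then X else Y.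

Lemma six_split X1 X2 X3 Y1 Y2 Y3 a :
    nonprin_prime X1 -> nonprin_prime X2 -> nonprin_prime X3 ->
    nonprin_prime Y1 -> nonprin_prime Y2 -> nonprin_prime Y3 ->
    X1 + X2 + X3 \in Prin -> X1 + Y1 \in Prin -> X2 + Y2 \in Prin -> X3 + Y3 \in Prin ->
    nz O a -> pid R a = (X1 + Y1) + (X2 + Y2) + (X3 + Y3) ->
  exists v c1 c2 c3, [/\ nz O v, divides_in a v
    & pid R v = pick2 c1 X1 Y1 + pick2 c2 X2 Y2 + pick2 c3 X3 Y3].
Proof.
move=> nX1 nX2 nX3 nY1 nY2 nY3 pX p1 p2 p3 aO aE.
have [[qX1 _] [qX2 _] [qX3 _]] := And3 nX1 nX2 nX3.
have [[qY1 _] [qY2 _] [qY3 _]] := And3 nY1 nY2 nY3.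
have pY : Y1 + Y2 + Y3 \in Prin.
  have -> : Y1 + Y2 + Y3 = (X1 + Y1) + (X2 + Y2) + (X3 + Y3) - (X1 + X2 + X3).
    by apply: ord_inj => P _; rewrite !(ordB, ordD); clear; lia.
  by apply: rpredB => //; apply: rpredD => //; apply: rpredD.
have iX : integral_ideal (X1 + X2 + X3) by do 2?apply: integralD; exact: prime_integral.
have iY : integral_ideal (Y1 + Y2 + Y3) by do 2?apply: integralD; exact: prime_integral.
have [q q0 qE] := prinP pX; have [q' q'0 q'E] := prinP pY.
have qR : nz R q by split=> //; apply/pid_integral => //; rewrite -qE.
have q'R : nz R q' by split=> //; apply/pid_integral => //; rewrite -q'E.
have tq : tri q by exists X1, X2, X3.
have tq' : tri q' by exists Y1, Y2, Y3.
have eqq : eqv a (q * q').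
  apply: eqv_pid; [exact: nz_R aO|exact: nzM|rewrite pidM // -qE -q'E aE].
  by apply: ord_inj => P _; rewrite !ordD; clear; lia.
have [v [w [vO wO avw vq wq]]] := lift_split lft aO qR q'R eqq.
have [[_ v0] [_ w0]] := conj vO wO.
have pvw : pid R a = pid R v + pid R w by rewrite avw pidM.
have iv := pid_nz_integral vO; have iw := pid_nz_integral wO.
pose s := [:: X1; Y1; X2; Y2; X3; Y3].
have sums : \sum_(P <- s) P = pid R a.
  by rewrite /s !big_cons big_nil aE; apply: ord_inj => P _; rewrite !(ordD, ord0); clear; lia.
have ps : primes_seq s.
  by move=> P; rewrite !inE => /or4P[/eqP->|/eqP->|/eqP->|/or3P[]/eqP->].
have [sv [psv vE]] := integral_factor iv; have [sw [psw wE]] := integral_factor iw.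
have pr : perm_eq s (sv ++ sw).
  apply: factorization_uniq => //; first exact: primes_cat.
  by rewrite big_cat sums pvw /= -vE -wE.
have [m szm pm] : exists2 m : bitseq, size m = size s & perm_eq sv (mask m s).
  by apply/count_maskP => P; rewrite (permP pr) count_cat leq_addr.
have {}vE : pid R v = \sum_(P <- mask m s) P by rewrite vE (perm_big _ pm).
have {}wE : pid R w = \sum_(P <- s) P - \sum_(P <- mask m s) P.
  by rewrite sums pvw vE addrC addKr.
have ip X Y : nonprin_prime X -> nonprin_prime Y -> integral_ideal (X + Y).
  by move=> [pX' _] [pY' _]; apply: integralD; exact: prime_integral.
have nz0 X Y : nonprin_prime X -> nonprin_prime Y -> X + Y != 0.
  move=> [pX' _] [pY' _]; apply/eqP => /(congr1 (@deg _ _)).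
  by rewrite deg0 degD !deg_prime //.
have iP X : nonprin_prime X -> integral_ideal X by move=> [/prime_integral].
case: m szm pm vE wE => [|b1 [|c1 [|b2 [|c2 [|b3 [|c3 [|]]]]]]] // _ _ vE wE.
have iM X (b : bool) : nonprin_prime X -> integral_ideal (X *+ b).
  by move=> /iP iX'; case: b => //; exact: integral0.
have {}vE : pid R v = X1 *+ b1 + Y1 *+ c1 + (X2 *+ b2 + Y2 *+ c2) + (X3 *+ b3 + Y3 *+ c3).
  rewrite vE; apply: ord_inj => P _; move: b1 c1 b2 c2 b3 c3 {vE wE} => [] [] [] [] [] [] /=;
  by rewrite ?big_cons big_nil !(mulr1n, mulr0n, ordD, ord0); clear; lia.
have {}wE : pid R w = X1 *+ ~~ b1 + Y1 *+ ~~ c1 + (X2 *+ ~~ b2 + Y2 *+ ~~ c2) + (X3 *+ ~~ b3 + Y3 *+ ~~ c3).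
  move: wE => _; have -> : pid R w = pid R a - pid R v by rewrite pvw addrC addKr.
  rewrite aE vE; apply: ord_inj => P _.
  by move: b1 c1 b2 c2 b3 c3 {vE} => [] [] [] [] [] [];
    rewrite !(mulr1n, mulr0n, ordB, ordD, ord0); clear; lia.
have H v' w' t t' (Z1 W1 Z2 W2 Z3 W3 : invideal R) (d1 e1 d2 e2 : bool) : tri t -> tri t' ->
    nz O v' -> nz O w' -> eqv v' t -> eqv w' t' ->
    nonprin_prime Z1 -> nonprin_prime W1 -> nonprin_prime Z2 -> nonprin_prime W2 ->
    nonprin_prime Z3 -> nonprin_prime W3 ->
    Z1 + W1 \in Prin -> Z2 + W2 \in Prin -> Z3 + W3 \in Prin ->
    pid R v' = Z1 *+ d1 + W1 *+ e1 + (Z2 *+ d2 + W2 *+ e2) + (Z3 + W3) ->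
    pid R w' = Z1 *+ ~~ d1 + W1 *+ ~~ e1 + (Z2 *+ ~~ d2 + W2 *+ ~~ e2) -> False.
  move=> tt tt' vO' wO' vt wt' nZ1 nW1 nZ2 nW2 nZ3 nW3 Z1P Z2P Z3P vE' wE'.
  apply: (halves tt tt' vO' wO' vt wt' vE' wE' (I1 := Z1 + W1) (I2 := Z2 + W2)) => //;
    try (by apply: ip); try (by apply: nz0); try (by do 3?apply: integralD; apply: iM).
  apply: ord_inj => P _; move: d1 e1 d2 e2 {vE' wE'} => [] [] [] [];
  by rewrite !(mulr1n, mulr0n, ordD, ord0); clear; lia.
have [b3c3|b3c3] := eqVneq b3 c3.
  exfalso; subst c3; case: b3 vE wE; rewrite /= ?mulr1n ?mulr0n ?addr0 => vE wE.
    exact: (H v w q q' X1 Y1 X2 Y2 X3 Y3 b1 c1 b2 c2).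
  apply: (H w v q' q X1 Y1 X2 Y2 X3 Y3 (~~ b1) (~~ c1) (~~ b2) (~~ c2)) => //.
  by rewrite !negbK.
have [b2c2|b2c2] := eqVneq b2 c2.
  exfalso; subst c2; case: b2 vE wE; rewrite /= ?mulr1n ?mulr0n ?addr0 => vE wE.
    apply: (H v w q q' X1 Y1 X3 Y3 X2 Y2 b1 c1 b3 c3) => //; first by rewrite addrAC.
  apply: (H w v q' q X1 Y1 X3 Y3 X2 Y2 (~~ b1) (~~ c1) (~~ b3) (~~ c3)) => //.
    by rewrite addrAC.
  by rewrite !negbK.
have [b1c1|b1c1] := eqVneq b1 c1.
  exfalso; subst c1; case: b1 vE wE; rewrite /= ?mulr1n ?mulr0n ?addr0 ?add0r => vE wE.
    apply: (H v w q q' X3 Y3 X2 Y2 X1 Y1 b3 c3 b2 c2) => //.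
      by rewrite vE; apply: ord_inj => P _; rewrite !ordD; clear; lia.
    by rewrite wE addrC.
  apply: (H w v q' q X3 Y3 X2 Y2 X1 Y1 (~~ b3) (~~ c3) (~~ b2) (~~ c2)) => //.
    by rewrite wE; apply: ord_inj => P _; rewrite !ordD; clear; lia.
  by rewrite !negbK vE addrC.
exists v, b1, b2, b3; split=> //; first by exists w => //; case: wO.
rewrite vE; case: b1 c1 b1c1 {vE wE} => [] [] // _; case: b2 c2 b2c2 => [] [] // _;
  case: b3 c3 b3c3 => [] [] // _; by rewrite /= ?mulr1n ?mulr0n ?addr0 ?add0r.
Qed.

Definition primes_everywhere := forall c : Cl R, exists Q, [/\ prime_ideal Q, ~ above O Q & ideal_class Q = c].

Lemma opposite_prime : primes_everywhere -> forall Q, prime_ideal Q -> ~ above O Q ->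
  exists Q', [/\ prime_ideal Q', ~ above O Q', Q + Q' \in Ord & Q *+ 2 \in Prin -> Q' = Q].
Proof.
move=> pe Q pQ nQ; have [Q2|Q2] := boolP (Q *+ 2 \in Prin).
  by exists Q; split=> //; rewrite -mulr2n; exact: cyclic_orderly.
have [Q' [pQ' nQ' e]] := pe (- ideal_class Q).
exists Q'; split=> //; apply: pair_orderly => //.
by apply/class_eq0; rewrite classD e subrr.
Qed.

Lemma opposite_nonprin Q Q' : Q \notin Prin -> Q + Q' \in Prin -> Q' \notin Prin.
Proof. by move=> nQ QQ'; apply: contra nQ => pQ'; rewrite -[Q](addrK Q') rpredB. Qed.

Lemma triple_orderly Q1 Q2 Q3 : primes_everywhere ->
    nonprin_prime Q1 -> nonprin_prime Q2 -> nonprin_prime Q3 ->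
    ~ above O Q1 -> ~ above O Q2 -> ~ above O Q3 ->
  Q1 + Q2 + Q3 \in Prin -> Q1 + Q2 + Q3 \in Ord.
Proof.
move=> pe n1 n2 n3 a1 a2 a3 T; have [[p1 q1] [p2 q2] [p3 q3]] := And3 n1 n2 n3.
have [Y1 [pY1 aY1 M1 d1]] := opposite_prime pe p1 a1.
have [Y2 [pY2 aY2 M2 d2]] := opposite_prime pe p2 a2.
have [Y3 [pY3 aY3 M3 d3]] := opposite_prime pe p3 a3.
have [P1 P2 P3] := And3 (orderly_prin M1) (orderly_prin M2) (orderly_prin M3).
have nY1 : nonprin_prime Y1 by split=> //; exact: opposite_nonprin P1.
have nY2 : nonprin_prime Y2 by split=> //; exact: opposite_nonprin P2.
have nY3 : nonprin_prime Y3 by split=> //; exact: opposite_nonprin P3.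
have MM : (Q1 + Y1) + (Q2 + Y2) + (Q3 + Y3) \in Ord by apply: rpredD => //; apply: rpredD.
have iP X : prime_ideal X -> integral_ideal X by exact: prime_integral.
have [|a [aO a0 ca aE]] := orderly_gen MM.
  by do 5?apply: integralD; apply: iP.
have [v [c1 [c2 [c3 [vO dv vE]]]]] :=
  six_split n1 n2 n3 nY1 nY2 nY3 T P1 P2 P3 (conj aO a0) (esym aE).
have vM : pid R v \in Ord.
  apply: orderly_of => //; rewrite vE.
  by do 2?apply: coprimeID; rewrite /pick2; case: ifP => _; exact: coprimeI_prime.
(* Two opposite choices of signs differ by an orderly ideal, so at most one
   prime needs to be flipped; it then has order two. *)
have one A B C C' : A + B + C \in Prin -> A + B + C' \in Ord -> C + C' \in Ord ->
    (C *+ 2 \in Prin -> C' = C) -> A + B + C \in Ord.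
  move=> ABC ABC' CC' C2; rewrite -C2 //.
  have -> : C *+ 2 = (A + B + C) - (A + B + C') + (C + C').
    by apply: ord_inj => P _; rewrite !(ordB, ordD, ordMn) mulr2n; clear; lia.
  by apply: rpredD; [apply: rpredB => //|]; exact: (@orderly_prin _ _ O).
have flip A : pid R v + A = (Q1 + Y1) + (Q2 + Y2) + (Q3 + Y3) -> A \in Ord.
  by move=> e; rewrite -[A](addKr (pid R v)) e rpredD // rpredN.
move: c1 c2 c3 vE => [] [] [] /= vE.
- by rewrite -vE.
- by apply: (one _ _ _ Y3) => //; rewrite -vE.
- rewrite addrAC; apply: (one _ _ _ Y2) => //; first by rewrite addrAC.
  by rewrite addrAC -vE.
- have -> : Q1 + Q2 + Q3 = Q2 + Q3 + Q1 by apply: ord_inj => P _; rewrite !ordD; clear; lia.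
  apply: (one _ _ _ Y1) => //; first by rewrite addrC addrA.
  by apply: flip; rewrite vE; apply: ord_inj => P _; rewrite !ordD; clear; lia.
- have -> : Q1 + Q2 + Q3 = Q2 + Q3 + Q1 by apply: ord_inj => P _; rewrite !ordD; clear; lia.
  apply: (one _ _ _ Y1) => //; first by rewrite addrC addrA.
  suff -> : Q2 + Q3 + Y1 = pid R v by [].
  by rewrite vE; apply: ord_inj => P _; rewrite !ordD; clear; lia.
- rewrite addrAC; apply: (one _ _ _ Y2) => //; first by rewrite addrAC.
  by apply: flip; rewrite vE; apply: ord_inj => P _; rewrite !ordD; clear; lia.
- apply: (one _ _ _ Y3) => //.
  by apply: flip; rewrite vE; apply: ord_inj => P _; rewrite !ordD; clear; lia.
- by apply: flip; rewrite vE; apply: ord_inj => P _; rewrite !ordD; clear; lia.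
Qed.

Lemma third_class : ~ has_two_elements (Cl R) -> forall c : Cl R, c != 0 ->
  exists d : Cl R, d != 0 /\ d != c.
Proof.
move=> n2 c c0; apply: contrapT => H; apply: n2.
have all d : d = 0 \/ d = c.
  have [->|d0] := eqVneq d 0; first by left.
  by have [->|dc] := eqVneq d c; [right|case: H; exists d].
apply/eq_cardSP; exists 0 => //.
have -> : [set: Cl R] `\ 0 = [set c]; last exact: card_set1.
apply/seteqP; split=> d /=; first by case=> _; case: (all d) => ->.
by move=> ->; split=> // /eqP; rewrite (negPf c0).
Qed.

Lemma two_classes : has_two_elements (Cl R) -> forall a b : Cl R, a != 0 -> b != 0 -> a = b.
Proof.
move=> /eq_cardSP[x _ /eq_cardSP[y _]]; rewrite II0 card_eq0 => /eqP e a b a0 b0.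
have all d : d = x \/ d = y.
  have [->|/eqP dx] := eqVneq d x; first by left.
  have [->|/eqP dy] := eqVneq d y; first by right.
  by have : set0 d by rewrite -e; split.
move: a0 b0 => /eqP a0 /eqP b0.
by case: (all 0) a0 b0 => ->; case: (all a) => ->; case: (all b) => ->.
Qed.

Lemma prime_class_orderly (s : seq (invideal R)) : primes_everywhere -> ~ has_two_elements (Cl R) ->
  (forall Q, Q \in s -> prime_ideal Q /\ ~ above O Q) ->
  \sum_(Q <- s) Q \in Prin -> \sum_(Q <- s) Q \in Ord.
Proof.
move=> pe n2; have [n] := ubnP (size s); elim: n s => // n IH s szs hs pS.
have [[Q [Qs QP]]|noP] := pselect (exists Q, Q \in s /\ Q \in Prin).
  have [pQ nQ] := hs _ Qs; rewrite (big_rem Q) //= in pS *.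
  have QO : Q \in Ord by rewrite -[Q]mulr1n; apply: cyclic_orderly.
  rewrite rpredD //; apply: IH.
  - by rewrite size_rem //; move: szs; case: (s) Qs => //.
  - by move=> P /mem_rem/hs.
  - by rewrite -[X in X \in _](addKr Q) rpredD ?rpredN.
have np Q : Q \in s -> nonprin_prime Q.
  by move=> Qs; split; [have [] := hs Q Qs|apply/negP => QP; apply: noP; exists Q].
have na Q : Q \in s -> ~ above O Q by move=> /hs[].
case: s szs hs pS noP np na => [|A [|B [|C [|D s]]]] szs hs pS noP np na.
- by rewrite big_nil rpred0.
- by case: noP; exists A; rewrite big_seq1 in pS; rewrite inE eqxx.
- have [nA nB] : nonprin_prime A /\ nonprin_prime B by split; apply: np; rewrite !inE eqxx ?orbT.
  have [aA aB] : ~ above O A /\ ~ above O B by split; apply: na; rewrite !inE eqxx ?orbT.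
  rewrite big_cons big_seq1 in pS *.
  have [A2|A2] := boolP (A *+ 2 \in Prin); last by case: nA nB => pA _ [pB _]; apply: pair_orderly.
  have cA0 : ideal_class A != 0.
    by apply/eqP => /class_eq0 pA; case: nA => _; rewrite pA.
  have [d [d0 dA]] := third_class n2 cA0.
  have [Q [pQ aQ Qd]] := pe d; have [Q' [pQ' aQ' Q'd]] := pe (- (ideal_class A + d)).
  have AA : ideal_class A + ideal_class A = 0.
    by rewrite -classD -mulr2n; apply/class_eq0.
  have nQ : nonprin_prime Q by split=> //; apply/negP => /class_eq0; rewrite Qd; exact/eqP.
  have nQ' : nonprin_prime Q'.
    split=> //; apply/negP => /class_eq0; rewrite Q'd => /eqP; rewrite oppr_eq0 addr_eq0.
    move=> /eqP e; case/eqP: dA; apply/eqP; rewrite -subr_eq0 -{1}[d]opprK -e.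
    by rewrite -opprD AA oppr0.
  have AB : ideal_class A = ideal_class B.
    have : ideal_class A + ideal_class B = 0 by rewrite -classD; apply/class_eq0.
    by rewrite -AA => /addrI ->.
  have AQQ : A + Q + Q' \in Prin by apply/class_eq0; rewrite !classD Qd Q'd subrr.
  have BQQ : B + Q + Q' \in Prin by apply/class_eq0; rewrite !classD Qd Q'd AB subrr.
  have oA := triple_orderly pe nA nQ nQ' aA aQ aQ' AQQ.
  have oB := triple_orderly pe nB nQ nQ' aB aQ aQ' BQQ.
  have o2 : A *+ 2 \in Ord by apply: cyclic_orderly => //; case: nA.
  have -> : A + B = A *+ 2 + ((B + Q + Q') - (A + Q + Q')).
    by apply: ord_inj => P _; rewrite !(ordB, ordD, ordMn) mulr2n; clear; lia.
  by rewrite rpredD // rpredB.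
- rewrite !big_cons big_nil addr0 addrA in pS *.
  by apply: triple_orderly => //; (apply: np || apply: na); rewrite !inE eqxx ?orbT.
- have [pA aA] := hs A (mem_head _ _).
  have [pB aB] : prime_ideal B /\ ~ above O B by apply: hs; rewrite !inE eqxx orbT.
  have [X [pX aX Xd]] := pe (- (ideal_class A + ideal_class B)).
  have [X' [pX' aX' XX' _]] := opposite_prime pe pX aX.
  set t := [:: C, D & s] in szs hs pS *.
  have o1 : \sum_(Q <- [:: A; B; X]) Q \in Ord.
    apply: IH; first by move: szs; rewrite /t /= ltnS; exact: leq_trans.
      by move=> Q; rewrite !inE => /or3P[]/eqP->.
    by rewrite !big_cons big_nil addr0; apply/class_eq0; rewrite !classD Xd addrA subrr.
  have o2 : \sum_(Q <- X' :: t) Q \in Ord.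
    apply: IH; first by move: szs; rewrite /t /= ltnS.
      by move=> Q; rewrite inE => /predU1P[->//|Qt]; apply: hs; rewrite !inE in Qt *; rewrite Qt !orbT.
    have -> : \sum_(Q <- X' :: t) Q = (X + X') + \sum_(Q <- [:: A, B & t]) Q - \sum_(Q <- [:: A; B; X]) Q.
      by rewrite !big_cons big_nil; apply: ord_inj => P _; rewrite !(ordB, ordD, ord0); clear; lia.
    by apply: rpredB; [apply: rpredD => //; exact: orderly_prin XX'|exact: orderly_prin o1].
  have -> : \sum_(Q <- [:: A, B & t]) Q =
      \sum_(Q <- [:: A; B; X]) Q + \sum_(Q <- X' :: t) Q - (X + X').
    by rewrite !big_cons big_nil; apply: ord_inj => P _; rewrite !(ordB, ordD, ord0); clear; lia.
  by apply: rpredB => //; apply: rpredD.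
Qed.

Lemma units_full_of_integral :
  (forall I, integral_ideal I -> coprimeI O I -> I \in Prin -> I \in Ord) -> units_full O.
Proof.
move=> H I cI /prinP[x x0 Ix]; rewrite Ix in cI *.
have [t [tR t0 ct [txR ctx]]] := coprime_denominator x0 cI.
have tx0 : t * x != 0 by rewrite mulf_neq0.
have gen y : y \in R -> y != 0 -> cop O y -> pid R y \in Ord.
  move=> yR y0 cy; apply: H; [exact/pid_integral| |exact: pid_prin].
  by move=> P aP; exact: (cop_pval aP yR y0 cy).
have -> : pid R x = pid R (t * x) - pid R t by rewrite pidM // addrC addKr.
by apply: rpredB; apply: gen.
Qed.

Lemma primes_everywhere_units : primes_everywhere -> ~ has_two_elements (Cl R) -> units_full O.
Proof.
move=> pe n2; apply: units_full_of_integral => I iI cI pI.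
have [s [ps Is]] := integral_factor iI; rewrite Is in pI *.
apply: prime_class_orderly => // Q Qs; have pQ := ps Q Qs; split=> // aQ.
have := cI Q aQ; rewrite Is ord_primes // => -[] /eqP.
by rewrite -leqn0 leqNgt -has_count has_pred1 Qs.
Qed.

End Arithmetic.

(** * Invertible ideals of the order *)

Section PrimesOfOrder.
Variables (K : fieldType) (R : dedDomain K) (O : orderIn R).
Implicit Types (x y a b q r s t u v w : K) (I J P Q X Y : invideal R).
Hypothesis inj : inj_contraction O.
Hypothesis torR : torsion (Cl R).

Local Notation Prin := (@principal K R).
Local Notation Ord := (orderly O).

Lemma approximation I : exists x, [/\ x != 0, ival I x & forall P, above O P -> pval P x = ord P I].
Proof.
have done1 P x : prime_ideal P -> ival I x -> ~ ival (I + P) x -> x != 0 /\ pval P x = ord P I.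
  move=> pP Ix nx; have x0 : x != 0.
    by apply/eqP => x0; apply: nx; rewrite x0; exact: (sub0 (ival_sub _)).
  split=> //; apply/eqP; rewrite eq_le; apply/andP; split; last by move/mem_ord: Ix => ->.
  rewrite leNgt; apply/negP => lt; apply: nx; apply/mem_ord => // Q pQ.
  rewrite ordD (ord_prime Q pP); have [<-|_] := eqVneq P Q; first by move: lt; rewrite lezD1.
  by rewrite addr0; move/mem_ord: Ix => ->.
have [[P0 aP0]|noP] := pselect (exists P, above O P); last first.
  have [x Ix x0] := invideal_nonzero I; exists x; split=> // P aP.
  by case: noP; exists P.
suff : forall L, uniq L -> (forall P, P \in L -> above O P) -> exists x, [/\ ival I x,
    forall P, P \in L -> ~ ival (I + P) x & forall P, above O P -> P \notin L -> ival (I + P) x].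
  move=> /(_ _ (above_seq_uniq O))[P /above_seqP //|x [Ix nx _]].
  have nx' P : above O P -> ~ ival (I + P) x by move/above_seqP/nx.
  exists x; split=> //; first by case: (done1 P0 x (proj1 aP0) Ix (nx' _ aP0)).
  by move=> P aP; case: (done1 P x (proj1 aP) Ix (nx' _ aP)).
elim=> [_ _|P L IH /= /andP[PL uL] aL].
  by exists 0; split=> // [|P _ _]; exact: (sub0 (ival_sub _)).
have aP : above O P by apply: aL; rewrite inE eqxx.
have aL' Q : Q \in L -> above O Q by move=> QL; apply: aL; rewrite inE QL orbT.
have [x [Ix nx yx]] := IH uL aL'.
have [pP _] := aP.
have [t [It nt]] : exists t, ival I t /\ ~ ival (I + P) t.
  apply: contrapT => H; have /leI : ival I `<=` ival (I + P).
    by move=> t It; apply: contrapT => nt; apply: H; exists t.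
  by rewrite opprD addrA subrr sub0r => /(ord_ge0 P); rewrite ordN (ord_prime P pP) eqxx.
have [t0 vt] := done1 P t pP It nt.
have [e [eO Pe Qe]] := idempotent_at inj 1 aP.
have eR := O_R eO; rewrite mulr1n in Pe.
have nPe : ~ ival P e.
  move=> Pe'; have [_ P1 _] := pP; apply: P1.
  by have := subD (ival_sub P) Pe Pe'; rewrite subrK.
have [e0 ve] := prime_nmem pP eR nPe.
have Ite : ival I (t * e) by rewrite mulrC; apply: (subM (ival_sub I)).
have te0 : t * e != 0 by rewrite mulf_neq0.
have nte : ~ ival (I + P) (t * e).
  move/mem_ord => /(_ te0 P pP); rewrite ordD (ord_prime P pP) eqxx pvalM // vt ve; lia.
have Qte Q : above O Q -> Q != P -> ival (I + Q) (t * e).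
  by move=> aQ QP; apply: mem_idealM => //; exact: Qe.
exists (x + t * e); split; first exact: (subD (ival_sub I)).
- move=> Q; rewrite inE; case: eqP => [-> _|/eqP QP /= QL].
    by move=> /(subB (ival_sub (I + P)))/(_ (yx P aP PL)); rewrite (addrC x) addrK.
  move=> /(subB (ival_sub (I + Q)))/(_ (Qte Q (aL' Q QL) QP)); rewrite addrK; exact: nx.
- move=> Q aQ; rewrite inE negb_or => /andP[QP QL].
  by apply: (subD (ival_sub (I + Q))); [exact: yx|exact: Qte].
Qed.

Lemma coprime_representative I : exists J, [/\ integral_ideal J, coprimeI O J & J - I \in Prin].
Proof.
have [x [x0 Ix vx]] := approximation (- I).
exists (pid R x + I); split.
- by have /(mem_pid _ x0) := Ix; rewrite opprK.
- by move=> P /vx; rewrite ordD /pval => ->; rewrite ordN addNr.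
- by rewrite addrK pid_prin.
Qed.

Definition contraction I : set K := [set x | x \in O /\ ival I x].

Lemma contraction_fractional I : integral_ideal I -> is_fractional O (contraction I).
Proof.
move=> iI; split; first split.
- by split; [exact: rpred0|exact: (sub0 (ival_sub I))].
- by move=> x y [xO Ix] [yO Iy]; split; [exact: rpredD|exact: (subD (ival_sub I))].
- move=> a x aO [xO Ix]; split; first exact: rpredM.
  by apply: (subM (ival_sub I)) => //; exact: O_R aO.
- have [x Ix x0] := invideal_nonzero I; have [c fc c0] := ord_cond O.
  exists (c * x); last by rewrite mulf_neq0.
  split; first by case: fc => _; apply; exact: iI.
  by apply: (subM (ival_sub I)) => //; exact: cond_R fc.
- by exists 1; rewrite rpred1 oner_neq0; split=> // x [xO _]; rewrite mul1r.
Qed.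

Lemma coprime_contraction I : integral_ideal I -> coprimeI O I ->
  exists x e, [/\ contraction I x, cond O e & x + e = 1].
Proof.
move=> iI cI; have [|P pP o1 o2|x [e [Ix ce xe]]] := @crt _ _ I (condI O) iI.
- exact: condI_integral.
- by have /(above_ord O pP) := o2 => /cI o0; rewrite o0 in o1.
rewrite condIE in ce; exists x, e; split=> //; split=> //.
by rewrite -(addrK e x) xe rpredB ?rpred1 //; exact: cond_O ce.
Qed.

Lemma cond_contraction I x e : integral_ideal I -> ival I x -> cond O e -> contraction I (x * e).
Proof.
move=> iI Ix ce; split; first by rewrite mulrC; case: ce => _; apply; exact: iI.
by rewrite mulrC; apply: (subM (ival_sub I)) => //; exact: cond_R ce.
Qed.

Lemma contraction_invertible I : integral_ideal I -> coprimeI O I ->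
  is_invertible O (contraction I).
Proof.
move=> iI cI; have [m m0 mP] := torsion_principal torR I.
have iIn n : integral_ideal (I *+ n).
  by elim: n => [|n IH]; [exact: integral0|rewrite mulrS; exact: integralD].
have [q q0 qE] := prinP mP.
have qR : q \in R by apply/pid_integral => //; rewrite -qE.
have cq : cop O q.
  by apply: pval_cop => // P aP; rewrite /pval -qE ordMn cI // mul0rn.
have [k k0 ck] := cop_pow cq.
have qkO : q ^+ k \in O by apply: (cgr_O ck); exact: rpred1.
set z := q ^+ k in ck qkO; have z0 : z != 0 by rewrite expf_neq0.
have cz : cop O z.
  apply: pval_cop => [||P aP]; [exact: O_R qkO|exact: z0|].
  by rewrite /z pvalX // (cop_pval aP qR q0 cq) mul0rn.
have [n nE] : exists n, pid R z = I + I *+ n.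
  by exists (m * k).-1; rewrite /z pidX // -qE -mulrnA -mulrS prednK // muln_gt0 m0.
have z_mem x : ival (I + I *+ n) x -> exists2 r, r \in R & x = z * r.
  by rewrite -nE val_pid // => -[r rR <-]; exists r.
have Iz : ival (I + I *+ n) z by rewrite -nE val_pid //; exact: idealP_mem.
have [x [e [Cx ce xe]]] := coprime_contraction iI cI.
have [y [f [Cy cf yf]]] := coprime_contraction (iIn n) (coprimeIMn n cI).
have zI : ival I z.
  move: z Iz {ck qkO z0 cz nE z_mem}; apply: (@idealM_sub _ R); first exact: ival_sub.
  move=> a b Ia Ib; rewrite mulrC; apply: (subM (ival_sub I)) => //; exact: iIn Ib.
have zIn : ival (I *+ n) z.
  move: z Iz {ck qkO z0 cz nE z_mem zI}; apply: (@idealM_sub _ R); first exact: ival_sub.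
  move=> a b Ia Ib; apply: (subM (ival_sub _)) => //; exact: iI Ia.
apply: (@invertible_of _ _ _ [set z^-1 * b | b in contraction (I *+ n)]).
  exact: contraction_fractional.
have sM : is_submodule O (idealM (contraction I) (contraction (I *+ n))).
  by apply: idealM_submodule; case: (contraction_fractional iI).
have zM : idealM (contraction I) (contraction (I *+ n)) z.
  have -> : z = z * (x * y) + (z * e * y + (x * (z * f) + z * (e * f))).
    by rewrite -[LHS]mulr1 -[X in _ * X]mulr1 -{1}xe -{1}yf; ring.
  apply: (subD sM); first by apply: (subM sM) => //; exact: mem_idealM.
  apply: (subD sM); first by apply: mem_idealM => //; exact: cond_contraction.
  apply: (subD sM); first by apply: mem_idealM => //; exact: cond_contraction.
  have ief t : ival (I + I *+ n) t -> idealM (contraction I) (contraction (I *+ n)) (t * (e * f)).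
    move: t; apply: idealM_ind => [|a b|a b Ia Ib].
    - by rewrite mul0r; exact: idealM0.
    - by rewrite mulrDl; exact: idealMD.
    - rewrite mulrACA; apply: mem_idealM; apply: cond_contraction => //; exact: iIn.
  exact: ief.
apply/seteqP; split.
  apply: (@idealM_sub _ O); first exact: setR_submodule.
  move=> a _ [aO Ia] [b [bO Ib] <-].
  have [r rR ab] : exists2 r, r \in R & a * b = z * r by apply: z_mem; exact: mem_idealM.
  have -> : a * (z^-1 * b) = r by rewrite mulrCA ab mulKf.
  by apply: (division qkO cz rR); rewrite -ab rpredM.
suff one : idealM (contraction I) [set z^-1 * b | b in contraction (I *+ n)] 1.
  move=> a aO; rewrite -[a]mulr1; apply: (@subM _ O) => //.
  by apply: idealM_submodule; case: (contraction_fractional iI).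
have -> : 1 = z^-1 * z by rewrite mulVf.
move: z zM {ck qkO z0 cz nE z_mem Iz zI zIn} => z.
set w := z^-1; move: z w => z w.
move: z; apply: idealM_ind => [|a b|a b Ca Cb].
- by rewrite mulr0; exact: idealM0.
- by rewrite mulrDr; exact: idealMD.
- by rewrite mulrCA; apply: mem_idealM => //; exists b.
Qed.

Lemma pic_prime I : primes_in_all_classes O (cond O) -> integral_ideal I -> coprimeI O I ->
  exists Q y, [/\ prime_ideal Q, ~ above O Q, y != 0, Q = pid R y + I
    & forall x, x \in O -> ival Q x -> x / y \in O].
Proof.
move=> pe iI cI; pose II : invideal O := InvIdeal (asboolT (contraction_invertible iI cI)).
have [p [pp cpp cl]] := pe (ideal_class II).
have : p - II \in @principal K O by rewrite Quotient.idealrBE; apply/eqP.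
move=> /asboolP[y yE].
have pE x : ival p x <-> exists2 i, contraction I i & x = y * i.
  rewrite -{1}(subrK II p) /= -[idealM p _]/(ival (p - II)) yE; split.
    move: x; apply: idealM_ind => [|x t [i Ii ->] [j Ij ->]|_ i [a aO <-] Ii].
    - exists 0; rewrite ?mulr0 //; split; [exact: rpred0|exact: (sub0 (ival_sub I))].
    - exists (i + j); last by rewrite mulrDr.
      by case: Ii Ij => iO Ii [jO Ij]; split; [exact: rpredD|exact: (subD (ival_sub I))].
    - exists (a * i); last by rewrite mulrA.
      by case: Ii => iO Ii; split; [exact: rpredM|apply: (subM (ival_sub I)) => //; exact: O_R aO].
  by move=> [i Ii ->]; apply: mem_idealM => //; exists 1; rewrite ?mulr1 //; exact: rpred1.
have [[sp pO] p1 pM] := pp.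
have y0 : y != 0.
  apply/eqP => y0; have /asboolP[[_ [x /pE[i _ ->]]]] := ivalP p.
  by rewrite y0 mul0r eqxx.
have [x0 [e [Cx0 ce xe]]] := coprime_contraction iI cI.
have one : [set` O] 1 by exact: rpred1.
have [p0 pp0 [f cf pf]] : [set x + y | x in ival p & y in cond O] 1 by rewrite cpp.
pose Q := pid R y + I.
have QE x : ival Q x <-> ival I (x / y).
  split.
    move: x; apply: (@idealM_ind _ _ _ [set x | ival I (x / y)]) => /=.
    - by rewrite mul0r; exact: (sub0 (ival_sub I)).
    - by move=> a b; rewrite mulrDl; exact: (subD (ival_sub I)).
    - rewrite val_pid // => _ b [a aR <-] Ib.
      have -> : y * a * b / y = a * b by field.
      by apply: (subM (ival_sub I)).
  move=> Ix; have -> : x = y * (x / y) by field.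
  by apply: mem_idealM => //; rewrite val_pid //; exact: idealP_mem.
have pQ x : ival p x -> ival Q x.
  by move=> /pE[i [_ Ii] ->]; apply/QE; have -> : y * i / y = i by field.
have OQ x : x \in O -> ival Q x -> ival p x.
  move=> xO /QE Ix; rewrite -[x]mulr1 -pf mulrDr; apply: (subD sp).
    exact: (subM sp).
  apply/pE; exists (x / y * f); first exact: cond_contraction.
  by field.
have iQ : integral_ideal Q.
  move=> x /QE Ix; have -> : x = y * (x / y * e) + x / y * (y * x0).
    by rewrite (_ : e = 1 - x0); [field|rewrite -xe addrC addKr].
  apply: rpredD.
    by apply: O_R; apply: pO; apply/pE; exists (x / y * e) => //; exact: cond_contraction.
  apply: rpredM; first exact: (iI _ Ix).
  by apply: O_R; apply: pO; apply/pE; exists x0.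
have Q1 : ~ ival Q 1 by move/(OQ _ (rpred1 _))/p1.
have fR := cond_R cf.
exists Q, y; split=> //.
- split=> //; first by split; [exact: ival_sub|].
  move=> x t xR tR Qxt.
  have xf : x * f \in O by rewrite mulrC; case: cf => _; exact.
  have tf : t * f \in O by rewrite mulrC; case: cf => _; exact.
  have back z : z \in R -> ival p (z * f) -> ival Q z.
    move=> zR pz; rewrite -[z]mulr1 -pf mulrDr; apply: (subD (ival_sub Q)).
      by apply: (subM (ival_sub Q)) => //; exact: pQ.
    exact: pQ.
  have [|/(back _ xR)|/(back _ tR)] := pM _ _ xf tf; [|by left|by right].
  apply: OQ; first exact: rpredM.
  by rewrite mulrACA mulrC; apply: (subM (ival_sub Q)) => //; exact: rpredM.
- move=> [_ fQ]; apply: Q1; rewrite -pf; apply: (subD (ival_sub Q)); first exact: pQ.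
  exact: fQ.
- by move=> x xO /(OQ _ xO)/pE[i [iO _] ->]; have -> : y * i / y = i by field.
Qed.

Lemma pic_primes_everywhere : primes_in_all_classes O (cond O) -> primes_everywhere O.
Proof.
move=> pe c; have [I Ic] := class_surj c.
have [J [iJ cJ JI]] := coprime_representative I.
have [Q [y [pQ nQ y0 QE _]]] := pic_prime pe iJ cJ.
exists Q; split=> //; rewrite -Ic; apply/class_eq.
by rewrite QE -addrA rpredD // pid_prin.
Qed.

End PrimesOfOrder.

(** * Local divisors of small value *)

Section LocalAtoms.
Variables (K : fieldType) (R : dedDomain K) (O : orderIn R).
Implicit Types (x y a b q r s t u v w : K) (I J P Q X Y : invideal R).
Variable eqv : K -> K -> Prop.
Hypothesis lft : lifting O eqv.
Hypothesis torR : torsion (Cl R).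

Local Notation Prin := (@principal K R).
Local Notation Ord := (orderly O).

Let inj : inj_contraction O := lifting_inj lft torR.

Lemma pic_units_full : primes_in_all_classes O (cond O) -> units_full O.
Proof.
move=> pe; apply: units_full_of_integral => I iI cI pI.
have [Q [y [pQ nQ y0 QE Qy]]] := pic_prime torR pe iI cI.
have QP : Q \in Prin by rewrite QE rpredD // pid_prin.
have QO : Q \in Ord by rewrite -[Q]mulr1n; apply: (cyclic_orderly lft torR).
have [o [oO o0 co oE]] := orderly_gen QO (prime_integral pQ).
have oy : o / y \in O by apply: Qy => //; rewrite oE val_pid //; exact: idealP_mem.
have IE : I = pid R (o / y) by rewrite pid_div // -oE QE addrC addKr.
rewrite IE; apply: (orderly_of _) => //; last by rewrite -IE.
by split=> //; rewrite mulf_neq0 ?invr_neq0.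
Qed.

Definition local_divisor P u v := exists s w, [/\ s \in O, ~ ival P s, w \in O & s * u = v * w].

Lemma local_divisor_sim P u a v : prime_ideal P -> sim O P u a -> divides_in O a v ->
  local_divisor P u v.
Proof.
move=> pP [s [t [sO tO Ps Pt e]]] [w wO aE]; exists t, (s * w); split=> //; first exact: rpredM.
by rewrite -e aE mulrCA.
Qed.

Lemma local_divisor_trans P u v w : prime_ideal P -> local_divisor P u v -> local_divisor P v w ->
  local_divisor P u w.
Proof.
move=> pP [s [a [sO Ps aO e]]] [t [b [tO Pt bO e']]]; exists (s * t), (a * b).
split; [exact: rpredM|by apply: nmem_prime_mul => //; [exact: O_R sO|exact: O_R tO]|exact: rpredM|].
by rewrite mulrAC e mulrAC (mulrC v) e' mulrA mulrAC.
Qed.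

Hypothesis full : units_full O.

Lemma adjust P u n J : above O P -> nz O u -> pval P u = n%:Z -> integral_ideal J -> coprimeI O J ->
  P *+ n + J \in Prin -> exists a, [/\ nz O a, pid R a = P *+ n + J & sim O P u a].
Proof.
move=> aP [uO u0] un iJ cJ pJ; have [pP _] := aP.
have [u' [u'O u'0 su nu]] := localize inj aP uO u0.
have [_ vu'] := sim_pval pP u0 su.
have cop : coprimeI O (P *+ n + J - pid R u').
  move=> Q aQ; rewrite ordB ordD (cJ Q aQ) addr0 ordMn (ord_prime Q pP) -/(pval Q u').
  have [<-|PQ] := eqVneq P Q; first by rewrite vu' un natz subrr.
  by rewrite eq_sym in PQ; have [_ ->] := prime_nmem (proj1 aQ) (O_R u'O) (nu Q aQ PQ); rewrite mul0rn subrr.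
have /asboolP[b [c [[bO cO] [b0 c0] cb cc e]]] := full cop (rpredB pJ (pid_prin _ u'0)).
have aE : pid R (u' * b / c) = P *+ n + J.
  rewrite pid_div ?mulf_neq0 // pidM // -addrA -e addrC subrK //.
have a0 : u' * b / c != 0 by rewrite !mulf_neq0 ?invr_neq0.
have aR : u' * b / c \in R.
  apply/pid_integral => //; rewrite aE; apply: integralD => //.
  by apply/integralP => Q _; rewrite ordMn ord_prime //; case: eqP => _ /=; lia.
have ca : c * (u' * b / c) = u' * b by field.
exists (u' * b / c); split=> //.
  by split=> //; apply: (division cO cc aR); rewrite ca rpredM.
apply: (sim_trans pP su); exists c, b; split=> //; [exact: cop_nmem aP cc|exact: cop_nmem aP cb|].
by rewrite ca mulrC.
Qed.

Lemma prime_ne P Q : above O P -> ~ above O Q -> (Q == P) = false.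
Proof. by move=> aP nQ; apply/eqP => QP; apply: nQ; rewrite QP. Qed.

Lemma local_dichotomy P u n : primes_everywhere O -> above O P -> nz O u -> pval P u = n.+1%:Z ->
  (exists v, [/\ nz O v, pval P v = 1 & local_divisor P u v]) \/
  [/\ P \notin Prin, P *+ 2 \in Prin, ~~ odd n.+1 &
    exists v, [/\ nz O v, pval P v = 2 & local_divisor P u v]].
Proof.
move=> pe aP uO un; have [pP _] := aP.
have [PP|nP] := boolP (P \in Prin).
  left; have [||a [aO aE su]] := @adjust P u n.+1 0 aP uO un (@integral0 _ _).
  - by move=> Q _; rewrite ord0.
  - by rewrite addr0 rpredMn.
  rewrite addr0 in aE.
  have [q q0 qE] := prinP PP.
  have qR : nz R q by split=> //; apply/pid_integral => //; rewrite -qE; exact: prime_integral.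
  have q1 : pid R q != 0.
    by rewrite -qE; apply/eqP => /(congr1 (ord P)); rewrite ord0 ord_prime // eqxx.
  have [|vs [szv vP pu]] := lift_power lft torR aO qR q1 (k := n.+1); first by rewrite -qE.
  have ge1 v : v \in vs -> 1 <= pval P v.
    move=> /vP[vO v1 dv]; have iv := pid_nz_integral vO.
    have [|k vE] := @divisor_primeX _ _ (pid R v) P n.+1 pP iv.
      by rewrite -aE; exact: (divides_integral aO vO dv).
    rewrite /pval vE ordMn ord_prime // eqxx natz lez_nat lt0n.
    by apply: contraNneq v1 => k0; rewrite vE k0.
  case: vs szv vP pu ge1 => // v vs [szv] vP pu ge1.
  have [vO v1 dv] := vP v (mem_head _ _).
  exists v; split=> //; last exact: local_divisor_sim su dv.
  have := congr1 (ord P) pu; rewrite aE ordMn (ord_prime P pP) eqxx natz ord_sum big_cons.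
  have : 1 *+ size vs <= \sum_(w <- vs) ord P (pid R w).
    by apply: sumz_ge => w wvs; apply: ge1; rewrite inE wvs orbT.
  have := ge1 v (mem_head _ _); rewrite (intMn 1) szv mul1n /pval.
  by move: (ord P _) (\sum_(_ <- _) _) => A B; clear; lia.
have [Q [pQ aQ Qc]] := pe (- ideal_class P).
have PQ : P + Q \in Prin by apply/class_eq0; rewrite classD Qc subrr.
have QP : (Q == P) = false by exact: (prime_ne aP aQ).
have cQ : coprimeI O (Q *+ n.+1) by apply: coprimeIMn; exact: coprimeI_prime.
have iQ : integral_ideal (Q *+ n.+1).
  by apply/integralP => A _; rewrite ordMn ord_prime //; case: eqP => _ /=; lia.
have [|a [aO aE su]] := @adjust P u n.+1 _ aP uO un iQ cQ.
  by rewrite -mulrnDl rpredMn.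
rewrite -mulrnDl in aE.
have [P2|P2] := boolP (P *+ 2 \in Prin); last first.
  left; have [//|v [vO dv vE]] := pair_split lft torR pP pQ PQ P2 _ aO aE.
  exists v; split=> //; last exact: local_divisor_sim su dv.
  by rewrite /pval vE ordD !ord_prime // eqxx QP.
have nnQ : nonprin_prime Q by split=> //; exact: opposite_nonprin nP PQ.
have [vs [szv vP pu]] := pair_split2 lft torR (conj pP nP) nnQ PQ aO aE.
have sumP : \sum_(v <- vs) pval P v = n.+1%:Z.
  have := congr1 (ord P) pu; rewrite aE ordMn ordD (ord_prime P pP) (ord_prime P pQ) eqxx QP addr0 natz ord_sum.
  by move=> <-.
have [[v [vvs v1]]|no1] := pselect (exists v, v \in vs /\ pval P v = 1).
  left; have [vO _ dv] := vP v vvs; exists v; split=> //; exact: local_divisor_sim su dv.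
have two v : v \in vs -> pval P v = 0 \/ pval P v = 2.
  move=> vvs; have [vO v2 dv] := vP v vvs; have iv := pid_nz_integral vO.
  have ne1 : pval P v <> 1 by move=> e; apply: no1; exists v.
  move: (ord_le_deg P iv) (ord_ge0 P iv) ne1; rewrite v2 /pval.
  by move: (ord _ _) => A; clear; lia.
right; split=> //.
  apply/negP => odd_n; have [k] : exists k, \sum_(v <- vs) pval P v = 2 * k.
    elim: (vs) two => [_|v l IH two]; first by exists 0; rewrite big_nil.
    have [k e] := IH (fun w wl => two w (mem_behead (s := v :: l) wl)).
    rewrite big_cons e; case: (two v (mem_head _ _)) => ->; first by exists k; rewrite add0r.
    by exists (1 + k); rewrite mulrDr mulr1.
  by rewrite sumP; move: odd_n; clear; lia.
have [[v [vvs v2]]|no2] := pselect (exists v, v \in vs /\ pval P v = 2).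
  have [vO _ dv] := vP v vvs; exists v; split=> //; exact: local_divisor_sim su dv.
move: sumP; rewrite big_seq big1 // => v vvs; case: (two v vvs) => // v2.
by case: no2; exists v.
Qed.

Lemma local_six P u : primes_everywhere O -> ~ has_two_elements (Cl R) -> above O P -> nz O u ->
    P \notin Prin -> P *+ 2 \in Prin -> pval P u = 2 ->
  exists v, [/\ nz O v, pval P v = 1 & local_divisor P u v].
Proof.
move=> pe n2 aP uO nP P2 u2; have [pP _] := aP.
have cP0 : ideal_class P != 0 by apply/eqP => /class_eq0 PP; rewrite PP in nP.
have [d [d0 dP]] := third_class n2 cP0.
have [A [pA aA Ad]] := pe d; have [B [pB aB Bd]] := pe (- (ideal_class P + d)).
have PP : ideal_class P + ideal_class P = 0 by rewrite -classD -mulr2n; apply/class_eq0.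
have nA : A \notin Prin by apply/negP => /class_eq0; rewrite Ad; exact/eqP.
have nB : B \notin Prin.
  apply/negP => /class_eq0; rewrite Bd => /eqP; rewrite oppr_eq0 addr_eq0 => /eqP e.
  case/eqP: dP; apply/eqP; rewrite -subr_eq0 -{1}[d]opprK -e.
  by rewrite -opprD PP oppr0.
have [A' [pA' aA' AA' _]] := opposite_prime lft torR pe pA aA.
have [B' [pB' aB' BB' _]] := opposite_prime lft torR pe pB aB.
have AAP := orderly_prin AA'; have BBP := orderly_prin BB'.
have nA' := opposite_nonprin nA AAP; have nB' := opposite_nonprin nB BBP.
have iJ : integral_ideal ((A + A') + (B + B')).
  by do 3?apply: integralD; exact: prime_integral.
have cJ : coprimeI O ((A + A') + (B + B')).
  by do 3?apply: coprimeID; exact: coprimeI_prime.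
have [|a [aO aE su]] := @adjust P u 2 _ aP uO u2 iJ cJ.
  by apply: rpredD => //; apply: rpredD.
have PAB : P + A + B \in Prin by apply/class_eq0; rewrite !classD Ad Bd subrr.
have P2' : P + P \in Prin by rewrite -mulr2n.
rewrite mulr2n addrA in aE.
have [v [c1 [c2 [c3 [vO dv vE]]]]] := six_split lft torR (conj pP nP) (conj pA nA) (conj pB nB)
  (conj pP nP) (conj pA' nA') (conj pB' nB') PAB P2' AAP BBP aO aE.
exists v; split=> //; last exact: local_divisor_sim su dv.
rewrite /pval {}vE !ordD /pick2; case: c1; case: c2; case: c3; rewrite !ord_prime // eqxx.
all: by rewrite ?(prime_ne aP aA) ?(prime_ne aP aB) ?(prime_ne aP aA') ?(prime_ne aP aB').
Qed.

Lemma local_one P u : primes_everywhere O -> ~ has_two_elements (Cl R) -> above O P -> nz O u ->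
  1 <= pval P u -> exists v, [/\ nz O v, pval P v = 1 & local_divisor P u v].
Proof.
move=> pe n2 aP uO u1; have [n un] : exists n, pval P u = n.+1%:Z.
  by exists (absz (pval P u)).-1; move: u1; move: (pval _ _) => z; clear; lia.
have [//|[nP P2 _ [v [vO v2 dv]]]] := local_dichotomy pe aP uO un.
have [w [wO w1 dw]] := local_six pe n2 aP vO nP P2 v2.
exists w; split=> //; exact: local_divisor_trans (proj1 aP) dv dw.
Qed.

End LocalAtoms.

Section LocalToGlobal.
Variables (K : fieldType) (R : dedDomain K) (O : orderIn R).
Implicit Types (x y a b q r s t u v w : K) (I J P Q X Y : invideal R).

Lemma units_full_factor : inj_contraction O -> units_full O ->
  (forall P, above O P -> exists u, nz O u /\ pval P u = 1) -> factor_units O.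
Proof.
move=> inj full ex1 x; split; last first.
  by move=> [a [e [aO [_ eR _] ->]]]; apply: rpredM => //; exact: O_R aO.
move=> xR; have [->|x0] := eqVneq x 0.
  exists 0, 1; rewrite mul0r rpred0; split=> //; split; rewrite /= ?invr1 ?oner_neq0 ?rpred1 //.
have /choice[f fP] : forall P, exists u, above O P -> nz O u /\ pval P u = 1.
  by move=> P; have [/ex1[u uP]|nP] := pselect (above O P); [exists u|exists 0].
have [|b [bO b0 sb _]] := glue inj (above_seq_uniq O) (f := fun P => f P ^+ absz (pval P x)).
  by move=> P /above_seqP aP; have [[fO f0] _] := fP P aP; rewrite rpredX ?expf_neq0.
have vb P : above O P -> pval P b = pval P x.
  move=> aP; have [[fO f0] f1] := fP P aP.
  have [|_ ->] := sim_pval (proj1 aP) _ (sb P (proj2 (above_seqP O P) aP)).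
    by rewrite expf_neq0.
  by rewrite pvalX // f1 natz gez0_abs // pval_ge0.
have cI : coprimeI O (pid R x - pid R b).
  by move=> P /vb; rewrite /pval ordB => ->; rewrite subrr.
have /asboolP[c [d [[cO dO] [c0 d0] cc cd e]]] := full _ cI (rpredB (pid_prin _ x0) (pid_prin _ b0)).
have e' : pid R (x * d) = pid R (b * c).
  by rewrite !pidM // -[pid R x](subrK (pid R b)) e addrAC subrK addrC.
have ue : ring_unit [set` R] (x * d / (b * c)) by apply: pid_inj => //; rewrite mulf_neq0.
have [e0 eR eVR] := ue.
have aR : x * (x * d / (b * c))^-1 \in R by apply: rpredM.
have xd : d * (x * (x * d / (b * c))^-1) = b * c by field; rewrite x0 d0 c0 b0.
exists (x * (x * d / (b * c))^-1), (x * d / (b * c)); split=> //; last by rewrite divfK.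
by apply: (division dO cd aR); rewrite xd rpredM.
Qed.

Lemma pval1_ex P : prime_ideal P -> exists x, nz R x /\ pval P x = 1.
Proof.
move=> pP; have [x [Px nx]] : exists x, ival P x /\ ~ ival (P *+ 2) x.
  apply: contrapT => H; have /leI : ival P `<=` ival (P *+ 2).
    by move=> x Px; apply: contrapT => nx; apply: H; exists x.
  by rewrite mulr2n opprD addrA subrr sub0r => /(ord_ge0 P); rewrite ordN (ord_prime P pP) eqxx.
have xR := prime_integral pP Px.
have x0 : x != 0 by apply/eqP => x0; apply: nx; rewrite x0; exact: (sub0 (ival_sub _)).
exists x; split=> //; have := prime_mem pP x0 xR; have := mem_primeX 2 pP xR x0.
move=> [_ H2] [H1 _]; move: (H1 Px); have : ~ (2%:Z <= pval P x) by move=> /H2.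
by move: (pval P x) => z; clear; lia.
Qed.

End LocalToGlobal.

(** * Localizations and their atoms *)

Section Localizations.
Variables (K : fieldType) (R : dedDomain K) (O : orderIn R).
Implicit Types (x y a b r s t u v w z : K) (I J P Q : invideal R).
Hypothesis inj : inj_contraction O.

Lemma pval_exprz P x (n : int) : x != 0 -> pval P (x ^ n) = pval P x * n.
Proof.
move=> x0; case: n => n; first by rewrite -exprnP pvalX // -mulr_natr natz.
by rewrite NegzE -exprnN pvalV ?expf_neq0 // pvalX // mulrN -mulr_natr natz.
Qed.

Definition over (p : spec O) P := prime_ideal P /\ forall a, a \in O -> (ival P a <-> prime_set p a).

Lemma spec_over (p : spec O) : nonzero (prime_set p) -> exists P, over p P.
Proof.
move=> [z pz z0]; have [[sp pO] p1 pM] := spec_prime p.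
pose S := [set s | s \in O /\ ~ prime_set p s].
have zR : z \in R by apply: O_R; exact: pO.
have [J [idJ nJ JS]] : exists J : set K, [/\ is_ideal R J, nonzero J & forall x, J x -> ~ S x].
  have [fp|/existsNP[f /not_implyP[cf pf]]] := pselect (cond O `<=` prime_set p).
    exists (cond O); split; [exact: cond_ideal|exact: ord_cond|].
    by move=> x /fp px [_].
  exists (idealP R z); split; last 1 first.
  - move=> _ [r rR <-] [zrO]; apply.
    have [|//|/pf//] := pM _ _ zrO (cond_O cf).
    rewrite -mulrA mulrC; apply: (subM sp) => //.
    by rewrite mulrC; case: cf => _; exact.
  - split; [exact: idealP_submodule|by move=> _ [a aR <-]; apply: rpredM].
  - by exists z => //; exact: idealP_mem.
have [|||P [pP _ PS]] := @prime_disjoint _ R S J _ _ _ idJ nJ JS.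
- move=> a b [aO pa] [bO pb]; split; first exact: rpredM.
  by move/(pM _ _ aO bO) => [].
- by split; first exact: rpred1.
- by move=> x [xO _]; exact: O_R xO.
have Pp a : a \in O -> ival P a -> prime_set p a.
  by move=> aO Pa; apply: contrapT => pa; apply: (PS _ Pa).
exists P; split=> // a aO; split; first exact: Pp.
move=> pa; apply: contrapT => Pa; have [b bO Pab] := contraction_maximal pP aO Pa.
apply: p1; have -> : 1 = a * b - (a * b - 1) by ring.
apply: (subB sp); first by rewrite mulrC; apply: (subM sp).
by apply: Pp => //; rewrite rpredB ?rpredM ?rpred1.
Qed.

Section Over.
Variables (p : spec O) (P : invideal R).
Hypothesis pPo : over p P.
Let pP : prime_ideal P. Proof. by case: pPo. Qed.

Lemma locP x : x \in localization p <->
  exists a s, [/\ a \in O, s \in O, ~ ival P s & x = a / s].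
Proof.
have [_ PE] := pPo.
split=> [/asboolP[a [s [aO sO ps ->]]]|[a [s [aO sO ps ->]]]].
  by exists a, s; split=> //; move/(PE s sO).
by apply/asboolP; exists a, s; split=> //; move/(PE s sO).
Qed.

Lemma loc_O a : a \in O -> a \in localization p.
Proof.
move=> aO; apply/locP; exists a, 1; rewrite divr1 rpred1; split=> //.
by case: pP.
Qed.

Lemma loc_pval x : x \in localization p -> x != 0 -> 0 <= pval P x.
Proof.
move=> /locP[a [s [aO sO Ps ->]]] x0.
have [s0 vs] := prime_nmem pP (O_R sO) Ps.
have a0 : a != 0 by apply: contraNneq x0 => ->; rewrite mul0r.
by rewrite pval_div // vs subr0 pval_ge0 //; exact: O_R aO.
Qed.

Lemma loc_unit x : x \in localization p -> x != 0 -> pval P x = 0 -> x^-1 \in localization p.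
Proof.
move=> /locP[a [s [aO sO Ps ->]]] x0 vx; apply/locP; exists s, a.
have [s0 vs] := prime_nmem pP (O_R sO) Ps.
have a0 : a != 0 by apply: contraNneq x0 => ->; rewrite mul0r.
rewrite invf_div; split=> // /(prime_mem pP a0 (O_R aO)).
by move: vx; rewrite pval_div // vs subr0 => ->.
Qed.

Lemma munit_pval (u : dot (localization p)) : munit u <-> pval P (dotval u) = 0.
Proof.
have [uL u0] : nz (localization p) (dotval u) := dot_nz u.
split=> [[v /(congr1 val)/= uv]|vu].
  have [vL v0] : nz (localization p) (dotval v) := dot_nz v.
  have := congr1 (pval P) uv; rewrite pvalM // pval1 => /eqP.
  by rewrite paddr_eq0 ?loc_pval // => /andP[/eqP].
have uV : nz (localization p) (dotval u)^-1 by split; [exact: loc_unit|rewrite invr_neq0].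
by exists (mkdot uV); apply/val_inj; rewrite /= divff.
Qed.

Lemma common_denominator x : x != 0 -> 0 <= pval P x ->
  exists a s, [/\ a \in R, s \in O, ~ ival P s & x = a / s].
Proof.
move=> x0 vx; have [|r [rR Pr rx]] := @denominator _ _ P x 0 pP x0 (@integral0 _ _).
  by rewrite ord0.
have [k k0 rkO] := root_O inj rR; case: k k0 rkO => // k _ rkO.
have [r0 _] := prime_nmem pP rR Pr.
exists (r ^+ k * (r * x)), (r ^+ k.+1); split=> //.
- by rewrite rpredM ?rpredX.
- exact: nmem_prime_exp.
- by rewrite mulrA -exprSr mulrAC divff ?mul1r ?expf_neq0.
Qed.

Lemma intclosure_loc x : intclosure (localization p) x <-> x = 0 \/ 0 <= pval P x.
Proof.
split=> [[f [mf fO rf]]|[->|vx]].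
- have [->|x0] := eqVneq x 0; [by left|right].
  rewrite leNgt; apply/negP => vx; pose n := (size f).-1.
  pose W := [set z | z = 0 \/ (z != 0 /\ 1 <= pval P z)].
  have WD z z' : W z -> W z' -> W (z + z').
    move=> [->|[z0 vz]]; first by rewrite add0r.
    move=> [->|[z'0 vz']]; first by rewrite addr0; right.
    have [->|zz0] := eqVneq (z + z') 0; [by left|right; split=> //].
    exact: pval_add.
  have szf : size f = n.+1 by rewrite prednK // lt0n size_poly_eq0 monic_neq0.
  have : W 1.
    have -> : 1 = - \sum_(i < n) f`_i * x ^+ i / x ^+ n.
      have : f.[x] / x ^+ n = 0 by rewrite (rootP rf) mul0r.
      rewrite horner_coef szf big_ord_recr /= mulrDl.
      have -> : f`_n = 1 by move/monicP: mf.
      rewrite mul1r divff ?expf_neq0 // => /eqP; rewrite addrC addr_eq0 => /eqP ->.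
      by rewrite mulr_suml.
    have WN z : W z -> W (- z).
      move=> [->|[z0 vz]]; [by left; rewrite oppr0|right].
      rewrite oppr_eq0; split=> //.
      by rewrite -mulN1r pvalM ?oppr_eq0 ?oner_neq0 //; have := pvalM P (x := -1) (y := -1);
        rewrite mulrNN mulr1 pval1 !oppr_eq0 oner_neq0 => /(_ isT isT); lia.
    apply: WN; elim/big_ind: _ => [|a b|i _]; [by left|exact: WD|].
    have [->|fi0] := eqVneq f`_i 0; first by left; rewrite !mul0r.
    right; split; first by rewrite !mulf_neq0 ?invr_neq0 ?expf_neq0.
    have vfi : 0 <= pval P f`_i by apply: loc_pval => //; apply: (polyOverP fO).
    rewrite pval_div ?mulf_neq0 ?expf_neq0 // pvalM ?expf_neq0 // !pvalX //.
    have lin : (i < n)%N by [].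
    move: (pval P f`_i) (pval P x) (nat_of_ord i) vfi vx lin => B A m B0 A0 lin.
    rewrite -(mulr_natr A m) -(mulr_natr A n) !natz.
    by move: lin; generalize n => k lin; clear -A0 B0 lin; nia.
  by case=> [/eqP|[_]]; rewrite ?oner_eq0 // pval1.
- exists 'X; split; [exact: monicX|exact: polyOverX|by rewrite rootX].
- have [->|x0] := eqVneq x 0.
    by exists 'X; split; [exact: monicX|exact: polyOverX|by rewrite rootX].
  have [a [t [aR tO Pt xE]]] := common_denominator x0 vx.
  have [t0 _] := prime_nmem pP (O_R tO) Pt.
  have [i [j [ij cij]]] := power_cgr O aR.
  set c := a ^+ j - a ^+ i in cij.
  have tX k : ~ ival P (t ^+ k) by apply: nmem_prime_exp => //; exact: O_R tO.
  pose g := ((t ^+ (j - i))^-1 *: 'X^i + (c / t ^+ j)%:P : {poly K}).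
  have gO : g \is a polyOver (localization p).
    apply: rpredD.
      apply/polyOverP => k; rewrite coefZ coefXn; apply: rpredM; last exact: rpred_nat.
      by apply/locP; exists 1, (t ^+ (j - i)); rewrite rpred1 rpredX // div1r.
    rewrite polyOverC; apply/locP; exists c, (t ^+ j).
    by split; [exact: cond_O cij|exact: rpredX|exact: tX|].
  have szg : (size g <= j)%N.
    rewrite (leq_trans (size_polyD _ _)) // geq_max (leq_trans (size_scale_leq _ _)) ?size_polyXn //.
    by rewrite (leq_trans (size_polyC_leq1 _)) //; apply: leq_ltn_trans ij.
  exists ('X^j - g); split.
  + by rewrite monicE lead_coefDl ?size_polyN ?size_polyXn ?ltnS // lead_coefXn.
  + by rewrite rpredB // rpredX ?polyOverX.
  + rewrite rootE !hornerE xE !expr_div_n.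
    have -> : t ^+ j = t ^+ (j - i) * t ^+ i by rewrite -exprD subnK // ltnW.
    apply/eqP; rewrite /c; field.
    by rewrite !expf_neq0.
Qed.

Lemma ring_unit_loc x : x != 0 -> ring_unit (intclosure (localization p)) x <-> pval P x = 0.
Proof.
move=> x0; split=> [[_ /intclosure_loc vx /intclosure_loc vxV]|vx].
  case: vx vxV => [e|vx]; first by rewrite e eqxx in x0.
  by case=> [/eqP|]; rewrite ?invr_eq0 ?(negPf x0) // pvalV //; lia.
split=> //; apply/intclosure_loc; right; rewrite ?pvalV ?vx //.
Qed.

Lemma nonunit_loc x : (intclosure (localization p) x /\ ~ ring_unit (intclosure (localization p)) x)
  <-> x = 0 \/ (x != 0 /\ 1 <= pval P x).
Proof.
have [->|x0] := eqVneq x 0.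
  split=> _; first by left.
  by split; [apply/intclosure_loc; left|case; rewrite eqxx].
have := ring_unit_loc x0; have := intclosure_loc x; move=> V U; split.
  move=> [/V[/eqP|vx]]; first by rewrite (negPf x0).
  move=> nu; right; split=> //; have : pval P x <> 0 by move/U.
  by move: vx; lia.
case=> [/eqP|[_ vx]]; first by rewrite (negPf x0).
split; first by apply/V; right; lia.
by move/U => e; rewrite e in vx.
Qed.

Lemma uniformizer_pval x : is_uniformizer (intclosure (localization p)) x <-> x != 0 /\ pval P x = 1.
Proof.
split=> [[x0 e]|[x0 vx]].
  split=> //; have [z [[zR z0] vz]] := pval1_ex pP.
  have mem y : (y = 0 \/ (y != 0 /\ 1 <= pval P y)) <->
      exists2 w, intclosure (localization p) w & x * w = y.
    by have := congr1 (fun A : set K => A y) e; rewrite /= => <-; exact: (iff_sym (nonunit_loc y)).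
  have [w /intclosure_loc vw xw] : exists2 w, intclosure (localization p) w & x * w = z.
    by apply/mem; right; rewrite vz.
  have w0 : w != 0 by apply: contraNneq z0 => w0; rewrite -xw w0 mulr0.
  have {}vw : 0 <= pval P w by case: vw => [w0'|//]; rewrite w0' eqxx in w0.
  have : pval P x + pval P w = 1 by rewrite -pvalM // xw.
  have [|/eqP|[_ vx1]] := proj2 (mem x) _.
  - by exists 1; rewrite ?mulr1 //; apply/intclosure_loc; right; rewrite pval1.
  - by rewrite (negPf x0).
  - by move: vw vx1; lia.
split=> //; apply/seteqP; split=> y /=.
  move/nonunit_loc => vy; exists (y / x); last by rewrite mulrC divfK.
  apply/intclosure_loc; case: vy => [->|[y0 vy]]; first by left; rewrite mul0r.
  by right; rewrite pval_div // vx; lia.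
move=> [w /intclosure_loc vw <-]; apply/nonunit_loc.
have [->|w0] := eqVneq w 0; first by left; rewrite mulr0.
case: vw => [/eqP|vw]; first by rewrite (negPf w0).
by right; rewrite mulf_neq0 // pvalM // vx; split=> //; lia.
Qed.

Lemma vp_pval x : x != 0 -> vp p x = pval P x.
Proof.
move=> x0; rewrite /vp /dvr_val; have [z [[zR z0] vz]] := pval1_ex pP.
have z1 : is_uniformizer (intclosure (localization p)) z by apply/uniformizer_pval.
case: xgetP => [m _ [pi [e [/uniformizer_pval[pi0 vpi] ue xE]]]|/(_ (pval P x)) H].
  have [e0 _ _] := ue; move/ring_unit_loc: ue => /(_ e0) ve.
  by rewrite xE pvalM // ?expfz_neq0 // ve add0r pval_exprz // vpi mul1r.
case: H; exists z, (x / z ^ pval P x).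
have zx0 : z ^ pval P x != 0 by rewrite expfz_neq0.
split=> //; last by rewrite divfK.
apply/ring_unit_loc; first by rewrite mulf_neq0 ?invr_neq0.
by rewrite pval_div // pval_exprz // vz mul1r subrr.
Qed.

Lemma atom_pval_gt0 (u : dot (localization p)) : atom u -> 1 <= pval P (dotval u).
Proof.
move=> [nu _]; have [uL u0] : nz (localization p) (dotval u) := dot_nz u.
have : pval P (dotval u) <> 0 by move/munit_pval.
by move=> /eqP nz; rewrite -gtz0_ge1 lt_neqAle eq_sym nz loc_pval.
Qed.

Lemma atom_factor (u : dot (localization p)) x : atom u -> nz (localization p) x ->
  dotval u / x \in localization p -> 1 <= pval P x -> pval P (dotval u) = pval P x.
Proof.
move=> [nu H] xL uxL vx; have [_ u0] : nz (localization p) (dotval u) := dot_nz u.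
have [xL' x0] := xL.
have yL : nz (localization p) (dotval u / x) by split=> //; rewrite mulf_neq0 ?invr_neq0.
have [|/munit_pval|/munit_pval] := H (mkdot xL) (mkdot yL).
- by apply/val_inj; rewrite /= mulrC divfK.
- by move=> /= e; rewrite e in vx.
- by rewrite /= pval_div // => /eqP; rewrite subr_eq0 => /eqP.
Qed.

Lemma local_divisor_loc x v : nz O v -> local_divisor O P x v -> x / v \in localization p.
Proof.
move=> [vO v0] [s [w [sO Ps wO e]]]; apply/locP; exists w, s; split=> //.
have [s0 _] := prime_nmem pP (O_R sO) Ps.
apply: (mulfI (mulf_neq0 s0 v0)); have -> : s * v * (x / v) = s * x by field.
by rewrite e; field.
Qed.

Lemma atom_local_divisor (u : dot (localization p)) x s v : atom u -> nz O x -> s \in O -> ~ ival P s ->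
  dotval u = x / s -> nz O v -> local_divisor O P x v -> 1 <= pval P v ->
  pval P (dotval u) = pval P v.
Proof.
move=> au [xO x0] sO Ps uE vO dv vv; apply: atom_factor => //.
  by case: vO => vO v0; split=> //; exact: loc_O.
have := local_divisor_loc vO dv; rewrite uE.
have [s0 _] := prime_nmem pP (O_R sO) Ps.
have -> : x / s / v = x / v / s by rewrite mulrAC.
move=> xv; apply: rpredM => //; apply/locP; exists 1, s; rewrite rpred1 div1r; split=> //.
Qed.

Lemma dot_loc_frac (u : dot (localization p)) : exists x s,
  [/\ nz O x, s \in O, ~ ival P s, dotval u = x / s & pval P x = pval P (dotval u)].
Proof.
have [/locP[x [s [xO sO Ps uE]]] u0] : nz (localization p) (dotval u) := dot_nz u.
have [s0 vs] := prime_nmem pP (O_R sO) Ps.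
have x0 : x != 0 by apply: contraNneq u0 => x0; rewrite uE x0 mul0r.
by exists x, s; split=> //; rewrite uE pval_div // vs subr0.
Qed.

Lemma not_above_atom (u : dot (localization p)) : ~ above O P -> atom u -> pval P (dotval u) = 1.
Proof.
move=> nP au; have [f [cf Pf]] : exists f, cond O f /\ ~ ival P f.
  apply: contrapT => H; apply: nP; split=> // x cx; apply: contrapT => Px; apply: H.
  by exists x.
have fR := cond_R cf; have [f0 vf] := prime_nmem pP fR Pf.
have [z [[zR z0] vz]] := pval1_ex pP.
have fzO : f * z \in O by case: cf => _; exact.
have fz0 : f * z != 0 by rewrite mulf_neq0.
have vfz : pval P (f * z) = 1 by rewrite pvalM // vf vz.
rewrite -vfz; apply: atom_factor => //; [split=> //; exact: loc_O| |by rewrite vfz].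
have [uL u0] : nz (localization p) (dotval u) := dot_nz u.
have u1 := atom_pval_gt0 au.
have [||a [s [aR sO Ps e]]] := @common_denominator (dotval u / (f * z)).
- by rewrite mulf_neq0 ?invr_neq0.
- by rewrite pval_div // vfz subr_ge0.
rewrite e; apply/locP; exists (f * a), (f * s); split.
- by case: cf => _; exact.
- by rewrite rpredM //; exact: cond_O cf.
- by apply: nmem_prime_mul => //; exact: O_R sO.
- by have [s0 _] := prime_nmem pP (O_R sO) Ps; field; rewrite s0 f0.
Qed.

Lemma atom_divisor (u : dot (localization p)) : 1 <= pval P (dotval u) ->
  exists a w : dot (localization p), atom a /\ u = (a * w)%g.
Proof.
have [n] := ubnP (absz (pval P (dotval u))); elim: n u => // n IH u un u1.
have [au|nau] := pselect (atom u).
  by exists u, 1%g; rewrite mulg1.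
have nu : ~ munit u by move/munit_pval => e; rewrite e in u1.
have [v [w [uE nv nw]]] : exists v w : dot (localization p), [/\ u = (v * w)%g, ~ munit v & ~ munit w].
  apply: contrapT => H; apply: nau; split=> // v w uE.
  have [|nv] := pselect (munit v); first by left.
  by right; apply: contrapT => nw; apply: H; exists v, w.
have [vL v0] : nz (localization p) (dotval v) := dot_nz v.
have [wL w0] : nz (localization p) (dotval w) := dot_nz w.
have v1 : pval P (dotval v) <> 0 by move/munit_pval.
have w1 : pval P (dotval w) <> 0 by move/munit_pval.
have vge := loc_pval vL v0; have wge := loc_pval wL w0.
have uvw : pval P (dotval u) = pval P (dotval v) + pval P (dotval w) by rewrite uE /= pvalM.
have [||a [b [aa vE]]] := IH v.
- move: un vge wge v1 w1; rewrite uvw.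
  by move: (pval P (dotval v)) (pval P (dotval w)) => A B; clear; lia.
- by move: vge v1; move: (pval P (dotval v)) => A; clear; lia.
by exists a, (b * w)%g; rewrite mulgA -vE.
Qed.

Lemma local_atom_divisor x : nz O x -> 1 <= pval P x -> exists (a : dot (localization p)) v,
  [/\ atom a, nz O v, pval P v = pval P (dotval a) & local_divisor O P x v].
Proof.
move=> [xO x0] vx; have xL : nz (localization p) x by split=> //; exact: loc_O.
have [a [w [aa xE]]] := @atom_divisor (mkdot xL) vx.
have [v [s [vO sO Ps aE va]]] := dot_loc_frac a.
have [b [t [bO tO Pt wE vb]]] := dot_loc_frac w.
exists a, v; split=> //; exists (s * t), b; split; [exact: rpredM| |by case: bO|].
  by apply: nmem_prime_mul => //; [exact: O_R sO|exact: O_R tO].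
have [s0 _] := prime_nmem pP (O_R sO) Ps; have [t0 _] := prime_nmem pP (O_R tO) Pt.
by have := congr1 val xE; rewrite /= => ->; rewrite aE wE; field; rewrite s0 t0.
Qed.

End Over.

Lemma zero_spec_atom (p : spec O) (u : dot (localization p)) : ~ nonzero (prime_set p) -> ~ atom u.
Proof.
move=> np [nu _]; apply: nu.
have [uL u0] : nz (localization p) (dotval u) := dot_nz u.
have uV : nz (localization p) (dotval u)^-1.
  split; last by rewrite invr_neq0.
  move/asboolP: uL => [a [s [aO sO ps ue]]]; apply/asboolP; exists s, a; rewrite ue invf_div.
  split=> // pa; apply: np; exists a => //.
  by apply: contraNneq u0 => a0; rewrite ue a0 mul0r.
by exists (mkdot uV); apply/val_inj; rewrite /= divff.
Qed.

Lemma contraction_spec P : prime_ideal P -> exists p : spec O, over p P.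
Proof.
move=> pP; have [[sP PR] P1 PM] := pP.
have pp : is_prime O [set x | x \in O /\ ival P x].
  split; [split; [split|]| |].
  - by split; [exact: rpred0|exact: (sub0 sP)].
  - by move=> x y [xO Px] [yO Py]; split; [exact: rpredD|exact: (subD sP)].
  - move=> a x aO [xO Px]; split; first exact: rpredM.
    by apply: (subM sP) => //; exact: O_R aO.
  - by move=> x [].
  - by move=> [_ /P1].
  - move=> x y xO yO [_ /(PM _ _ (O_R xO) (O_R yO))[Px|Py]]; by [left|right].
by exists (Spec pp); split=> // a aO; split=> [Pa|[]].
Qed.

End Localizations.

Lemma qinj_frac (H : cmonoidType) (c x y : H) : (qinj c * qfrac x y)%g = qfrac (c * x)%g y.
Proof. by rewrite [LHS]qmulE mul1g. Qed.

Lemma qfracX (H : cmonoidType) (x y : H) n : (qfrac x y ^+ n)%g = qfrac (x ^+ n)%g (y ^+ n)%g.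
Proof. by elim: n => [|n IH] //; rewrite !expgS IH; exact: qmulE. Qed.

(** * Transfer homomorphisms *)

Section KrullDedekind.
Variables (K : fieldType) (R : dedDomain K).
Implicit Types (x y c : K).

Lemma range_qinj_frac (r s : dot R) : range (@qinj (dot R)) (qfrac r s) <-> dotval r / dotval s \in R.
Proof.
have [rR r0] := dot_nz r; have [sR s0] := dot_nz s.
split=> [[t _ /qfracP /(congr1 val)/=]|rs].
  rewrite mulr1 => <-; rewrite mulfK //; by have [] := dot_nz t.
have rsN : nz R (dotval r / dotval s) by split; rewrite ?mulf_neq0 ?invr_neq0.
exists (mkdot rsN) => //; apply/qfracP; apply/val_inj => /=.
by rewrite mulr1 divfK.
Qed.

Lemma krull_dot : krull (dot R).
Proof.
split.
  move=> q; have [r [s ->]] := qgroupP q => -[c H]; apply/range_qinj_frac.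
  have [cR c0] := dot_nz c; have [rR r0] := dot_nz r; have [sR s0] := dot_nz s.
  apply: (dedekind_cic (ded_ded R) c0) => n.
  have := H n; rewrite qfracX qinj_frac => /range_qinj_frac /=.
  by rewrite !dot_expE expr_div_n mulrA.
move=> I vI mono.
pose J n : set K := [set x | x = 0 \/ exists r : dot R, dotval r = x /\ I n (qinj r)].
have mem n (r : dot R) : I n (qinj r) <-> forall a b : dot R,
    qdual (I n) (qfrac a b) -> dotval r * dotval a / dotval b \in R.
  have [_ dd] := vI n; rewrite -{1}dd; split=> [H a b /H|H p].
    by rewrite qinj_frac => /range_qinj_frac.
  have [a [b ->]] := qgroupP p => /H.
  by move=> rab; rewrite qinj_frac; exact/range_qinj_frac.
have idJ n : is_ideal R (J n).
  split; last by move=> x [->|[r [<- _]]] /=; [exact: rpred0|have [] := dot_nz r].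
  split.
  - by left.
  - move=> x y [->|[r [<- Ir]]]; first by rewrite add0r.
    move=> [->|[s [<- Is]]]; first by rewrite addr0; right; exists r.
    have [rR r0] := dot_nz r; have [sR s0] := dot_nz s.
    have [->|rs0] := eqVneq (dotval r + dotval s) 0; [by left|right].
    have rsN : nz R (dotval r + dotval s) by split; rewrite ?rpredD.
    exists (mkdot rsN); split=> //; apply/mem => a b Hab /=.
    by rewrite !mulrDl rpredD //; [move/mem: Ir; apply|move/mem: Is; apply].
  - move=> a x aR [->|[r [<- Ir]]]; first by left; rewrite mulr0.
    have [rR r0] := dot_nz r.
    have [->|a0] := eqVneq a 0; [by left; rewrite mul0r|right].
    have arN : nz R (a * dotval r) by split; rewrite ?rpredM ?mulf_neq0.
    exists (mkdot arN); split=> //; apply/mem => b c Hbc /=.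
    by rewrite -!mulrA rpredM // mulrA; move/mem: Ir; apply.
have Jmono m n : (m <= n)%N -> I m `<=` I n.
  move=> /subnK <-; elim: (n - m)%N => [//|k IH]; rewrite addSn.
  exact: subset_trans IH (mono _).
have noeR : noetherian R by case: (ded_ded R).
have [||_ [[N _ <-] maxN]] := @noetherian_max _ R (range J) noeR.
- by exists (J 0%N); exists 0%N.
- by move=> _ [n _ <-].
exists N => n Nn.
have JE : J n = J N.
  apply: maxN; first by exists n.
  by move=> x [->|[r [<- Ir]]]; [left|right; exists r; split=> //; exact: (Jmono _ _ Nn)].
apply/seteqP; split; last exact: Jmono.
move=> q Iq; have [sub _] := vI n; have [r _ rq] := sub _ Iq.
have : J n (dotval r) by right; exists r; rewrite rq.
rewrite JE => -[r0|[s [sr Is]]]; first by have [_] := dot_nz r; rewrite r0 eqxx.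
by rewrite -rq; have <- : s = r by apply/val_inj.
Qed.

End KrullDedekind.

(* The additive monoid of nat in multiplicative notation; an alias keeps the
   instances off nat itself. *)
Definition natm := nat.
HB.instance Definition _ := Choice.on natm.
HB.instance Definition _ := isMonoid.Build natm addnA add0n addn0.
Fact natm_inj : right_injective addn. Proof. exact: addnI. Qed.
HB.instance Definition _ := Monoid_isCancelCom.Build natm addnC natm_inj.

Lemma munit_natm (n : natm) : munit n <-> n = 0%N.
Proof.
split=> [[m]|->]; last by exists 0%N.
by move/eqP; rewrite -[(n * m)%g]/(n + m)%N addn_eq0 => /andP[/eqP].
Qed.

Lemma range_natm (a b : natm) : range (@qinj natm) (qfrac a b) <-> (b <= a)%N.
Proof.
split=> [[t _ /qfracP e]|ba].
  have {}e : (t + b)%N = (a + 0)%N by exact: e.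
  by rewrite addn0 in e; rewrite -e; exact: leq_addl.
exists (a - b)%N => //; apply/qfracP.
by rewrite -[LHS]/(a - b + b)%N -[RHS]/(a + 0)%N subnK // addn0.
Qed.

Lemma krull_natm : krull natm.
Proof.
split.
  move=> q; have [a [b ->]] := qgroupP q => -[c H]; apply/range_natm.
  have nX n (x : natm) : (x ^+ n)%g = (n * x)%N.
    by elim: n => [|n IH] //; rewrite expgS IH mulSn.
  have := H c.+1; rewrite qfracX qinj_frac !nX => /range_natm.
  rewrite -[(c * _)%g]/(c + c.+1 * a)%N; clear; nia.
move=> I vI mono.
have Imono m n : (m <= n)%N -> I m `<=` I n.
  move=> /subnK <-; elim: (n - m)%N => [//|k IH]; rewrite addSn.
  exact: subset_trans IH (mono _).
have up n (a b : natm) : I n (qinj a) -> (a <= b)%N -> I n (qinj b).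
  have [_ dd] := vI n; rewrite -dd => Ha ab p; have [c [d ->]] := qgroupP p => /Ha.
  rewrite !qinj_frac => /range_natm le; apply/range_natm.
  apply: leq_trans le _; by rewrite leq_add2r.
have [[k0 [n0 Ik0]]|none] := pselect (exists (k : natm) n, I n (qinj k)); last first.
  exists 0%N => n _; apply/seteqP; split=> q Iq.
    by have [sub _] := vI n; have [r _ rq] := sub _ Iq; case: none; exists r, n; rewrite rq.
  by have [sub _] := vI 0%N; have [r _ rq] := sub _ Iq; case: none; exists r, 0%N; rewrite rq.
have exk : exists k : nat, `[< exists n, I n (@qinj natm k) >] by exists k0; apply/asboolP; exists n0.
case: (ex_minnP exk) => k /asboolP[N IN] mink.
exists N => n Nn; apply/seteqP; split; last exact: Imono.
move=> q Iq; have [sub _] := vI n; have [r _ rq] := sub _ Iq.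
rewrite -rq; apply: (up _ k) => //; apply: mink; apply/asboolP; exists n; by rewrite rq.
Qed.

Section Backward.
Variables (K : fieldType) (R : dedDomain K) (O : orderIn R).
Implicit Types (x y a b q r s t u v w : K) (I J P Q : invideal R).

Local Notation Prin := (@principal K R).
Local Notation Ord := (orderly O).

Hypothesis inj : inj_contraction O.
Hypothesis full : units_full O.

Lemma split_global u b : nz O u -> nz R b -> integral_ideal (pid R u - pid R b) ->
    (forall P, above O P -> exists v, [/\ nz O v, pval P v = pval P b & local_divisor O P u v]) ->
  exists v, [/\ nz O v, pid R v = pid R b & divides_in O u v].
Proof.
move=> [uO u0] [bR b0] iub loc.
have /choice[f fP] : forall P, exists v, above O P ->
    [/\ nz O v, pval P v = pval P b & local_divisor O P u v].
  by move=> P; have [/loc[v vP]|nP] := pselect (above O P); [exists v|exists 0].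
have [|g [gO g0 sg _]] := glue inj (above_seq_uniq O) (f := f).
  by move=> P /above_seqP aP; have [[]] := fP P aP.
have sim_g P : above O P -> sim O P (f P) g by move=> aP; apply: sg; exact/above_seqP.
have vg P : above O P -> pval P g = pval P b.
  move=> aP; have [[fO f0] vf _] := fP P aP.
  by have [_ ->] := sim_pval (proj1 aP) f0 (sim_g P aP).
have cI : coprimeI O (pid R b - pid R g).
  by move=> P /vg; rewrite /pval ordB => ->; rewrite subrr.
have /asboolP[c [d [[cO dO] [c0 d0] cc cd e]]] := full cI (rpredB (pid_prin _ b0) (pid_prin _ g0)).
pose v := g * c / d.
have v0 : v != 0 by rewrite !mulf_neq0 ?invr_neq0.
have vb : pid R v = pid R b.
  by rewrite pid_div ?mulf_neq0 // pidM // -addrA -e addrC subrK.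
have vR : v \in R by apply/pid_integral => //; rewrite vb; exact/pid_integral.
have dv : d * v = g * c by rewrite /v; field.
have vO : v \in O by apply: (division dO cd vR); rewrite dv rpredM.
exists v; split=> //; exists (u / v); last by field.
have uv0 : u / v != 0 by rewrite mulf_neq0 ?invr_neq0.
have uvR : u / v \in R by apply/pid_integral => //; rewrite pid_div // vb.
apply: (local_global inj uvR) => P aP; have [pP _] := aP.
have [[fO f0] _ [s [w [sO Ps wO sw]]]] := fP P aP.
have [s' [t' [s'O t'O Ps' Pt' st']]] := sim_g P aP.
have nm x y : x \in O -> y \in O -> ~ ival P x -> ~ ival P y -> ~ ival P (x * y).
  by move=> xO yO; apply: nmem_prime_mul => //; [exact: O_R xO|exact: O_R yO].
exists (s * t' * c); split; first by rewrite !rpredM.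
  by apply: (nm) => //; [exact: rpredM|apply: (nm)|exact: (cop_nmem aP)].
suff -> : s * t' * c * (u / v) = s' * w * d by rewrite !rpredM.
apply: (mulIf v0); rewrite -[LHS]mulrA divfK //.
have -> : s' * w * d * v = s' * w * (d * v) by ring.
rewrite dv; have -> : s' * w * (g * c) = s' * g * w * c by ring.
have -> : s * t' * c * u = t' * c * (s * u) by ring.
by rewrite st' sw; ring.
Qed.

Lemma local_splitting P u k : above O P -> nz O u ->
    (forall w, nz O w -> 1 <= pval P w -> exists v, [/\ nz O v, pval P v = 1 & local_divisor O P w v]) ->
    k%:Z <= pval P u -> exists v, [/\ nz O v, pval P v = k%:Z & local_divisor O P u v].
Proof.
move=> aP uO one; have [pP _] := aP; have [_ P1 _] := pP.
elim: k => [_|k IH ku].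
  exists 1; rewrite pval1; split=> //; first exact: nz1.
  by exists 1, u; rewrite rpred1 mul1r; split=> //; case: uO.
have [|v [vO vk [s [w [sO Ps wO e]]]]] := IH.
  by apply: le_trans ku; rewrite lez_nat.
have [s0 vs] := prime_nmem pP (O_R sO) Ps.
have [[uO' u0] [vO' v0]] := conj uO vO.
have w0 : w != 0.
  by apply: contraTneq (mulf_neq0 s0 u0) => w0; rewrite e w0 mulr0 eqxx.
have vw : 1 <= pval P w.
  have := congr1 (pval P) e; rewrite !pvalM // vs vk add0r => uE.
  by move: ku; rewrite uE; move: (pval P w) => z; clear; lia.
have [v' [v'O v'1 [t [w' [tO Pt w'O e']]]]] := one w (conj wO w0) vw.
have [_ v'0] := v'O.
exists (v * v'); split; first exact: nzM.
  by rewrite pvalM // vk v'1 -[k.+1%:Z]/(Posz k.+1); clear; lia.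
exists (t * s), w'; split=> //; [exact: rpredM| |].
  by apply: nmem_prime_mul => //; [exact: O_R tO|exact: O_R sO].
by rewrite -mulrA e mulrCA e' mulrA.
Qed.

Lemma unit_O_dot (u : dot O) : pid R (dotval u) = 0 <-> munit u.
Proof.
have [uO u0] := dot_nz u; split=> [/(pid_eq0 _ u0)[_ _ uV]|[v /(congr1 val)/= e]].
  have uN : nz O (dotval u)^-1 by split; [exact: unit_O|rewrite invr_neq0].
  by exists (mkdot uN); apply/val_inj; rewrite /= divff.
apply/pid_eq0 => //; split=> //; first exact: O_R uO.
have [vO _] := dot_nz v.
have -> : (dotval u)^-1 = dotval v by apply: (mulfI u0); rewrite divff.
exact: O_R vO.
Qed.

Section AtomsOne.
Hypothesis fu : factor_units O.
Hypothesis one : forall P w, above O P -> nz O w -> 1 <= pval P w ->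
  exists v, [/\ nz O v, pval P v = 1 & local_divisor O P w v].

Lemma split_one u b : nz O u -> nz R b -> integral_ideal (pid R u - pid R b) ->
  exists v, [/\ nz O v, pid R v = pid R b & divides_in O u v].
Proof.
move=> uO bR iub; apply: split_global => // P aP; have [bR' b0] := bR.
have vb := pval_ge0 P b0 bR'.
have [|v [vO vk dv]] := @local_splitting P u (absz (pval P b)) aP uO (fun w => one aP).
  by rewrite gez0_abs //; have := ord_ge0 P iub; rewrite ordB subr_ge0.
by exists v; rewrite gez0_abs // in vk.
Qed.

Lemma massoc_pid (D : dedDomain K) (x y : dot D) : pid D (dotval x) = pid D (dotval y) -> massoc x y.
Proof.
have [xD x0] := dot_nz x; have [yD y0] := dot_nz y.
move=> /(pid_inj x0 y0)[e0 eD eVD].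
have eN : nz D (dotval x / dotval y) by split.
have eVN : nz D (dotval x / dotval y)^-1 by split=> //; rewrite invr_neq0.
exists (mkdot eN); last by apply/val_inj; rewrite /= divfK.
by exists (mkdot eVN); apply/val_inj; rewrite /= divff.
Qed.

Lemma dot_incl_transfer (sub : {subset O <= R}) : transfer_hom (dot_incl sub).
Proof.
split.
- by split=> [|x y]; apply/val_inj.
- split.
    move=> b; have [bR b0] := dot_nz b; have /fu[a [e [aO ue be]]] := bR.
    have [e0 eR eVR] := ue.
    have a0 : a != 0 by apply: contraNneq b0 => a0; rewrite be a0 mul0r.
    exists (mkdot (conj aO a0)), (mkdot (conj eR e0)); split; last by apply/val_inj.
    by exists (mkdot (conj eVR (invr_neq0 e0))); apply/val_inj; rewrite /= divff.
  move=> u; rewrite -unit_O_dot; have [uO u0] := dot_nz u.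
  split=> [[v /(congr1 val)/= e]|/pid_eq0 -/(_ u0)[_ _ uV]].
    apply/pid_eq0 => //; split=> //; first exact: O_R uO.
    have [vR _] := dot_nz v.
    by have -> : (dotval u)^-1 = dotval v by apply: (mulfI u0); rewrite divff.
  by exists (mkdot (conj uV (invr_neq0 u0))); apply/val_inj; rewrite /= divff.
- move=> u b c /(congr1 val)/= e.
  have bN := dot_nz b; have [bR b0] := bN; have [cR c0] := dot_nz c.
  have [|v [vO vb [w wO uvw]]] := split_one (dot_nz u) bN.
    by rewrite e pidM // addrC addKr; apply/pid_integral.
  have [uO u0] := dot_nz u; have [_ v0] := vO.
  have w0 : w != 0 by apply: contraNneq u0 => w0; rewrite uvw w0 mulr0.
  exists (mkdot vO), (mkdot (conj wO w0)); split; first exact/val_inj.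
    by apply: massoc_pid.
  apply: massoc_pid => /=; apply: (addrI (pid R v)).
  by rewrite -pidM // -uvw e pidM // vb.
Qed.

End AtomsOne.

End Backward.

Lemma perm_map_lift (T1 T2 : eqType) (f : T1 -> T2) (s : seq T1) (t : seq T2) :
  perm_eq (map f s) t -> exists s', perm_eq s s' /\ map f s' = t.
Proof.
elim: t s => [|b t IH] s pr.
  by exists [::]; case: s pr => // x s /perm_size.
have /mapP[x xs bx] : b \in map f s by rewrite (perm_mem pr) mem_head.
have pr' := perm_to_rem xs.
have [|s' [ps' s't]] := IH (rem x s).
  by rewrite -(perm_cons b) -(permPr pr) perm_sym {1}bx -map_cons; exact: perm_map.
exists (x :: s'); split; last by rewrite /= s't bx.
by rewrite (permPl pr') perm_cons.
Qed.

Section PrimeFactors.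
Variables (K : fieldType) (R : dedDomain K).
Implicit Types (I J P Q : invideal R) (s t : seq (invideal R)).

Definition pfac I : seq (invideal R) := xget [::] [set s | primes_seq s /\ I = \sum_(P <- s) P].

Lemma pfacP I : integral_ideal I -> primes_seq (pfac I) /\ I = \sum_(P <- pfac I) P.
Proof.
rewrite /pfac; case: xgetP => [_ _ [] //|H] /integral_factor[s sP].
by have := H s sP.
Qed.

Lemma pfac_perm I s : primes_seq s -> I = \sum_(P <- s) P -> perm_eq (pfac I) s.
Proof.
move=> ps e; have [|p1 p2] := @pfacP I; first by rewrite e; exact: primes_integral.
by apply: factorization_uniq => //; rewrite -p2.
Qed.

Lemma pfacD I J : integral_ideal I -> integral_ideal J -> perm_eq (pfac (I + J)) (pfac I ++ pfac J).
Proof.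
move=> /pfacP[pI eI] /pfacP[pJ eJ]; apply: pfac_perm; first exact: primes_cat.
by rewrite big_cat /= -eI -eJ.
Qed.

Lemma pfac0 : pfac 0 = [::].
Proof. by apply/perm_nilP; apply: pfac_perm => //; rewrite big_nil. Qed.

Lemma pfac_prime P : prime_ideal P -> pfac P = [:: P].
Proof.
by move=> pP; apply/perm_small_eq => //; apply: pfac_perm; [exact: primes_seq1|rewrite big_seq1].
Qed.

Lemma mem_pfac I P : integral_ideal I -> prime_ideal P -> (P \in pfac I) = (1 <= ord P I).
Proof.
move=> iI pP; have [ps e] := pfacP iI.
by rewrite {2}e ord_primes // lez_nat -has_count has_pred1.
Qed.

End PrimeFactors.

Section BlockMonoid.
Variables (K : fieldType) (R : dedDomain K) (O : orderIn R).
Implicit Types (x y a b q r s t u v w : K) (I J P Q : invideal R).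
Hypothesis full : units_full O.
Hypothesis inj : inj_contraction O.
Hypothesis pe : primes_everywhere O.
Hypothesis one : forall P w, above O P -> nz O w -> 1 <= pval P w ->
  exists v, [/\ nz O v, pval P v = 1 & local_divisor O P w v].

Definition classes x : seq (Cl R) := map (@ideal_class K R) (pfac (pid R x)).

Lemma classesM x y : nz O x -> nz O y -> perm_eq (classes (x * y)) (classes x ++ classes y).
Proof.
move=> [xO x0] [yO y0]; rewrite /classes -map_cat pidM //; apply/perm_map/pfacD.
  by apply/pid_integral => //; exact: O_R xO.
by apply/pid_integral => //; exact: O_R yO.
Qed.

Lemma seq_mset_cat (T : choiceType) (s t : seq T) :
  seq_mset (s ++ t) = msetD (seq_mset s) (seq_mset t).
Proof. by apply/msetP => x; rewrite msetE2 !mset_seqE count_cat. Qed.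

Lemma msum_seq (G : zmodType) (s : seq G) : msum (seq_mset s) = \sum_(g <- s) g.
Proof. by apply: perm_big; exact: perm_eq_seq_mset. Qed.

Lemma block_sum (u : dot O) : msum (seq_mset (classes (dotval u))) == 0.
Proof.
have [uO u0] := dot_nz u; have uR := O_R uO.
have [_ e] := pfacP (proj2 (pid_integral _ u0) uR).
by rewrite msum_seq big_map -class_sum -e; apply/eqP/class_eq0/pid_prin.
Qed.

Definition block (u : dot O) : zerosum (Cl R) := ZeroSum (block_sum u).

Lemma block_transfer : transfer_hom block.
Proof.
split.
- split=> [|u v]; apply/val_inj => /=.
    by rewrite /classes pid1 pfac0 /=; apply/msetP => g; rewrite mset_seqE mset0E.
  by rewrite -seq_mset_cat; apply/eq_seq_msetP/classesM; exact: dot_nz.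
- split.
    move=> b; have /choice[g gP] := pe.
    pose s := map g (zseq b).
    have ps : primes_seq s by move=> P /mapP[c _ ->]; have [] := gP c.
    have sc : map (@ideal_class K R) s = zseq b.
      by rewrite -map_comp -[RHS]map_id; apply: eq_map => c /=; have [] := gP c.
    have pS : \sum_(P <- s) P \in @principal K R.
      apply/class_eq0; rewrite class_sum -(big_map (@ideal_class K R) xpredT id) sc.
      exact/eqP/zseqP.
    have cS : coprimeI O (\sum_(P <- s) P).
      move=> P aP; rewrite ord_primes //; apply/eqP; rewrite eqz_nat -leqn0 leqNgt -has_count has_pred1.
      by apply/negP => /mapP[c _ Pc]; have [_ na _] := gP c; apply: na; rewrite -Pc.
    have [x [xO x0 cx xE]] := orderly_gen (full cS pS) (primes_integral ps).
    exists (mkdot (conj xO x0)), 1%g; split; first by exists 1%g; rewrite mulg1.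
    rewrite mulg1; apply/val_inj => /=; rewrite -[LHS]seq_mset_id; apply/eq_seq_msetP.
    by rewrite /classes -sc perm_sym; apply/perm_map/pfac_perm => //; rewrite xE.
  move=> u; rewrite -unit_O_dot; have [uO u0] := dot_nz u; have uR := O_R uO.
  have iu : integral_ideal (pid R (dotval u)) by apply/pid_integral.
  split=> [[z /(congr1 val)/= e]|u1].
    have [_ ->] := pfacP iu.
    have : size (classes (dotval u)) = 0%N.
      have := congr1 (fun m : {mset Cl R}%mset => size (m : seq (Cl R))) e.
      rewrite enum_mset0 /= => /eqP.
      rewrite -[zseq z]seq_mset_id -seq_mset_cat (perm_size (perm_eq_seq_mset _)) size_cat addn_eq0.
      by move=> /andP[/eqP].
    by rewrite size_map; case: (pfac _) => // _; rewrite big_nil.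
  exists 1%g; rewrite mulg1; apply/val_inj => /=.
  by rewrite /classes u1 pfac0 /=; apply/msetP => g; rewrite mset_seqE mset0E.
- move=> u b c /(congr1 val)/= e; have [uO u0] := dot_nz u; have uR := O_R uO.
  have iu : integral_ideal (pid R (dotval u)) by apply/pid_integral.
  have [pu eu] := pfacP iu.
  have pr : perm_eq (classes (dotval u)) (zseq b ++ zseq c).
    by apply/eq_seq_msetP; rewrite e seq_mset_cat !seq_mset_id.
  have [s [ps sE]] := perm_map_lift pr.
  pose s1 := take (size (zseq b)) s; pose s2 := drop (size (zseq b)) s.
  have s12 : s = s1 ++ s2 by rewrite cat_take_drop.
  have s1b : map (@ideal_class K R) s1 = zseq b by rewrite map_take sE take_size_cat.
  have s2c : map (@ideal_class K R) s2 = zseq c by rewrite map_drop sE drop_size_cat.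
  have prs : primes_seq s by move=> P; rewrite -(perm_mem ps); exact: pu.
  have pr1 : primes_seq s1 by move=> P P1; apply: prs; rewrite s12 mem_cat P1.
  have pr2 : primes_seq s2 by move=> P P1; apply: prs; rewrite s12 mem_cat P1 orbT.
  have pS : \sum_(P <- s1) P \in @principal K R.
    apply/class_eq0; rewrite class_sum -(big_map (@ideal_class K R) xpredT id) s1b.
    exact/eqP/zseqP.
  have [r r0 rE] := prinP pS.
  have rR : nz R r by split=> //; apply/pid_integral => //; rewrite -rE; exact: primes_integral.
  have uE : pid R (dotval u) = pid R r + \sum_(P <- s2) P.
    by rewrite eu (perm_big _ ps) s12 big_cat /= rE.
  have [|v [vO vE [w wO uvw]]] := split_one inj full one (dot_nz u) rR.
    by rewrite uE addrC addKr; exact: primes_integral.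
  have [_ v0] := vO.
  have w0 : w != 0 by apply: contraNneq u0 => w0; rewrite uvw w0 mulr0.
  have wE : pid R w = \sum_(P <- s2) P.
    by apply: (addrI (pid R v)); rewrite -pidM // -uvw uE vE.
  have arefl (z z' : zerosum (Cl R)) : z = z' -> massoc z z'.
    by move=> ->; exists 1%g; rewrite ?mul1g //; exists 1%g; rewrite mulg1.
  exists (mkdot vO), (mkdot (conj wO w0)); split; first exact/val_inj.
    apply: arefl; apply/val_inj => /=; rewrite -[RHS]seq_mset_id; apply/eq_seq_msetP.
    by rewrite /classes vE -s1b; apply/perm_map/pfac_perm.
  apply: arefl; apply/val_inj => /=; rewrite -[RHS]seq_mset_id; apply/eq_seq_msetP.
  by rewrite /classes wE -s2c; apply/perm_map/pfac_perm.
Qed.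

End BlockMonoid.

Section HalfFactorial.
Variables (K : fieldType) (R : dedDomain K) (O : orderIn R).
Implicit Types (x y a b q r s t u v w : K) (I J P Q : invideal R).
Hypothesis full : units_full O.
Hypothesis inj : inj_contraction O.
Hypothesis pe : primes_everywhere O.
Hypothesis two : forall a b : Cl R, a != 0 -> b != 0 -> a = b.
Hypothesis one_or_two : forall P w, above O P -> nz O w -> 1 <= pval P w ->
  exists v, [/\ nz O v, pval P v = 1 \/ pval P v = 2 & local_divisor O P w v].
Hypothesis prin_one : forall P w, above O P -> P \in @principal K R -> nz O w -> 1 <= pval P w ->
  exists v, [/\ nz O v, pval P v = 1 & local_divisor O P w v].

Local Notation Prin := (@principal K R).

(* Twice the length of any factorization: a principal prime is an atom of R, and
   the other atoms of R are products of two nonprincipal primes. *)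
Definition weight I : nat := \sum_(P <- pfac I) (if P \in Prin then 2 else 1).

Lemma weightD I J : integral_ideal I -> integral_ideal J -> weight (I + J) = (weight I + weight J)%N.
Proof. by move=> iI iJ; rewrite /weight (perm_big _ (pfacD iI iJ)) big_cat. Qed.

Lemma weight_prime P : prime_ideal P -> weight P = if P \in Prin then 2 else 1.
Proof. by move=> pP; rewrite /weight pfac_prime // big_seq1. Qed.

Lemma weightM x y : nz R x -> nz R y -> weight (pid R (x * y)) = (weight (pid R x) + weight (pid R y))%N.
Proof. by move=> [xR x0] [yR y0]; rewrite pidM // weightD //; exact/pid_integral. Qed.

Lemma addcc (a : Cl R) : a + a = 0.
Proof.
have [->|a0] := eqVneq a 0; first by rewrite addr0.
have [//|aa0] := eqVneq (a + a) 0; have := two aa0 a0.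
by move=> /(congr1 (fun z => z - a)); rewrite addrK subrr => e; rewrite e eqxx in a0.
Qed.

Lemma nonprin_pair P Q : P \notin Prin -> Q \notin Prin -> P + Q \in Prin.
Proof.
move=> nP nQ; apply/class_eq0; rewrite classD.
rewrite (two (a := ideal_class P) (b := ideal_class Q)) ?addcc //.
  by apply/eqP => /class_eq0 e; rewrite e in nP.
by apply/eqP => /class_eq0 e; rewrite e in nQ.
Qed.

Lemma weight_even I : integral_ideal I -> I \in Prin -> ~~ odd (weight I).
Proof.
move=> iI pI; rewrite /weight; have [_ e] := pfacP iI.
move: pI; rewrite {1}e => /class_eq0; rewrite class_sum => s0.
suff -> : odd (\sum_(P <- pfac I) (if P \in Prin then 2 else 1)) =
    (\sum_(P <- pfac I) ideal_class P != 0) by rewrite s0 eqxx.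
elim: (pfac I) {s0} => [|P s IH]; first by rewrite !big_nil eqxx.
rewrite !big_cons oddD IH; have [PP|nP] := boolP (P \in Prin).
  by have /class_eq0 -> := PP; rewrite add0r.
have cP : ideal_class P != 0 by apply/eqP => /class_eq0 e'; rewrite e' in nP.
have [->|c0] := eqVneq (\sum_(Q <- s) ideal_class Q) 0; first by rewrite addr0 cP.
by rewrite (two c0 cP) addcc eqxx.
Qed.

Lemma weight_eq0 I : integral_ideal I -> weight I = 0%N -> I = 0.
Proof.
move=> iI; have [_ {2}->] := pfacP iI; rewrite /weight.
by case: (pfac I) => [|P s]; rewrite ?big_nil // big_cons; case: ifP.
Qed.

Lemma local_divisor1 P u : prime_ideal P -> nz O u -> local_divisor O P u 1.
Proof. by move=> [_ P1 _] [uO _]; exists 1, u; rewrite rpred1. Qed.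

Lemma local_divisor_self P u : prime_ideal P -> local_divisor O P u u.
Proof. by move=> [_ P1 _]; exists 1, 1; rewrite rpred1 mulrC. Qed.

Lemma split_ideal w J : nz O w -> integral_ideal J -> J \in Prin -> integral_ideal (pid R w - J) ->
    weight J = 2%N -> (forall P, above O P -> exists v, [/\ nz O v, pval P v = ord P J & local_divisor O P w v]) ->
  exists v, [/\ nz O v, weight (pid R v) = 2%N & divides_in O w v].
Proof.
move=> wO iJ /prinP[b b0 bE]; rewrite bE in iJ *; move=> iwJ J2 loc.
have bR : nz R b by split=> //; apply/pid_integral.
have [v [vO vE dv]] := split_global inj full wO bR iwJ loc.
by exists v; rewrite vE.
Qed.

Lemma half_step w : nz O w -> (0 < weight (pid R w))%N ->
  exists v, [/\ nz O v, weight (pid R v) = 2%N & divides_in O w v].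
Proof.
move=> wO w_gt0; have [wO' w0] := wO; have wR := O_R wO'.
have iw : integral_ideal (pid R w) by apply/pid_integral.
have wP : pid R w \in Prin by apply: pid_prin.
have [ps e] := pfacP iw.
have ordw P : ord P (pid R w) = (count_mem P (pfac (pid R w)))%:Z by rewrite {1}e ord_primes.
have sub P : prime_ideal P -> 1 <= ord P (pid R w) -> integral_ideal (pid R w - P).
  by move=> pP oP; apply/leI/le_prime.
have [[P [Ps PP]]|noP] := pselect (exists P, P \in pfac (pid R w) /\ P \in Prin).
  have pP := ps P Ps; have oP : 1 <= ord P (pid R w) by rewrite -mem_pfac.
  apply: (@split_ideal w P) => //; [exact: prime_integral|exact: sub|by rewrite weight_prime // PP|].
  move=> Q aQ; rewrite ord_prime //; have [PQ|PQ] := eqVneq P Q.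
    by subst Q; exact: prin_one.
  exists 1; split; [exact: nz1|by rewrite pval1|apply: local_divisor1 => //; exact: (proj1 aQ)].
have np P : P \in pfac (pid R w) -> P \notin Prin.
  by move=> Ps; apply/negP => PP; apply: noP; exists P.
have [[P [aP P2]]|no2] := pselect (exists P, above O P /\ 2 <= ord P (pid R w)).
  have [pP _] := aP; have oP : 1 <= ord P (pid R w) by apply: le_trans P2.
  have nP : P \notin Prin by apply: np; rewrite mem_pfac.
  apply: (@split_ideal w (P + P)) => //.
  - by apply: integralD; exact: prime_integral.
  - exact: nonprin_pair.
  - apply/integralP => Q pQ; rewrite ordB ordD (ord_prime _ pP).
    have [PQ|_] := eqVneq P Q; first by rewrite -PQ subr_ge0.
    by rewrite subr_ge0; exact: ord_ge0.
  - by rewrite weightD ?weight_prime ?(negPf nP) //; exact: prime_integral.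
  move=> Q aQ; rewrite ordD ord_prime //; have [PQ|PQ] := eqVneq P Q; last first.
    exists 1; split; [exact: nz1|by rewrite pval1|apply: local_divisor1 => //; exact: (proj1 aQ)].
  subst Q.
  have [v [vO v12 dv]] := one_or_two aP wO oP; case: v12 => vv; last by exists v.
  have [s [w' [sO Ps w'O e']]] := dv.
  have [s0 vs] := prime_nmem pP (O_R sO) Ps; have [_ v0] := vO.
  have w'0 : w' != 0.
    by apply: contraTneq (mulf_neq0 s0 w0) => w'0; rewrite e' w'0 mulr0 eqxx.
  have vw' : 1 <= pval P w'.
    have := congr1 (pval P) e'; rewrite !pvalM // vs vv add0r => wE.
    by move: P2; rewrite -/(pval P w) wE; move: (pval P w') => z; clear; lia.
  have [v' [v'O v'12 [t [w'' [tO Pt w''O e'']]]]] := one_or_two aP (conj w'O w'0) vw'.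
  have [_ v'0] := v'O.
  have Pts : ~ ival P (t * s) by apply: nmem_prime_mul => //; [exact: O_R tO|exact: O_R sO].
  case: v'12 => vv'.
    exists (v * v'); split; [exact: nzM|by rewrite pvalM // vv vv'|].
    exists (t * s), w''; split=> //; first exact: rpredM.
    by rewrite -mulrA e' mulrCA e'' mulrA.
  exists v'; split=> //; exists (t * s), (v * w''); split=> //; first exact: rpredM.
    by apply: rpredM => //; case: vO.
  by rewrite -mulrA e' mulrCA e'' mulrCA.
have ev := weight_even iw wP.
have wsz : weight (pid R w) = size (pfac (pid R w)).
  rewrite /weight big_seq (eq_bigr (fun=> 1%N)); last by move=> P /np/negPf ->.
  by rewrite -big_seq sum1_size.
case E : (pfac (pid R w)) => [|P [|Q s]]; [by rewrite wsz E in w_gt0|by rewrite wsz E in ev|].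
have Pm : P \in pfac (pid R w) by rewrite E mem_head.
have Qm : Q \in pfac (pid R w) by rewrite E !inE eqxx orbT.
have pP := ps P Pm; have pQ := ps Q Qm; have nP := np P Pm; have nQ := np Q Qm.
have iwPQ : integral_ideal (pid R w - (P + Q)).
  have -> : pid R w - (P + Q) = \sum_(A <- s) A.
    by rewrite e E !big_cons (addrA P Q) (addrC (P + Q)) addrK.
  by apply: primes_integral => A As; apply: ps; rewrite E !inE As !orbT.
apply: (@split_ideal w (P + Q)) => //.
- by apply: integralD; exact: prime_integral.
- exact: nonprin_pair.
- by rewrite weightD ?weight_prime ?(negPf nP) ?(negPf nQ) //; exact: prime_integral.
move=> A aA; have [pA _] := aA.
have A1 : ord A (pid R w) <= 1.
  by rewrite leNgt; apply/negP => lt; apply: no2; exists A.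
have := ord_ge0 A iwPQ; rewrite ordB subr_ge0 => PQw.
have : 0 <= ord A (P + Q) by apply: ord_ge0; apply: integralD; exact: prime_integral.
rewrite le_eqVlt => /orP[/eqP <-|gt0].
  by exists 1; split; [exact: nz1|rewrite pval1|exact: local_divisor1].
exists w; split=> //; last exact: local_divisor_self.
by apply/eqP; rewrite eq_le PQw andbT (le_trans A1).
Qed.

Lemma half_split k u : nz O u -> (k.*2 <= weight (pid R u))%N ->
  exists v, [/\ nz O v, weight (pid R v) = k.*2 & divides_in O u v].
Proof.
move=> uO; elim: k => [_|k IH ku].
  exists 1; rewrite pid1 /weight pfac0 big_nil; split=> //; first exact: nz1.
  by exists u; rewrite ?mul1r //; case: uO.
have [|v [vO vk [w wO uvw]]] := IH; first by apply: leq_trans ku; rewrite leq_double.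
have [_ u0] := uO; have [_ v0] := vO.
have w0 : w != 0 by apply: contraNneq u0 => w0; rewrite uvw w0 mulr0.
have wN : nz O w by [].
have [|v' [v'O v'2 [w' w'O wE]]] := @half_step w wN.
  move: ku; rewrite uvw weightM ?vk; [|exact: nz_R vO|exact: nz_R wN].
  by rewrite doubleS; lia.
exists (v * v'); split; first exact: nzM.
  by rewrite weightM ?vk ?v'2 ?doubleS ?addn2 //; [exact: nz_R vO|exact: nz_R v'O].
by exists w' => //; rewrite uvw wE mulrA.
Qed.

Definition flength (u : dot O) : natm := (weight (pid R (dotval u)))./2.

Lemma flengthK (u : dot O) : weight (pid R (dotval u)) = (flength u).*2.
Proof.
have [uO u0] := dot_nz u; rewrite -[LHS]odd_double_half (negPf (weight_even _ _)) //.
  by apply/pid_integral => //; exact: O_R uO.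
exact: pid_prin.
Qed.

Lemma flength_transfer : transfer_hom flength.
Proof.
have fM (u v : dot O) : flength (u * v)%g = (flength u + flength v)%N.
  apply: double_inj; rewrite -flengthK doubleD -!flengthK /= weightM //; exact: nz_R (dot_nz _).
have f1 : flength 1%g = 0%N by rewrite /flength /= pid1 /weight pfac0 big_nil.
split=> //.
- split.
    have [Q [pQ nQ Q0]] := pe 0; have QP : Q \in Prin by apply/class_eq0.
    have [x [xO x0 cx xE]] := orderly_gen (full (coprimeI_prime pQ nQ) QP) (prime_integral pQ).
    pose X := mkdot (conj xO x0).
    have fX : flength X = 1%N by rewrite /flength /= -xE weight_prime // QP.
    move=> n; exists (X ^+ n)%g, 1%g; split; first by exists 1%g; rewrite mulg1.
    rewrite mulg1; elim: n => [|n IH]; first by rewrite f1.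
    by rewrite expgS fM fX -IH.
  move=> u; rewrite munit_natm -unit_O_dot; have [uO u0] := dot_nz u.
  split=> [f0|u1]; last by rewrite /flength u1 /weight pfac0 big_nil.
  apply: weight_eq0; last by rewrite flengthK f0.
  by apply/pid_integral => //; exact: O_R uO.
- move=> u b c e; have e' : flength u = (b + c)%N by exact: e.
  have [|v [vO vb [w wO uvw]]] := @half_split b (dotval u) (dot_nz u).
    by rewrite flengthK e' leq_double leq_addr.
  have [_ u0] := dot_nz u; have [_ v0] := vO.
  have w0 : w != 0 by apply: contraNneq u0 => w0; rewrite uvw w0 mulr0.
  have uE : u = (mkdot vO * mkdot (conj wO w0))%g by apply/val_inj.
  have arefl (z z' : natm) : z = z' -> massoc z z'.
    by move=> ->; exists 1%g; rewrite ?mul1g //; exists 1%g; rewrite mulg1.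
  have fv : flength (mkdot vO) = b by rewrite /flength /= vb doubleK.
  exists (mkdot vO), (mkdot (conj wO w0)); split=> //; apply: arefl => //.
  by have := fM (mkdot vO) (mkdot (conj wO w0)); rewrite -uE e' fv => /addnI.
Qed.

End HalfFactorial.

(** * The two cases *)

Section Atoms.
Variables (K : fieldType) (R : dedDomain K) (O : orderIn R).
Implicit Types (x y a b c s t u v w : K) (P Q : invideal R).

Lemma class_primes_everywhere : primes_in_all_classes R (cond O) -> primes_everywhere O.
Proof.
move=> pc c; have [P [pP cP Pc]] := pc c; exists P; split=> // -[_ fP].
have : [set` R] 1 by exact: rpred1.
rewrite -cP => -[x Px [y fy xy]]; have [_ P1 _] := pP; apply: P1.
by rewrite -xy; apply: (subD (ival_sub P)) => //; exact: fP.
Qed.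

Lemma conductor_element P : above O P -> exists c, [/\ cond O c, nz O c & 1 <= pval P c].
Proof.
move=> [pP fP]; have [c cf c0] := ord_cond O; exists c; split=> //.
  by split=> //; exact: cond_O cf.
by apply/prime_mem => //; [exact: cond_R cf|exact: fP].
Qed.

Lemma atom_over (inj : inj_contraction O) (p : spec O) (u : dot (localization p)) : atom u ->
  exists P, [/\ over p P, vp p (dotval u) = pval P (dotval u) &
    vp p (dotval u) = 1 \/ above O P /\ exists x, [/\ nz O x, 1 <= pval P x &
      forall v, nz O v -> local_divisor O P x v -> 1 <= pval P v -> vp p (dotval u) = pval P v] ].
Proof.
move=> au; have [np|np] := pselect (nonzero (prime_set p)); last first.
  by case: (zero_spec_atom np au).
have [P pPo] := spec_over np; have u0 : dotval u != 0 by case: (dot_nz u).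
have vE := vp_pval inj pPo u0; exists P; split=> //; rewrite vE.
have [aP|naP] := pselect (above O P); last by left; exact: not_above_atom.
have [x [s [xO sO Ps ux xu]]] := dot_loc_frac pPo u.
right; split=> //; exists x; split=> //; first by rewrite xu; exact: atom_pval_gt0.
by move=> v vO dv v1; exact: (atom_local_divisor pPo au xO sO Ps ux).
Qed.

Lemma atom_below (inj : inj_contraction O) P w : prime_ideal P -> nz O w -> 1 <= pval P w ->
  exists (p : spec O) (a : dot (localization p)) v,
    [/\ over p P, atom a, nz O v, pval P v = vp p (dotval a) & local_divisor O P w v].
Proof.
move=> pP wO w1; have [p pPo] := contraction_spec O pP.
have [a [v [aa vO va dv]]] := local_atom_divisor pPo wO w1.
exists p, a, v; split=> //; rewrite va; symmetry; apply: vp_pval => //.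
by case: (dot_nz a).
Qed.

Lemma over_principal (inj : inj_contraction O) (p : spec O) P (Q : spec R) : over p P ->
  nonzero (prime_set p) -> lies_over Q p -> is_principal R (prime_set Q) -> P \in @principal K R.
Proof.
move=> [pP PE] [z pz z0] Qp prQ; have QE a : a \in O -> prime_set Q a <-> prime_set p a.
  by move=> aO; rewrite -Qp; split=> [|[]].
have [idQ Q1 QM] := spec_prime Q; have [[_ pO] _ _] := spec_prime p.
have [|J JQ] := @ideal_of_set _ R (prime_set Q) idQ.
  by exists z => //; apply/QE => //; exact: pO.
have pJ : prime_ideal J by rewrite /prime_ideal JQ.
suff <- : J = P by apply/asboolP; rewrite JQ.
apply: (inj_contraction_all inj pJ pP) => a aO; rewrite JQ.
by split=> [/(QE a aO)/(PE a aO)|/(PE a aO)/(QE a aO)].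
Qed.

Let unit_valued := forall (p : spec O) (u : dot (localization p)), atom u -> vp p (dotval u) = 1.

Lemma transfer_krull_orders (torR : torsion (Cl R)) (n2 : ~ has_two_elements (Cl R)) :
  primes_everywhere O -> transfer_krull (dot O) -> factor_units O /\ unit_valued.
Proof.
move=> pe [B [theta [krB trB]]]; have [eqv lft] := transfer_lifting krB trB.
have inj := lifting_inj lft torR; have full := primes_everywhere_units lft torR pe n2.
have one P w := local_one lft torR full (P := P) (u := w) pe n2.
split.
  apply: units_full_factor => // P aP; have [c [_ cO c1]] := conductor_element aP.
  by have [v [vO v1 _]] := one P c aP cO c1; exists v.
move=> p u au; have [P [_ _ [//|[aP [x [xO x1 xv]]]]]] := atom_over inj au.
by have [v [vO v1 dv]] := one P x aP xO x1; rewrite (xv v) ?v1.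
Qed.

Lemma unit_valued_divisor (inj : inj_contraction O) : unit_valued ->
  forall P w, above O P -> nz O w -> 1 <= pval P w ->
  exists v, [/\ nz O v, pval P v = 1 & local_divisor O P w v].
Proof.
move=> uv P w [pP _] wO w1; have [p [a [v [_ aa vO va dv]]]] := atom_below inj pP wO w1.
by exists v; rewrite va uv.
Qed.

Let class_two_valued := forall p : spec O,
  (forall u : dot (localization p), atom u -> vp p (dotval u) = 1 \/ vp p (dotval u) = 2) /\
  (forall P : spec R, lies_over P p -> is_principal R (prime_set P) ->
     forall u : dot (localization p), atom u -> vp p (dotval u) = 1).

Lemma transfer_krull_two (torR : torsion (Cl R)) : primes_in_all_classes O (cond O) ->
  transfer_krull (dot O) -> factor_units O /\ class_two_valued.
Proof.
move=> pc [B [theta [krB trB]]]; have [eqv lft] := transfer_lifting krB trB.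
have inj := lifting_inj lft torR; have full := pic_units_full lft torR pc.
have pe := pic_primes_everywhere inj torR pc.
have dich P u n := local_dichotomy lft torR full (P := P) (u := u) (n := n) pe.
split.
  apply: units_full_factor => // P aP; have [pP _] := aP.
  have [c [cf cO c1]] := conductor_element aP; have [y [yR y1]] := pval1_ex pP.
  have [u [n [uO un odd_n]]] : exists u n, [/\ nz O u, pval P u = n.+1%:Z & odd n.+1].
    have [_ c0] := cO; have [yR' y0] := yR.
    case E : (pval P c) c1 => [[|n]|] // _.
    have [on|en] := boolP (odd n.+1); first by exists c, n.
    exists (c * y), n.+1; split; [split; [|exact: mulf_neq0]| |by rewrite oddS en].
      by case: cf => _; exact.
    by rewrite pvalM // E y1 -[n.+2]addn1 PoszD.
  have [[v [vO v1 _]]|[_ _]] := dich P u n aP uO un; first by exists v.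
  by rewrite odd_n.
move=> p; split=> [u au|Q Qp prQ u au].
  have [P [_ _ [v1|[aP [x [xO x1 xv]]]]]] := atom_over inj au; first by left.
  case E : (pval P x) x1 => [[|n]|] // _.
  have [[v [vO v1 dv]]|[_ _ _ [v [vO v2 dv]]]] := dich P x n aP xO E.
    by left; rewrite (xv v) ?v1.
  by right; rewrite (xv v) ?v2.
have [P [pPo _ [//|[aP [x [xO x1 xv]]]]]] := atom_over inj au.
have np : nonzero (prime_set p) by apply: contrapT => np; case: (zero_spec_atom np au).
have PP := over_principal inj pPo np Qp prQ.
case E : (pval P x) x1 => [[|n]|] // _.
have [[v [vO v1 dv]]|[nP]] := dich P x n aP xO E; first by rewrite (xv v) ?v1.
by rewrite PP in nP.
Qed.

Lemma class_two_valued_transfer (torR : torsion (Cl R)) (h2 : has_two_elements (Cl R)) :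
  primes_in_all_classes O (cond O) -> factor_units O -> class_two_valued -> transfer_krull (dot O).
Proof.
move=> pc fu cv; have inj := factor_units_inj fu; have full := factor_units_full fu.
have pe := pic_primes_everywhere inj torR pc.
have one_or_two P w : above O P -> nz O w -> 1 <= pval P w ->
    exists v, [/\ nz O v, pval P v = 1 \/ pval P v = 2 & local_divisor O P w v].
  move=> [pP _] wO w1; have [p [a [v [_ aa vO va dv]]]] := atom_below inj pP wO w1.
  by exists v; rewrite va; split=> //; exact: (proj1 (cv p)).
have prin_one P w : above O P -> P \in @principal K R -> nz O w -> 1 <= pval P w ->
    exists v, [/\ nz O v, pval P v = 1 & local_divisor O P w v].
  move=> [pP _] PP wO w1; have [p [a [v [[_ PE] aa vO va dv]]]] := atom_below inj pP wO w1.
  exists v; rewrite va; split=> //; apply: (proj2 (cv p) (Spec pP)) => //; last by apply/asboolP.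
  have [[_ pO] _ _] := spec_prime p.
  apply/seteqP; split=> [x [Px xO]|x px]; first by apply/PE.
  by split; [apply/PE => //|]; exact: pO.
exists natm, (@flength K R O); split; first exact: krull_natm.
exact: (flength_transfer full inj pe (two_classes h2) one_or_two prin_one).
Qed.

End Atoms.

Lemma order_conductor (K : fieldType) (R O : subringClosed K) : is_order R O -> nonzero (conductor R O).
Proof.
move=> [OR qfO [s sE]].
have [c [cO c0 cs]] : exists c, [/\ c \in O, c != 0 & forall x, x \in s -> c * x \in O].
  elim: s {sE} => [|x s [c [cO c0 cs]]]; first by exists 1; rewrite rpred1 oner_neq0.
  have [a [b [aO bO b0 xE]]] := qfO x; exists (b * c); split; [exact: rpredM|exact: mulf_neq0|].
  move=> y; rewrite inE => /orP[/eqP->|ys]; last by rewrite -mulrA rpredM ?cs.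
  have -> : b * c * x = a * c by rewrite xE; field.
  exact: rpredM.
exists c => //; split=> [|r rR]; first exact: OR.
have : [set` R] r by [].
rewrite sE => -[d [dO ->]]; rewrite mulr_sumr; apply: rpred_sum => i _.
by rewrite mulrCA rpredM ?dO ?cs ?mem_nth.
Qed.

Theorem theorem1 (K : fieldType) (R O : subringClosed K)
    (qfR : is_quotient_field R) (dedR : dedekind R) (torR : torsion (Cl R))
    (ordO : is_order R O)
    (finRf : finite_set (residue R (conductor R O))) :
  (~ has_two_elements (Cl R) -> primes_in_all_classes R (conductor R O) ->
     (transfer_krull (dot O) <->
        (forall x : K, x \in R <->
           exists a e, [/\ a \in O, ring_unit [set` R] e & x = a * e]) /\
        (forall (p : spec O) (u : dot (localization p)),
           atom u -> vp p (val u) = 1)) /\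
     (transfer_krull (dot O) ->
        transfer_hom (dot_incl (order_sub ordO)) /\
        exists theta : dot O -> zerosum (Cl R), transfer_hom theta)) /\
  (has_two_elements (Cl R) -> primes_in_all_classes O (conductor R O) ->
     (transfer_krull (dot O) <->
        (forall x : K, x \in R <->
           exists a e, [/\ a \in O, ring_unit [set` R] e & x = a * e]) /\
        (forall p : spec O,
           (forall u : dot (localization p),
              atom u -> vp p (val u) = 1 \/ vp p (val u) = 2) /\
           (forall P : spec R, lies_over P p -> is_principal R P ->
              forall u : dot (localization p), atom u -> vp p (val u) = 1)))).
Proof.
pose R' := DedDomain qfR dedR.
pose O' := @OrderIn K R' O (order_sub ordO) (order_conductor ordO) finRf.
split=> [n2 pc|h2 pc]; last first.
  split; first exact: (@transfer_krull_two K R' O' torR pc).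
  by move=> [fu cv]; exact: (@class_two_valued_transfer K R' O' torR h2 pc fu cv).
have pe : primes_everywhere O' by exact: (@class_primes_everywhere K R' O' pc).
have fwd := @transfer_krull_orders K R' O' torR n2 pe.
have incl : factor_units O' -> (forall (p : spec O) (u : dot (localization p)),
    atom u -> vp p (val u) = 1) -> transfer_hom (dot_incl (order_sub ordO)).
  move=> fu uv; have inj := factor_units_inj fu; have full := factor_units_full fu.
  exact: (@dot_incl_transfer K R' O' inj full fu (unit_valued_divisor inj uv)).
split; last first.
  move=> tk; have [fu uv] := fwd tk; split; first exact: incl.
  have inj := factor_units_inj fu; have full := factor_units_full fu.
  exists (@block K R' O'); exact: (block_transfer full inj pe (unit_valued_divisor inj uv)).
split; first exact: fwd.
move=> [fu uv]; exists (dot R), (dot_incl (order_sub ordO)); split; first exact: (@krull_dot K R').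
exact: incl.
Qed.
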